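(* Let $f\in V$ and $r\in(0,1)$ satisfy $\limsup_{m\to\infty}\mathrm{var}_m(f)^{1/m}/r^m<\infty$. Let $p>0$ satisfy $r^{2p}e^{h_{\mathrm{top}}(\sigma_{\mathbf A})}<1$. Then: (i) $\sum_{n=1}^\infty|\lambda_n(f)|^p<\infty$. (ii) For every $q\in\mathbb N$ with $q\ge p$, $\sum_{n=1}^\infty\lambda_n(f)^q=\sum_{\omega\in\mathrm{Per}_q(\sigma_{\mathbf A})}e^{S_qf(\omega)}$. (iii) Let $k_0$ be the smallest $k\in\mathbb N\cup\{0\}$ such that $\sum_n|\lambda_n(f)|^{k+1}<\infty$ and the identity in (ii) holds for all $q\in\mathbb N$ with $q>k$. Set $E(z,k_0)=(1-z)\exp(\sum_{k=1}^{k_0}z^k/k)$. Then $\prod_{n=1}^\infty E(z\lambda_n(f),k_0)$ converges uniformly on compact subsets of $\mathbb C$, and $\zeta_f(z)^{-1}=\exp\Big(-\sum_{q=1}^{k_0}\frac{z^q}{q}\sum_{\omega\in\mathrm{Per}_q(\sigma_{\mathbf A})}e^{S_qf(\omega)}\Big)\prod_{n=1}^\infty E(z\lambda_n(f),k_0)$, i.e. the entire function on the right is the holomorphic extension to $\mathbb C$ of $\zeta_f(z)^{-1}$.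
   Context: Let $N\ge2$ and let $\mathbf A$ be an $N\times N$ zero-one aperiodic matrix (some power has all entries positive). $\Sigma_{\mathbf A}^+=\{\omega\in\{1,\dots,N\}^{\mathbb N\cup\{0\}}:\mathbf A(\omega_m\omega_{m+1})=1\ \forall m\}$ with product topology, $\sigma_{\mathbf A}$ the left shift, $h_{\mathrm{top}}(\sigma_{\mathbf A})$ its topological entropy. For $\phi:\Sigma_{\mathbf A}^+\to\mathbb C$, $\mathrm{var}_m(\phi)=\sup\{|\phi(\omega)-\phi(\omega')|:\omega_k=\omega'_k,\ 0\le k\le m-1\}$. $V$ is the set of $\phi$ with $\mathrm{var}_m(\phi)^{1/m}\to0$, topologized by the norms $\|\phi\|_\theta=\|\phi\|_\infty+[\phi]_\theta$, $\theta\in(0,1)$, where $[\phi]_\theta$ is the Lipschitz constant w.r.t. $d_\theta(\omega,\omega')=\theta^{\min\{m:\omega_m\ne\omega'_m\}}$. Transfer operator: $(\mathscr L_f\phi)(\omega)=\sum_{\sigma_{\mathbf A}\omega'=\omega}e^{f(\omega')}\phi(\omega')$ on $V$. $\lambda_1(f),\lambda_2(f),\dots$ are the nonzero eigenvalues of $\mathscr L_f:V\to V$, repeated according to multiplicity, ordered with $|\lambda_n(f)|\ge|\lambda_{n+1}(f)|$, and set to $0$ beyond the last one if there are finitely many. $\mathrm{Per}_q(\sigma_{\mathbf A})=\{\omega:\sigma_{\mathbf A}^q\omega=\omega\}$, $S_qf=\sum_{k=0}^{q-1}f\circ\sigma_{\mathbf A}^k$, and the Ruelle zeta function is $\zeta_f(z)=\exp\big(\sum_{q\ge1}\frac{z^q}{q}\sum_{\omega\in\mathrm{Per}_q(\sigma_{\mathbf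 A})}e^{S_qf(\omega)}\big)$, convergent for small $|z|$. *)

(* Defs.v *)
From HB Require Import structures.
From mathcomp Require Import all_boot all_order all_algebra.
From mathcomp Require Import all_classical all_reals all_analysis.
From mathcomp Require Import complex.
Set Implicit Arguments.
Unset Strict Implicit.
Unset Printing Implicit Defensive.
Import Order.TTheory GRing.Theory Num.Theory.
Import numFieldNormedType.Exports.
Local Open Scope ring_scope.
Local Open Scope classical_set_scope.

Definition seqN (N : nat) := nat -> 'I_N.

Definition zero_one (N : nat) (A : 'M[int]_N) : Prop :=
  forall i j, A i j = 0 \/ A i j = 1.

Definition matpow (N : nat) (A : 'M[int]_N) (k : nat) : 'M[int]_N :=
  iter k (fun B => A *m B) 1%:M.

Definition aperiodic (N : nat) (A : 'M[int]_N) : Prop :=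
  exists k : nat, forall i j, 0 < matpow A k i j.

Definition admissible (N : nat) (A : 'M[int]_N) (w : seqN N) : Prop :=
  forall m : nat, A (w m) (w m.+1) = 1.

Definition SigmaA (N : nat) (A : 'M[int]_N) : set (seqN N) :=
  [set w | admissible A w].

Definition shift (N : nat) (w : seqN N) : seqN N := fun m => w m.+1.

Definition consw (N : nat) (i : 'I_N) (w : seqN N) : seqN N :=
  fun m => if m is m'.+1 then w m' else i.

Definition nwords (N : nat) (A : 'M[int]_N) (n : nat) : nat :=
  #|[set u : n.-tuple 'I_N |
      `[< exists w, SigmaA A w /\ forall k : 'I_n, w (nat_of_ord k) = tnth u k >]]|.

Definition htop (R : realType) (N : nat) (A : 'M[int]_N) : R :=
  limn (fun n : nat => ln ((nwords A n)%:R : R) / n%:R).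

Definition cmod (R : realType) (z : R[i]) : R :=
  Num.sqrt (@complex.Re R z ^+ 2 + @complex.Im R z ^+ 2).

Definition expC (R : realType) (z : R[i]) : R[i] :=
  ((expR (@complex.Re R z))%:C * (cos (@complex.Im R z) +i* sin (@complex.Im R z)))%C.

Definition cvgC (R : realType) (u : nat -> R[i]) (l : R[i]) : Prop :=
  forall eps : R, 0 < eps -> exists M : nat, forall n : nat, (M <= n)%N ->
    cmod (u n - l) <= eps.

Definition var_le (R : realType) (N : nat) (A : 'M[int]_N)
  (phi : seqN N -> R[i]) (m : nat) (c : R) : Prop :=
  forall w w', SigmaA A w -> SigmaA A w' ->
    (forall k, (k < m)%N -> w k = w' k) -> cmod (phi w - phi w') <= c.

(* phi in V:  var_m(phi)^(1/m) -> 0 *)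
Definition inV (R : realType) (N : nat) (A : 'M[int]_N)
  (phi : seqN N -> R[i]) : Prop :=
  forall eps : R, 0 < eps -> exists M : nat, forall m : nat, (M <= m)%N ->
    var_le A phi m (eps ^+ m).

Definition transfer (R : realType) (N : nat) (A : 'M[int]_N)
  (f phi : seqN N -> R[i]) : seqN N -> R[i] :=
  fun w => \sum_(i < N | A i (w 0%N) == 1) expC (f (consw i w)) * phi (consw i w).

Definition Lshift_pow (R : realType) (N : nat) (A : 'M[int]_N)
  (f : seqN N -> R[i]) (mu : R[i]) (k : nat) (phi : seqN N -> R[i]) :
  seqN N -> R[i] :=
  iter k (fun psi => fun w => transfer A f psi w - mu * psi w) phi.

Definition gen_eigvec (R : realType) (N : nat) (A : 'M[int]_N)
  (f : seqN N -> R[i]) (mu : R[i]) (phi : seqN N -> R[i]) : Prop :=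
  inV A phi /\ exists k : nat, forall w, SigmaA A w -> Lshift_pow A f mu k phi w = 0.

Definition lin_indep (R : realType) (N : nat) (A : 'M[int]_N) (m : nat)
  (g : 'I_m -> seqN N -> R[i]) : Prop :=
  forall c : 'I_m -> R[i],
    (forall w, SigmaA A w -> \sum_(j < m) c j * g j w = 0) -> forall j, c j = 0.

(* the algebraic multiplicity of mu as an eigenvalue of L_f : V -> V is m
   (dimension of the generalized eigenspace; m = 0 iff mu is not an eigenvalue) *)
Definition alg_mult_is (R : realType) (N : nat) (A : 'M[int]_N)
  (f : seqN N -> R[i]) (mu : R[i]) (m : nat) : Prop :=
  (exists g : 'I_m -> seqN N -> R[i],
      (forall j, gen_eigvec A f mu (g j)) /\ lin_indep A g) /\
  (forall g : 'I_m.+1 -> seqN N -> R[i],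
      (forall j, gen_eigvec A f mu (g j)) -> ~ lin_indep A g).

(* lam 0, lam 1, ... is (lambda_1(f), lambda_2(f), ...): the nonzero eigenvalues
   of L_f : V -> V repeated according to multiplicity, ordered by nonincreasing
   modulus, and 0 beyond the last one *)
Definition eigen_enum (R : realType) (N : nat) (A : 'M[int]_N)
  (f : seqN N -> R[i]) (lam : nat -> R[i]) : Prop :=
  (forall n, cmod (lam n.+1) <= cmod (lam n)) /\
  forall mu : R[i], mu != 0 ->
    exists m : nat, alg_mult_is A f mu m /\
      exists s : seq nat, [/\ uniq s, size s = m & forall n, lam n = mu <-> n \in s].

Definition Per (N : nat) (A : 'M[int]_N) (q : nat) : set (seqN N) :=
  [set w | SigmaA A w /\ iter q (@shift N) w = w].

Definition Ssum (R : realType) (N : nat) (f : seqN N -> R[i]) (q : nat)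
  (w : seqN N) : R[i] :=
  \sum_(k < q) f (iter k (@shift N) w).

Definition Zper (R : realType) (N : nat) (A : 'M[int]_N) (f : seqN N -> R[i])
  (q : nat) : R[i] :=
  \sum_(w \in Per A q) expC (Ssum f q w).

Definition Efac (R : realType) (k : nat) (z : R[i]) : R[i] :=
  (1 - z) * expC (\sum_(1 <= j < k.+1) z ^+ j / j%:R).

Definition k0_prop (R : realType) (N : nat) (A : 'M[int]_N)
  (f : seqN N -> R[i]) (lam : nat -> R[i]) (k : nat) : Prop :=
  cvgn (series (fun n => cmod (lam n) ^+ k.+1)) /\
  forall q : nat, (k < q)%N ->
    cvgC (fun n => \sum_(j < n) lam j ^+ q) (Zper A f q).

(* Main.v *)
(** Extend every finite word u to a point e(u) of the shift space. The increments
    phi(e(u)) - phi(e(u')), where u' is u without its last letter, are coordinates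
    on V. In them the transfer operator is an infinite matrix M that improves
    decay: size rho^((|u|+t)^2) becomes size rho^((|u|+t+1)^2). Let M_m be M cut off
    at words of length m.
    - The trace of M_m^q tends to the periodic sum Z_q.
    - Let p' = 2j/2^l be a dyadic number below p. Conjugated by the weights
      rho^(|u|^2), M_m^j is a product of 2^l matrices whose Frobenius norms are
      bounded because r^(2p) e^h < 1, so by Weyl's inequality the sum of
      |eigenvalue|^p' is bounded uniformly in m.
    - A small finite-rank change of M_m makes the span of generalized
      eigenvectors of L_f invariant. If these account for all |lambda_n| >= eps,
      the other eigenvalues of M_m are < eps for large m: otherwise the limit of
      eigenvectors along an ultrafilter is a further eigenvector in V.
    Hence sum |lambda_n|^p' is finite, and the sum of lambda_n^q over
    |lambda_n| >= eps misses Z_q by O(eps^(q-p')).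
    For (iii), E(w, n) = 1 + O(|w|^(n+1)) and E(w, k) exp(sum_(k<q<=n) w^q/q) = E(w, n),
    so prod_j E(z lambda_j, k) * exp(sum_(k<q<=n) z^q Z_q / q) = prod_j E(z lambda_j, n),
    which tends to 1 as n grows. *)
Require Import Defs.
From HB Require Import structures.
From mathcomp Require Import all_boot all_order all_algebra.
From mathcomp Require Import all_classical all_reals all_analysis.
From mathcomp Require Import complex zify ring lra.
Set Implicit Arguments.
Unset Strict Implicit.
Unset Printing Implicit Defensive.
Import Order.TTheory GRing.Theory Num.Theory.
Import numFieldNormedType.Exports.
Local Open Scope ring_scope.
Local Open Scope classical_set_scope.

(** The obstacle is that [eigen_enum] knows the lambda_n only through generalized eigenvectors in V,
    so eigenvalues of the cut-off matrices must be matched with them, multiplicities included. An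
    exactly invariant span turns this into a factorization of the characteristic polynomial; the
    other eigenvalues only need a crude smallness bound. The constants: var_m(f) is about r^(m^2),
    and (|u|+j)^2 - |u|^2 >= 2j|u|, so column u of the weighted M_m^j has size rho^(2j|u|). Each of
    the 2^l factors carries the 2^l-th root of this, and the sum over words of its square is that of
    rho^(2p'|u|): here 2p meets the entropy. The strict inequality r^(2p) e^h < 1 is spent twice: on
    p' < p, which lets (ii) reach q = p, and on rho = r^c with c < 1, whose distance from r pays for
    exponential factors and index shifts. For dyadic exponents, repeated square roots reduce Weyl's
    inequality to Schur's. There are at most (2N)^m words while the cut-off errors are of order
    rho^(m^2), so traces converge although the matrices grow. *)

Section Modulus.
Variable R : realType.
Implicit Types (x y z : R[i]) (a b : R).

Lemma cmodE z : `|z| = (cmod z)%:C%C.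
Proof. by rewrite normc_def. Qed.

Lemma cmod_ge0 z : 0 <= cmod z.
Proof. exact: sqrtr_ge0. Qed.

Lemma cmod0 : cmod (0 : R[i]) = 0.
Proof. by apply: complexI; rewrite -cmodE normr0. Qed.

Lemma cmod1 : cmod (1 : R[i]) = 1.
Proof. by apply: complexI; rewrite -cmodE normr1. Qed.

Lemma cmod_eq0 z : (cmod z == 0) = (z == 0).
Proof. by rewrite -(inj_eq (@complexI R)) -cmodE normr_eq0. Qed.

Lemma cmod_gt0 z : (0 < cmod z) = (z != 0).
Proof. by rewrite lt_def cmod_eq0 cmod_ge0 andbT. Qed.

Lemma cmodM x y : cmod (x * y) = cmod x * cmod y.
Proof. by apply: complexI; rewrite rmorphM /= -!cmodE normrM. Qed.

Lemma cmodN x : cmod (- x) = cmod x.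
Proof. by apply: complexI; rewrite -!cmodE normrN. Qed.

Lemma cmodB x y : cmod (x - y) = cmod (y - x).
Proof. by rewrite -cmodN opprB. Qed.

Lemma cmodD x y : cmod (x + y) <= cmod x + cmod y.
Proof. by rewrite -lecR rmorphD /= -!cmodE ler_normD. Qed.

Lemma cmodBD x y : cmod (x - y) <= cmod x + cmod y.
Proof. by rewrite -(cmodN y) cmodD. Qed.

Lemma cmod_dist x y : cmod x <= cmod y + cmod (x - y).
Proof. by rewrite -{1}(subrK y x) addrC cmodD. Qed.

Lemma cmod_tri x y z : cmod (x - z) <= cmod (x - y) + cmod (y - z).
Proof. by rewrite -{1}(subrK y x) -addrA cmodD. Qed.

Lemma cmodX x n : cmod (x ^+ n) = cmod x ^+ n.
Proof. by apply: complexI; rewrite rmorphXn /= -!cmodE normrX. Qed.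

Lemma cmodV x : cmod x^-1 = (cmod x)^-1.
Proof. by apply: complexI; rewrite fmorphV /= -!cmodE normfV. Qed.

Lemma cmodR a : cmod a%:C%C = `|a|.
Proof. by rewrite /cmod /= expr0n addr0 sqrtr_sqr. Qed.

Lemma cmod_nat n : cmod (n%:R : R[i]) = n%:R.
Proof. by apply: complexI; rewrite -cmodE normr_nat rmorph_nat. Qed.

Lemma cmodJ z : cmod z^* = cmod z.
Proof. by apply: complexI; rewrite -!cmodE norm_conjC. Qed.

Lemma cmod_sqr z : (cmod z ^+ 2)%:C%C = z * z^*.
Proof. by rewrite rmorphXn /= -cmodE -normCK. Qed.

Lemma cmod_sum (I : Type) (s : seq I) (P : pred I) (F : I -> R[i]) :
  cmod (\sum_(i <- s | P i) F i) <= \sum_(i <- s | P i) cmod (F i).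
Proof.
elim/big_rec2: _ => [|i a z _ H]; first by rewrite cmod0.
by rewrite (le_trans (cmodD _ _))// lerD2l.
Qed.

Lemma cmod_prod (I : Type) (s : seq I) (P : pred I) (F : I -> R[i]) :
  cmod (\prod_(i <- s | P i) F i) = \prod_(i <- s | P i) cmod (F i).
Proof. by apply: (big_morph _ cmodM cmod1). Qed.

Lemma cmod_Re z : `|@complex.Re R z| <= cmod z.
Proof.
rewrite /cmod -sqrtr_sqr ler_wsqrtr// lerDl sqr_ge0 //.
Qed.

Lemma cmod_Im z : `|@complex.Im R z| <= cmod z.
Proof. by rewrite /cmod -sqrtr_sqr ler_wsqrtr// lerDr sqr_ge0. Qed.

Lemma cmod_ReIm z : cmod z <= `|@complex.Re R z| + `|@complex.Im R z|.
Proof.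
rewrite -[leRHS]ger0_norm ?addr_ge0// -sqrtr_sqr /cmod ler_wsqrtr//.
by rewrite sqrrD !real_normK ?num_real// -addrA addrCA lerDr mulrn_wge0// mulr_ge0.
Qed.

End Modulus.

(** * Eigenvalues and Frobenius norms *)

Section FieldMatrices.
Variable F : fieldType.

Definition roots_of n (A : 'M[F]_n) (s : seq F) :=
  char_poly A = \prod_(x <- s) ('X - x%:P).

Lemma char_poly_conj n (P Q A : 'M[F]_n) :
  P *m Q = 1%:M -> char_poly (P *m A *m Q) = char_poly A.
Proof.
move=> PQ; rewrite /char_poly /char_poly_mx.
have PQX : map_mx polyC P *m map_mx polyC Q = 1%:M by rewrite -map_mxM PQ map_mx1.
have -> : 'X%:M - map_mx polyC (P *m A *m Q) =
   map_mx polyC P *m ('X%:M - map_mx polyC A) *m map_mx polyC Q.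
  rewrite mulmxBr mulmxBl !map_mxM; congr (_ - _).
  by rewrite mul_mx_scalar -scalemxAl PQX scalemx1.
by rewrite !det_mulmx mulrAC -det_mulmx PQX det1 mul1r.
Qed.

(** Multiplying the characteristic matrix on the right by the block matrix with rows [(X, 0)] and
    [(B, 1)] clears the lower left block and leaves [X^2 - A B] and [X] on the diagonal. The extra
    determinants on both sides are [X^n] and cancel. *)
Lemma char_poly_block_antidiag n (A B : 'M[F]_n) :
  char_poly (block_mx 0 A B 0) = char_poly (A *m B) \Po 'X^2.
Proof.
have cX : (char_poly (A *m B)) \Po 'X^2 =
    \det (('X^2)%:M - map_mx polyC (A *m B)).
  rewrite /char_poly /char_poly_mx -[LHS](det_map_mx (comp_poly 'X^2)).
  congr (\det _); rewrite map_mxB map_scalar_mx /= comp_polyX; congr (_ - _).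
  by apply/matrixP => i j; rewrite !mxE comp_polyC.
rewrite cX; set M := map_mx polyC (A *m B).
have Xn : \det ('X%:M : 'M[{poly F}]_n) != 0.
  by rewrite det_scalar expf_neq0// polyX_eq0.
apply: (mulIf Xn).
have -> : char_poly (block_mx 0 A B 0) =
    \det (block_mx ('X%:M) (- map_mx polyC A) (- map_mx polyC B) ('X%:M)).
  rewrite /char_poly /char_poly_mx map_block_mx !map_mx0.
  by rewrite opp_block_mx scalar_mx_block add_block_mx !oppr0 !addr0 !add0r.
have -> : \det ('X%:M : 'M[{poly F}]_n) =
    \det (block_mx ('X%:M : 'M[{poly F}]_n) 0 (map_mx polyC B) (1%:M : 'M[{poly F}]_n)).
  by rewrite det_lblock det1 mulr1.
rewrite -det_mulmx mulmx_block !mulmx0 !mulmx1 !add0r.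
rewrite -!scalar_mxM -expr2 mulNmx -map_mxM.
rewrite mulNmx mul_mx_scalar mul_scalar_mx addNr det_ublock.
by rewrite det_lblock det1 mulr1.
Qed.

(** In the row convention the span of the rows of [V] is invariant under [A], with restriction [T],
    and [Y *m V] projects onto it. So [A *m (1%:M - Y *m V)] carries the quotient action and kills
    the span, which accounts for the factor ['X^n]. *)
Lemma char_poly_split n D (A : 'M[F]_D) (V : 'M[F]_(n, D)) (Y : 'M[F]_(D, n))
    (T : 'M[F]_n) :
  V *m A = T *m V -> V *m Y = 1%:M ->
  char_poly A * 'X^n = char_poly (A *m (1%:M - Y *m V)) * char_poly T.
Proof.
move=> VA VY.
pose N := A *m (1%:M - Y *m V).
have big1 : char_poly (block_mx N (A *m Y) 0 T) = char_poly N * char_poly T.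
  rewrite /char_poly /char_poly_mx map_block_mx map_mx0 scalar_mx_block.
  by rewrite opp_block_mx add_block_mx oppr0 addr0 add0r det_ublock.
have big2 : char_poly (block_mx A (A *m Y) 0 (0 : 'M[F]_n)) = char_poly A * 'X^n.
  rewrite /char_poly /char_poly_mx map_block_mx !map_mx0 scalar_mx_block.
  rewrite opp_block_mx add_block_mx !oppr0 !addr0 add0r det_ublock.
  by rewrite det_scalar.
rewrite -big1 -big2.
pose P : 'M[F]_(D + n) := block_mx 1%:M 0 V 1%:M.
pose Q : 'M[F]_(D + n) := block_mx 1%:M 0 (- V) 1%:M.
have QP : Q *m P = 1%:M.
  rewrite mulmx_block !mulmx0 !mul0mx !mul1mx !mulmx1 !addr0 add0r addNr.
  by rewrite -scalar_mx_block.
rewrite -[RHS](char_poly_conj _ QP); congr char_poly.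
rewrite /Q /P mulmx_block !mul0mx !mul1mx !addr0.
rewrite mulmx_block !mulmx0 !mulmx1 !add0r.
have -> : N + A *m Y *m V = A.
  by rewrite /N mulmxBr mulmx1 mulmxA subrK.
have -> : - V *m (A *m Y) + T = 0.
  by rewrite mulNmx mulmxA VA -mulmxA VY mulmx1 addNr.
have VN : V *m N = 0.
  by rewrite /N mulmxA VA mulmxBr mulmx1 mulmxA -[T *m V *m Y]mulmxA VY mulmx1 subrr.
by rewrite mulNmx VN oppr0 add0r mul0mx.
Qed.

End FieldMatrices.

Section ClosedFieldMatrices.
Variable C : numClosedFieldType.
Local Notation "M ^t*" := (map_mx Num.conj M^T) (at level 30).

Lemma schur_form n (A : 'M[C]_n) : exists P : 'M[C]_n,
  P \is unitarymx /\ is_trig_mx (P *m A *m P^t*).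
Proof.
case: n A => [|n] A.
  exists 1%:M; split; first by apply/unitarymxP/matrixP => -[].
  by apply/is_trig_mxP => -[].
have [|P Pu AT] := Schur A; first by [].
exists P; split; first exact: Pu.
have E := conjymx A Pu; move: AT; rewrite /similar_to E.
exact: id.
Qed.

Lemma roots_of_sum n (A P : 'M[C]_n) (s : seq C) (V : nmodType) (g : C -> V) :
  P \is unitarymx -> is_trig_mx (P *m A *m P^t*) -> roots_of A s ->
  \sum_(x <- s) g x = \sum_(i < n) g ((P *m A *m P^t*) i i).
Proof.
move=> Pu T As; set B := _ *m _ *m _ in T *.
have : char_poly B = char_poly A.
  by apply: char_poly_conj; apply/unitarymxP.
rewrite As char_poly_trig// => /esym.
rewrite -(big_map (fun i => B i i) xpredT (fun x => 'X - x%:P)).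
move=> /prod_XsubC_eq sT; rewrite (perm_big _ sT) /=.
by rewrite big_map.
Qed.

Lemma is_trig_mxM n (A B : 'M[C]_n) : is_trig_mx A -> is_trig_mx B ->
  is_trig_mx (A *m B) /\ forall i, (A *m B) i i = A i i * B i i.
Proof.
move=> /is_trig_mxP At /is_trig_mxP Bt; split.
  apply/is_trig_mxP => i j ij; rewrite mxE big1// => k _.
  have [ik|ki] := ltnP i k; first by rewrite At// mul0r.
  by rewrite Bt ?mulr0// (leq_ltn_trans ki).
move=> i; rewrite mxE (bigD1 i)//= big1 ?addr0// => k ki.
have [ik|ik] := ltnP i k; first by rewrite At// mul0r.
by rewrite Bt ?mulr0// ltn_neqAle ik andbT.
Qed.

Lemma unitary_conjX n (A P : 'M[C]_n) q : P \is unitarymx ->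
  P *m (A ^+ q) *m P^t* = (P *m A *m P^t*) ^+ q.
Proof.
move=> Pu; have PP : P^t* *m P = 1%:M.
  by apply: mulmx1C; apply/unitarymxP.
elim: q => [|q IH]; first by rewrite !expr0 mulmx1; apply/unitarymxP.
rewrite !exprS -IH -!mulmxE.
by rewrite !mulmxA -[_ *m P^t* *m P]mulmxA PP mulmx1.
Qed.

Lemma is_trig_mxX n (A : 'M[C]_n) q : is_trig_mx A ->
  is_trig_mx (A ^+ q) /\ forall i, (A ^+ q) i i = A i i ^+ q.
Proof.
move=> At; elim: q => [|q [IH1 IH2]].
  rewrite expr0; split; last by move=> i; rewrite mxE eqxx expr0.
  apply/is_trig_mxP => i j ij; rewrite mxE; case: eqP ij => // ->.
  by rewrite ltnn.
rewrite exprS -mulmxE; have [T E] := is_trig_mxM At IH1.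
by split=> // i; rewrite E IH2 exprS.
Qed.

Lemma roots_ofX n (A : 'M[C]_n) (s : seq C) q :
  roots_of A s -> roots_of (A ^+ q) [seq x ^+ q | x <- s].
Proof.
move=> As; have [P [Pu T]] := schur_form A.
have [TX EX] := is_trig_mxX q T.
rewrite /roots_of big_map.
have <- : char_poly (P *m (A ^+ q) *m P^t*) = char_poly (A ^+ q).
  by apply: char_poly_conj; apply/unitarymxP.
rewrite unitary_conjX// char_poly_trig//.
set B := P *m A *m P^t* in T TX EX *.
rewrite (eq_bigr (fun i => 'X - (B i i ^+ q)%:P)); last first.
  by move=> i _; congr ('X - _%:P); exact: EX.
have := As; rewrite /roots_of.
have <- : char_poly (P *m A *m P^t*) = char_poly A.
  by apply: char_poly_conj; apply/unitarymxP.
rewrite char_poly_trig//.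
rewrite -(big_map (fun i => B i i) xpredT (fun x => 'X - x%:P)).
move=> /prod_XsubC_eq sT.
rewrite -(perm_big _ sT) /= big_map.
by apply: eq_bigr.
Qed.

Lemma roots_of_trace n (A : 'M[C]_n) (s : seq C) q :
  roots_of A s -> \tr (A ^+ q) = \sum_(x <- s) x ^+ q.
Proof.
move=> As; have [P [Pu T]] := schur_form A.
rewrite (roots_of_sum (fun x => x ^+ q) Pu T As).
have [TX EX] := is_trig_mxX q T.
under eq_bigr do rewrite -EX.
rewrite -/(\tr _) -unitary_conjX// mxtrace_mulC mulmxA.
by rewrite (_ : P^t* *m P = 1%:M) ?mul1mx//; apply: mulmx1C; apply/unitarymxP.
Qed.

Lemma roots_of_exists n (A : 'M[C]_n) : exists s, roots_of A s.
Proof.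
have [s sE] := closed_field_poly_normal (char_poly A).
exists s; rewrite /roots_of {1}sE.
by rewrite (monicP (char_poly_monic A)) scale1r.
Qed.

End ClosedFieldMatrices.

Section ComplexMatrices.
Variable R : realType.
Local Notation C := R[i].
Local Notation "M ^t*" := (map_mx Num.conj M^T) (at level 30).

Definition frob2 m n (A : 'M[C]_(m, n)) : R := \sum_i \sum_j cmod (A i j) ^+ 2.

Lemma frob2_trace m n (A : 'M[C]_(m, n)) : (frob2 A)%:C%C = \tr (A *m A^t*).
Proof.
rewrite rmorph_sum /=; apply: eq_bigr => i _.
rewrite rmorph_sum mxE /=; apply: eq_bigr => j _.
by rewrite !mxE cmod_sqr.
Qed.

Lemma frob2_unitary n (A P : 'M[C]_n) :
  P \is unitarymx -> frob2 (P *m A *m P^t*) = frob2 A.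
Proof.
move=> Pu; apply: complexI; rewrite !frob2_trace.
have PP : P^t* *m P = 1%:M by apply: mulmx1C; apply/unitarymxP.
have PtK : (P^t*)^t* = P by rewrite trmxCK.
rewrite !trmx_mul !map_mxM PtK !mulmxA.
rewrite -[_ *m P^t* *m P]mulmxA PP mulmx1 mxtrace_mulC !mulmxA PP.
by rewrite mul1mx.
Qed.

Lemma frob2_block m n p q (A : 'M[C]_(m, p)) (B : 'M[C]_(m, q))
  (D : 'M[C]_(n, p)) (E : 'M[C]_(n, q)) :
  frob2 (block_mx A B D E) = frob2 A + frob2 B + (frob2 D + frob2 E).
Proof.
rewrite /frob2 big_split_ord /= -!big_split /=.
congr (_ + _); apply: eq_bigr => i _; rewrite big_split_ord /=.
  by congr (_ + _); apply: eq_bigr => j _; rewrite ?block_mxEul ?block_mxEur.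
by congr (_ + _); apply: eq_bigr => j _; rewrite ?block_mxEdl ?block_mxEdr.
Qed.

Lemma frob20 m n : frob2 (0 : 'M[C]_(m, n)) = 0.
Proof.
by rewrite /frob2 big1// => i _; rewrite big1// => j _; rewrite mxE cmod0 expr0n.
Qed.

(** A unitary change of basis keeps the Frobenius norm and puts the eigenvalues on the diagonal of a
    triangular matrix. *)
Lemma schur_inequality n (A : 'M[C]_n) s :
  roots_of A s -> \sum_(x <- s) cmod x ^+ 2 <= frob2 A.
Proof.
move=> As; have [P [Pu T]] := schur_form A.
rewrite (roots_of_sum (fun x => cmod x ^+ 2) Pu T As) -(frob2_unitary A Pu).
by apply: ler_sum => i _; rewrite (bigD1 i)//= lerDl sumr_ge0// => j; rewrite sqr_ge0.
Qed.

Lemma roots_of_antidiag n (A B : 'M[C]_n) (s : seq C) :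
  roots_of (A *m B) s ->
  roots_of (block_mx 0 A B 0) ([seq sqrtC x | x <- s] ++ [seq - sqrtC x | x <- s]).
Proof.
rewrite /roots_of char_poly_block_antidiag => ->.
rewrite big_cat !big_map /= -big_split /=.
rewrite rmorph_prod /=; apply: eq_bigr => x _.
rewrite comp_polyB comp_polyX comp_polyC polyCN opprK -subr_sqr.
by rewrite -rmorphXn /= sqrtCK.
Qed.

Lemma block_antidiag_prod n m (A B : nat -> 'M[C]_n) :
  \prod_(i < m) (block_mx (A i) 0 0 (B i)) * block_mx 0 (A m) (B m) 0 =
  block_mx 0 (\prod_(i < m.+1) A i) (\prod_(i < m.+1) B i) 0.
Proof.
have H : \prod_(i < m) (block_mx (A i) 0 0 (B i)) =
   block_mx (\prod_(i < m) A i) 0 0 (\prod_(i < m) B i).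
  elim: m => [|m IH]; first by rewrite !big_ord0 -scalar_mx_block.
  rewrite !big_ord_recr /= IH -!mulmxE mulmx_block.
  by rewrite !mul0mx !mulmx0 !addr0 !add0r.
rewrite H -mulmxE mulmx_block !mul0mx !mulmx0 !addr0 !add0r.
by rewrite !big_ord_recr.
Qed.

(* A product of [2 ^ l.+1] factors [Q1 Q2] is traded for the block antidiagonal
   matrix with blocks [Q1, Q2]: it is a product of [2 ^ l] factors with the same
   total Frobenius norm, and its eigenvalues are the square roots of those of
   [Q1 Q2], each taken with both signs. *)
Lemma schatten_prod l n (A : nat -> 'M[C]_n) (s : seq C) :
  roots_of (\prod_(i < 2 ^ l) A i) s ->
  \sum_(x <- s) cmod x `^ (2 / (2 ^ l)%:R) <=
    (\sum_(i < 2 ^ l) frob2 (A i)) / (2 ^ l)%:R.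
Proof.
elim: l n A s => [|l IH] n A s.
  rewrite expn0 !big_ord_recl !big_ord0 mulr1 addr0 !divr1 => As.
  under eq_bigr do rewrite powR_mulrn ?cmod_ge0//.
  exact: schur_inequality.
set h := (2 ^ l)%N in IH *.
have h0 : (0 < h)%N by rewrite expn_gt0.
have hE : (2 ^ l.+1 = h + h)%N by rewrite expnS mul2n addnn.
rewrite hE big_split_ord /= => As.
(* The two half products run side by side in diagonal blocks. Only the last factor is antidiagonal:
   this makes the product antidiagonal, so that its eigenvalues come from [Q1 Q2] and not from [Q1]
   and [Q2] separately. *)
pose B (i : nat) : 'M[C]_(n + n) :=
  if (i < h.-1)%N then block_mx (A i) 0 0 (A (h + i)%N)
  else block_mx 0 (A i) (A (h + i)%N) 0.
have hp : h.-1.+1 = h by rewrite prednK.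
have BE : \prod_(i < h) B i =
   block_mx 0 (\prod_(i < h) A i) (\prod_(i < h) A (h + i)%N) 0.
  have := block_antidiag_prod h.-1 A (fun i => A (h + i)%N).
  rewrite hp => <-; transitivity (\prod_(i < h.-1.+1) B i); first by rewrite hp.
  rewrite big_ord_recr /= {2}/B ltnn; congr (_ * _).
  by apply: eq_bigr => i _; rewrite /B ltn_ord.
have /roots_of_antidiag := As; rewrite -BE => /IH.
rewrite big_cat !big_map /=.
under [X in _ + X]eq_bigr do rewrite cmodN.
rewrite -mulr2n.
have -> : \sum_(i < h) frob2 (B i) = \sum_(i < h + h) frob2 (A i).
  rewrite big_split_ord /= -big_split /=; apply: eq_bigr => i _.
  by rewrite /B; case: ifP => _; rewrite frob2_block !frob20 ?addr0 ?add0r.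
have E : forall x : C, cmod x `^ (2 / (h + h)%:R) =
    cmod (sqrtC x) `^ (2 / h%:R).
  move=> x; rewrite -{1}(sqrtCK x) cmodX -powR_mulrn ?cmod_ge0// -powRrM.
  congr (_ `^ _); rewrite natrD; field.
  by rewrite -natrD !pnatr_eq0 -!lt0n addn_gt0 h0.
move=> le2; under eq_bigr do rewrite E.
have hh : (h + h)%:R = h%:R * 2 :> R by rewrite natrD; ring.
rewrite hh invfM mulrA ler_pdivlMr//.
by move: le2; rewrite mulr2n mulrDr mulr1.
Qed.

End ComplexMatrices.

(** * Words and increments *)

Section OperatorMatrices.
Variable C : comNzRingType.

Definition is_lin (T T' : Type) (F : (T -> C) -> T' -> C) :=
  forall a x y t, F (fun s => a * x s + y s) t = a * F x t + F y t.

(* Row-vector convention: row [i] is the image of the [i]-th basis function. *)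
Definition opmx (T T' : finType) (F : (T -> C) -> T' -> C) : 'M[C]_(#|T|, #|T'|) :=
  \matrix_(i, j) F (fun t => (t == enum_val i)%:R) (enum_val j).

Definition vec (T : finType) (x : T -> C) : 'rV[C]_#|T| := \row_i x (enum_val i).

Definition unvec (T : finType) (v : 'rV[C]_#|T|) : T -> C := fun t => v 0 (enum_rank t).

Lemma unvecK (T : finType) : cancel (@unvec T) (@vec T).
Proof. by move=> v; apply/rowP => i; rewrite mxE /unvec enum_valK. Qed.

Lemma is_lin0 (T T' : Type) (F : (T -> C) -> T' -> C) : is_lin F ->
  forall t, F (fun=> 0) t = 0.
Proof.
move=> lF t; have := lF (-1) (fun=> 0) (fun=> 0) t.
rewrite (_ : (fun=> _) = fun=> 0); last by apply/funext => s; rewrite mulr0 addr0.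
by rewrite mulN1r addNr.
Qed.

Lemma is_lin_sum (T T' : Type) (F : (T -> C) -> T' -> C) (I : Type) (s : seq I)
    (a : I -> C) (x : I -> T -> C) t : is_lin F ->
  F (fun t => \sum_(i <- s) a i * x i t) t = \sum_(i <- s) a i * F (x i) t.
Proof.
move=> lF; elim: s => [|i s IH].
  by rewrite big_nil -[RHS](is_lin0 lF t); congr (F _ t); apply/funext => u; rewrite big_nil.
rewrite big_cons -IH -lF; congr (F _ t).
by apply/funext => u; rewrite big_cons.
Qed.

Lemma vec_opmx (T T' : finType) (F : (T -> C) -> T' -> C) (x : T -> C) :
  is_lin F -> vec x *m opmx F = vec (F x).
Proof.
move=> lF; apply/rowP => j; rewrite !mxE.
have xE : x = fun t => \sum_(i < #|T|) x (enum_val i) * (t == enum_val i)%:R.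
  apply/funext => t; rewrite (bigD1 (enum_rank t))//= enum_rankK eqxx mulr1.
  rewrite big1 ?addr0// => i it; rewrite (_ : (t == _) = false) ?mulr0//.
  by apply: contraNF it => /eqP ->; rewrite enum_valK.
rewrite [in RHS]xE is_lin_sum//.
by apply: eq_bigr => i _; rewrite !mxE.
Qed.

Lemma opmx_comp (T T' T'' : finType) (F : (T -> C) -> T' -> C)
    (G : (T' -> C) -> T'' -> C) : is_lin G ->
  opmx (G \o F) = opmx F *m opmx G.
Proof.
move=> lG; apply/matrixP => i j.
have := congr1 (fun v : 'rV_ _ => v 0 j)
  (vec_opmx (F (fun t => (t == enum_val i)%:R)) lG).
rewrite !mxE /= => <-.
by apply: eq_bigr => k _; rewrite !mxE.
Qed.

Lemma opmxX (T : finType) (F : (T -> C) -> T -> C) q : is_lin F ->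
  opmx F ^+ q = opmx (iter q F).
Proof.
move=> lF; elim: q => [|q IH].
  rewrite expr0; apply/matrixP => i j; rewrite !mxE /=.
  by rewrite (inj_eq enum_val_inj) eq_sym.
by rewrite exprSr -mulmxE IH -opmx_comp.
Qed.

Lemma trace_opmx (T : finType) (F : (T -> C) -> T -> C) :
  \tr (opmx F) = \sum_(t : T) F (fun s => (s == t)%:R) t.
Proof.
rewrite /mxtrace (reindex enum_rank) /=; last first.
  by apply: onW_bij; exact: enum_rank_bij.
by apply: eq_bigr => t _; rewrite mxE enum_rankK.
Qed.

End OperatorMatrices.

Section Words.
Variables (N : nat) (A : 'M[int]_N) (i0 : 'I_N).
Implicit Types (u v : seq 'I_N) (w : seqN N).

Definition pre (a : nat) w : seq 'I_N := mkseq w a.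

Definition adm u : bool := `[< exists2 w, SigmaA A w & pre (size u) w = u >].

(* Junk value [i] if no point of [SigmaA A] starts with [i]. *)
Definition nx (i : 'I_N) : 'I_N :=
  if pselect (exists w, SigmaA A w /\ w 0%N = i) is left h
  then projT1 (cid h) 1%N else i.

(* The continuation of a word depends on its last letter only; this makes
   extension compatible with truncation, see [ext_pre_ext]. *)
Definition ext u : seqN N := fun t =>
  if (t < size u)%N then nth i0 u t else iter (t - size u).+1 nx (last i0 u).

Lemma size_pre a w : size (pre a w) = a.
Proof. exact: size_mkseq. Qed.

Lemma eq_pre a w w' : (forall k, (k < a)%N -> w k = w' k) -> pre a w = pre a w'.
Proof.
move=> H; apply: (@eq_from_nth _ i0); rewrite ?size_pre// => k ka.
by rewrite !nth_mkseq// H.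
Qed.

Lemma nth_pre a w k : (k < a)%N -> nth i0 (pre a w) k = w k.
Proof. exact: nth_mkseq. Qed.

Lemma take_pre a b w : (b <= a)%N -> take b (pre a w) = pre b w.
Proof.
move=> ba; apply: (@eq_from_nth _ i0); rewrite ?size_takel ?size_pre//.
by move=> k kb; rewrite nth_take// !nth_pre// (leq_trans kb).
Qed.

Lemma pre_ext u a : (a <= size u)%N -> pre a (ext u) = take a u.
Proof.
move=> au; apply: (@eq_from_nth _ i0); rewrite size_pre ?size_takel//.
move=> k ka; rewrite nth_pre// nth_take// /ext.
by rewrite (leq_trans ka au).
Qed.

Lemma pre_size_ext u : pre (size u) (ext u) = u.
Proof. by rewrite pre_ext// take_size. Qed.

Lemma adm_pre a w : SigmaA A w -> adm (pre a w).
Proof. by move=> Sw; apply/asboolP; exists w => //; rewrite size_pre. Qed.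

Lemma ext_lt u t : (t < size u)%N -> ext u t = nth i0 u t.
Proof. by move=> tu; rewrite /ext tu. Qed.

Lemma ext_ge u t : (0 < size u)%N -> ((size u).-1 <= t)%N ->
  ext u t = iter (t - (size u).-1) nx (last i0 u).
Proof.
move=> u0; rewrite /ext; case: ltnP => tu ut.
  have -> : t = (size u).-1 by apply/eqP; rewrite eqn_leq ut andbT -ltnS prednK.
  by rewrite subnn /= nth_last.
by rewrite -subSn// -subn1 subnBA// addn1.
Qed.

Lemma nx_alive i : (exists w, SigmaA A w /\ w 0%N = i) ->
  A i (nx i) = 1 /\ exists w, SigmaA A w /\ w 0%N = nx i.
Proof.
rewrite /nx; case: pselect => // h _; case: (cid h) => w [Sw wi] /=; split.
  by rewrite -wi; exact: Sw.
by exists (Defs.shift w); split=> // k; apply: Sw.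
Qed.

Lemma SigmaA_ext u : (0 < size u)%N -> adm u -> SigmaA A (ext u).
Proof.
move=> u0 /asboolP[w Sw wu] t.
have [tu|ut] := ltnP t.+1 (size u).
  rewrite !ext_lt// 1?ltnW// -wu !nth_pre// 1?ltnW//; exact: Sw.
have ut' : ((size u).-1 <= t)%N by rewrite -ltnS prednK.
rewrite !ext_ge//; last exact: leqW.
rewrite subSn//=.
have [|H _] := @nx_alive (iter (t - (size u).-1) nx (last i0 u)); last exact: H.
(* Invariant: the current letter starts some point of the shift space. For the last letter of [u]
   such a point is a suffix of the witness [w]. *)
elim: (t - _)%N => [|k IH] /=; last by have [] := nx_alive IH.
exists (fun k => w ((size u).-1 + k)%N); split.
  by move=> k; rewrite addnS; apply: Sw.
by rewrite addn0 -nth_last -{2}wu nth_pre// prednK.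
Qed.

Lemma ext_pre_ext u a : (0 < size u)%N -> (size u <= a)%N ->
  ext (pre a (ext u)) = ext u.
Proof.
move=> u0 ua; apply/funext => t; have [ta|at'] := ltnP t a.
  by rewrite ext_lt ?size_pre// nth_pre.
have a0 : (0 < a)%N by rewrite (leq_trans u0).
rewrite ext_ge ?size_pre//; last by rewrite (leq_trans (leq_pred _)).
rewrite -nth_last size_pre nth_pre ?prednK//.
have ua' : ((size u).-1 <= a.-1)%N by rewrite -!subn1 leq_sub2r.
rewrite !ext_ge//; last by rewrite (leq_trans ua')// (leq_trans (leq_pred _)).
rewrite -iterD; congr (iter _ _ _).
rewrite addnBA// subnK//.
by rewrite (leq_trans (leq_pred _)).
Qed.

Lemma SigmaA_cons i w : SigmaA A w -> A i (w 0%N) = 1 -> SigmaA A (consw i w).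
Proof. by move=> Sw Ai [|k] //=; apply: Sw. Qed.

Lemma nwordsE n : nwords A n = #|[set u : n.-tuple 'I_N | adm u]%SET|.
Proof.
apply: eq_card => u; rewrite [RHS]inE; apply/idP/idP.
  move=> /set_mem /asboolP[w [Sw wu]]; apply/asboolP; exists w; first exact: Sw.
  apply: (@eq_from_nth _ i0); first by rewrite size_pre.
  move=> k; rewrite size_pre => ku; rewrite nth_pre//.
  have kn : (k < n)%N by rewrite -(size_tuple u).
  by rewrite (wu (Ordinal kn)) (tnth_nth i0).
move=> /asboolP[w Sw wu]; apply/mem_set/asboolP; exists w; split=> // k.
by rewrite (tnth_nth i0) -wu nth_pre// size_tuple.
Qed.

Lemma adm_take u a : adm u -> adm (take a u).
Proof.
move=> /asboolP[w Sw wu]; apply/asboolP; exists w => //.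
rewrite size_take_min -{2}wu.
have [au|ua] := leqP a (size u); first by rewrite take_pre.
by rewrite take_oversize ?size_pre// ltnW.
Qed.

End Words.

(** * Truncated transfer matrices and the trace formula *)

Section TransferAlgebra.
Variables (N : nat) (A : 'M[int]_N) (i0 : 'I_N) (C : comNzRingType).
Implicit Types (u : seq 'I_N) (w : seqN N) (phi : seqN N -> C).

Local Notation ext := (ext A i0).
Local Notation adm := (adm A).

(** With [g = expC \o f] this is [transfer A f] up to conversion. The weight stays abstract because
    the trace computation also uses the truncated weight [gcut]. *)
Definition Lw (g phi : seqN N -> C) : seqN N -> C :=
  fun w => \sum_(i < N | A i (w 0%N) == 1) g (consw i w) * phi (consw i w).

Definition Sop m (x : seq 'I_N -> C) w : C := \sum_(b < m) x (pre b.+1 w).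

(* The increment of [phi] due to the last letter of [u]; the increments are
   coordinates for [phi], since summing them up along the prefixes of a point
   with [Sop] gives [phi] back. *)
Definition Jop phi u : C :=
  if adm u && (0 < size u)%N then
    phi (ext u) - (if (1 < size u)%N then phi (ext (take (size u).-1 u)) else 0)
  else 0.

Definition zext m (x : m.-bseq 'I_N -> C) u : C := oapp x 0 (insub u).

(* The transfer operator in these coordinates, cut off at words of length [m]. *)
Definition Mop m g (x : m.-bseq 'I_N -> C) (t : m.-bseq 'I_N) : C :=
  Jop (Lw g (Sop m (zext x))) t.

Lemma zext_lin m : is_lin (@zext m).
Proof.
by move=> a x y u; rewrite /zext; case: insubP => [t _ _|_] /=; rewrite ?mulr0 ?addr0.
Qed.

Lemma zext_val m (x : m.-bseq 'I_N -> C) (t : m.-bseq 'I_N) : zext x t = x t.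
Proof. by rewrite /zext valK. Qed.

Lemma zext_in m (x : seq 'I_N -> C) u : (size u <= m)%N ->
  zext (fun t : m.-bseq 'I_N => x t) u = x u.
Proof. by move=> um; rewrite /zext insubT. Qed.

Lemma Sop_lin m : is_lin (Sop m).
Proof.
by move=> a x y w; rewrite /Sop mulr_sumr -big_split; apply: eq_bigr.
Qed.

Lemma Lw_lin g : is_lin (Lw g).
Proof.
move=> a x y w; rewrite /Lw mulr_sumr -big_split; apply: eq_bigr => i _ /=.
by rewrite mulrDr mulrCA.
Qed.

Lemma Jop_lin : is_lin Jop.
Proof.
move=> a x y u; rewrite /Jop; case: ifP => _; last by rewrite mulr0 addr0.
by case: ifP => _; ring.
Qed.

Lemma comp_lin (T1 T2 T3 : Type) (F : (T1 -> C) -> T2 -> C)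
  (G : (T2 -> C) -> T3 -> C) : is_lin F -> is_lin G -> is_lin (G \o F).
Proof.
move=> lF lG a x y t /=; rewrite -lG; congr (G _ t).
by apply/funext => s; rewrite lF.
Qed.

Lemma Mop_lin m g : is_lin (@Mop m g).
Proof.
move=> a x y t.
by have := comp_lin (comp_lin (comp_lin (@zext_lin m) (Sop_lin m)) (Lw_lin g)) Jop_lin
   a x y t.
Qed.

Lemma Lw_eq g phi psi w : SigmaA A w ->
  (forall w, SigmaA A w -> phi w = psi w) -> Lw g phi w = Lw g psi w.
Proof.
move=> Sw E; apply: eq_bigr => i /eqP Ai; rewrite E//.
exact: SigmaA_cons.
Qed.

Lemma Jop_eq phi psi u :
  (forall v, adm v -> (0 < size v <= size u)%N -> phi (ext v) = psi (ext v)) ->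
  Jop phi u = Jop psi u.
Proof.
move=> E; rewrite /Jop; case: ifP => // /andP[au u0]; rewrite (E u) ?u0 ?leqnn//.
case: ifP => // u1; rewrite E//; first exact: adm_take.
by rewrite size_takel ?leq_pred//; lia.
Qed.

(** The increments telescope along the prefixes of [w]; stopping at length [m] replaces [w] by the
    standard extension of its first [m] letters. *)
Lemma Sop_Jop m phi w : SigmaA A w -> (0 < m)%N ->
  Sop m (Jop phi) w = phi (ext (pre m w)).
Proof.
move=> Sw; case: m => // m _; rewrite /Sop.
elim: m => [|m IH].
  by rewrite big_ord_recl big_ord0 addr0 /Jop size_pre adm_pre// subr0.
rewrite big_ord_recr IH /Jop size_pre adm_pre// [(m.+2).-1]/= take_pre//= .
by rewrite addrC subrK.
Qed.

Lemma Sop_eq m x y w : (forall b, (0 < b <= m)%N -> x (pre b w) = y (pre b w)) ->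
  Sop m x w = Sop m y w.
Proof. by move=> E; apply: eq_bigr => b _; rewrite E /=. Qed.

Lemma Sop_pre m x w w' : pre m w = pre m w' -> Sop m x w = Sop m x w'.
Proof.
move=> E; apply: eq_bigr => b _.
by rewrite -(@take_pre _ i0 m)// E take_pre.
Qed.

Definition pret m w : m.-tuple 'I_N := [tuple w i | i < m].

Lemma pretE m w : pret m w = pre m w :> seq _.
Proof. by rewrite /pret /pre /mkseq -val_enum_ord -map_comp. Qed.

(* Cyclicity of the trace moves powers of [Mop] to functions of the first [m]
   letters, where the trace becomes a sum over cycles. *)
Definition Bop m g (y : m.-tuple 'I_N -> C) (u : m.-tuple 'I_N) : C :=
  if adm u then Lw g (fun w => y (pret m w)) (ext u) else 0.

Definition Jm m (y : m.-tuple 'I_N -> C) (t : m.-bseq 'I_N) : C :=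
  Jop (fun w => y (pret m w)) t.

Definition Sm m (x : m.-bseq 'I_N -> C) (u : m.-tuple 'I_N) : C :=
  if adm u then Sop m (zext x) (ext u) else 0.

Lemma Bop_lin m g : is_lin (@Bop m g).
Proof.
move=> a x y u; rewrite /Bop; case: ifP => _; last by rewrite mulr0 addr0.
by rewrite -Lw_lin.
Qed.

Lemma Jm_lin m : is_lin (@Jm m).
Proof. by move=> a x y u; rewrite /Jm -Jop_lin. Qed.

Lemma Sm_lin m : is_lin (@Sm m).
Proof.
move=> a x y u; rewrite /Sm; case: ifP => _; last by rewrite mulr0 addr0.
by rewrite -Sop_lin; congr (Sop m _ _); apply/funext => v; rewrite zext_lin.
Qed.

Section Level.
Variables (m : nat) (g : seqN N -> C).
Hypothesis m0 : (0 < m)%N.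

Lemma SigmaA_ext_tuple (u : m.-tuple 'I_N) : adm u -> SigmaA A (ext u).
Proof. by move=> au; apply: SigmaA_ext => //; rewrite size_tuple. Qed.

Lemma pre_ext_tuple (u : m.-tuple 'I_N) : pre m (ext u) = u.
Proof. by have := pre_size_ext A i0 u; rewrite size_tuple. Qed.

Lemma Sm_Jm y (u : m.-tuple 'I_N) : adm u -> Sm (Jm y) u = y u.
Proof.
move=> au; rewrite /Sm au.
rewrite (@Sop_eq _ _ (Jop (fun w => y (pret m w)))); last first.
  by move=> b /andP[b0 bm]; rewrite zext_in ?size_pre.
rewrite Sop_Jop//; last exact: SigmaA_ext_tuple.
congr y; apply/val_inj => /=; rewrite pretE.
by rewrite !pre_ext_tuple.
Qed.

(** [Sop m] reads only the first [m] letters of a point, so [Mop] passes through functions on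
    [m]-tuples: [Sm] sums coordinates up, [Bop] transfers, [Jm] takes increments again. *)
Lemma Mop_factor (x : m.-bseq 'I_N -> C) : Mop g x = Jm (Bop g (Sm x)).
Proof.
apply/funext => t; rewrite /Mop /Jm; apply: Jop_eq => v av /andP[v0 vt].
have vm : (size v <= m)%N by rewrite (leq_trans vt)// size_bseq.
have Sv : SigmaA A (ext v) by exact: SigmaA_ext.
rewrite /Bop pretE adm_pre// ext_pre_ext//; apply: eq_bigr => i /eqP Ai.
congr (_ * _); rewrite /Sm pretE adm_pre; last exact: SigmaA_cons.
apply: Sop_pre; apply: (@eq_pre _ i0) => k km.
by rewrite ext_lt ?size_pre// nth_pre.
Qed.

Lemma opmx_Mop : opmx (@Mop m g) = opmx (@Sm m) *m opmx (@Bop m g) *m opmx (@Jm m).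
Proof.
rewrite -!opmx_comp; [|exact: Jm_lin|exact: Bop_lin].
by congr opmx; apply/funext => x; rewrite Mop_factor.
Qed.

(** [Sm] after [Jm] is the identity at admissible tuples, and [Bop] produces 0 at all others. *)
Lemma Bop_Jm_Sm :
  opmx (@Bop m g) *m (opmx (@Jm m) *m opmx (@Sm m)) = opmx (@Bop m g).
Proof.
rewrite -!opmx_comp; [|apply: comp_lin; [exact: Jm_lin|exact: Sm_lin]|exact: Sm_lin].
congr opmx; apply/funext => x; apply/funext => u /=.
have [au|au] := boolP (adm u); first by rewrite Sm_Jm.
by rewrite /Sm /Bop (negbTE au).
Qed.

Lemma opmx_MopX q : opmx (@Mop m g) ^+ q.+1 =
  opmx (@Sm m) *m (opmx (@Bop m g) ^+ q.+1) *m opmx (@Jm m).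
Proof.
rewrite opmx_Mop; have := Bop_Jm_Sm.
move: (opmx (@Bop m g)) (opmx (@Jm m)) (opmx (@Sm m)) => B J S H.
elim: q => [|q IH]; first by rewrite !expr1.
have -> : (S *m B *m J) ^+ q.+2 = (S *m B *m J) *m (S *m B *m J) ^+ q.+1.
  exact: exprS.
have -> : B ^+ q.+2 = B *m B ^+ q.+1 by exact: exprS.
rewrite IH !mulmxA.
by rewrite -(mulmxA (S *m B) J S) -(mulmxA S B (J *m S)) H.
Qed.

Lemma trace_Mop_Bop q :
  \tr (opmx (@Mop m g) ^+ q.+1) = \tr (opmx (@Bop m g) ^+ q.+1).
Proof.
rewrite opmx_MopX -mulmxA mxtrace_mulC -mulmxA.
have -> : opmx (@Bop m g) ^+ q.+1 = opmx (@Bop m g) ^+ q *m opmx (@Bop m g).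
  exact: exprSr.
by rewrite -mulmxA Bop_Jm_Sm.
Qed.

(** The weight that [Bop] really sees: all letters after position [m] are replaced by the standard
    extension. Since it reads [m + 1] letters only, iterates of [Bop] become iterates of a genuine
    transfer operator, with no replacement of points in between ([iter_Bop]). *)
Definition gcut (w : seqN N) : C := g (consw (w 0%N) (ext (pre m (Defs.shift w)))).

Lemma gcut_eq w w' : (forall k, (k <= m)%N -> w k = w' k) -> gcut w = gcut w'.
Proof.
move=> E; rewrite /gcut E//; congr (g (consw _ (ext _))).
by apply: (@eq_pre _ i0) => k km; rewrite /Defs.shift E.
Qed.

Lemma iter_Bop q y (u : m.-tuple 'I_N) : adm u ->
  iter q (Bop g) y u = iter q (Lw gcut) (fun w => y (pret m w)) (ext u).
Proof.
move=> au; suff H (w : seqN N) : SigmaA A w ->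
    iter q (Bop g) y (pret m w) = iter q (Lw gcut) (fun w => y (pret m w)) w.
  rewrite -H; last exact: SigmaA_ext_tuple.
  congr (iter q _ y _); apply/val_inj => /=; rewrite pretE.
  by rewrite pre_ext_tuple.
elim: q w => [//|q IH] w Sw /=.
rewrite {1}/Bop pretE adm_pre//.
have Se : SigmaA A (ext (pre m w)).
  by apply: SigmaA_ext; rewrite ?size_pre// adm_pre.
have e0 k : (k < m)%N -> ext (pre m w) k = w k.
  by move=> km; rewrite ext_lt ?size_pre// nth_pre.
apply: eq_big => [i|i]; rewrite e0// => /eqP Ai.
apply: (f_equal2 *%R) => //.
rewrite -IH; last exact: SigmaA_cons.
congr (iter q _ y _); apply/val_inj; rewrite /= !pretE.
by apply: (@eq_pre _ i0) => -[|k] km //=; rewrite e0// ltnW.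
Qed.

End Level.

Definition catw (s : seq 'I_N) w : seqN N := foldr (@consw N) w s.

Lemma catwE s w t :
  catw s w t = if (t < size s)%N then nth i0 s t else w (t - size s)%N.
Proof.
by elim: s t => [|i s IH] [|t] //=; rewrite IH ltnS subSS.
Qed.

Definition chain s w : bool :=
  [forall t : 'I_(size s), A (catw s w t) (catw s w t.+1) == 1].

Lemma chain_cons i s w :
  chain (i :: s) w = (A i (catw s w 0%N) == 1) && chain s w.
Proof.
apply/forallP/andP => [H|[H1 /forallP H2] [[|t] ts]] //=.
  split; first exact: (H ord0).
  by apply/forallP => t; exact: (H (lift ord0 t)).
exact: (H2 (Ordinal (ts : (t < size s)%N))).
Qed.

Lemma iter_Lw q g phi w : iter q (Lw g) phi w =
  \sum_(s : q.-tuple 'I_N | chain s w)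
    (\prod_(t < q) g (iter t (@Defs.shift N) (catw s w))) * phi (catw s w).
Proof.
elim: q phi w => [|q IH] phi w.
  rewrite (big_pred1 [tuple])/=; last first.
    by move=> s; rewrite tuple0 /= eqxx; apply/forallP => -[].
  by rewrite big_ord0 mul1r.
rewrite iterSr IH.
under eq_bigr do rewrite mulr_sumr.
rewrite (exchange_big_dep xpredT)//=.
rewrite (reindex (fun p : 'I_N * q.-tuple 'I_N => [tuple of p.1 :: p.2])) /=; last first.
  exists (fun s => (thead s, [tuple of behead s])) => [[i s] _|s _] /=.
    by congr pair; apply/val_inj.
  by rewrite [RHS](tuple_eta s); apply/val_inj.
rewrite (eq_bigl (fun p : 'I_N * q.-tuple 'I_N =>
  xpredT p.1 && ((chain p.2 w) && (A p.1 (catw p.2 w 0%N) == 1)))); last first.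
  by move=> [i s]; rewrite /= chain_cons andbC.
rewrite -(pair_big_dep xpredT (fun i (s : q.-tuple 'I_N) =>
   (chain s w) && (A i (catw s w 0%N) == 1)) (fun i (s : q.-tuple 'I_N) =>
   (\prod_(t < q.+1) g (iter t (@Defs.shift N) (catw (i :: s) w))) *
     phi (catw (i :: s) w))) /=.
apply: eq_bigr => i _; apply: eq_bigr => s _.
rewrite big_ord_recl mulrA [X in X * phi _]mulrC; congr (_ * _ * _).
apply: eq_bigr => t _.
have -> : nat_of_ord (lift ord0 t) = t.+1 by [].
by rewrite iterSr.
Qed.

Definition per (s : seq 'I_N) : seqN N := fun t => nth i0 s (t %% size s).

Lemma per_subn s t : (size s <= t)%N -> per s (t - size s)%N = per s t.
Proof. by move=> st; rewrite -{2}(subnKC st) /per modnDl. Qed.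

Lemma per_SigmaA s : (0 < size s)%N ->
  (forall t, (t < size s)%N -> A (per s t) (per s t.+1) = 1) -> SigmaA A (per s).
Proof.
move=> s0 H t; have := H (t %% size s)%N (ltn_pmod _ s0).
rewrite /per modn_mod; congr (A _ (nth _ _ _) = 1).
by rewrite -addn1 modnDml addn1.
Qed.

(** If prepending [s] does not change the first [m] letters, then letter [t] equals letter [t - q]
    as long as [t - q < m]; descending in steps of [q] ends inside [s]. *)
Lemma catw_per m q (s : q.-tuple 'I_N) w : (0 < q)%N ->
  (forall t, (t < m)%N -> catw s w t = w t) ->
  forall t, (t < m + q)%N -> catw s w t = per s t.
Proof.
move=> q0 H t; have [n] := ubnP t; elim: n t => // n IH t tn tm.
rewrite catwE size_tuple; case: ltnP => tq.
  by rewrite /per size_tuple modn_small.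
have tqm : (t - q < m)%N by rewrite ltn_subLR// addnC.
rewrite -H// IH; last 2 first.
- by rewrite -ltnS (leq_trans _ tn)// ltnS ltn_subrL q0 (leq_trans q0).
- by rewrite (leq_trans tqm)// leq_addr.
by have := @per_subn s t; rewrite size_tuple => ->.
Qed.

(** A diagonal entry of the [q]-th power of [Bop] at [u] sums over words [s] of length [q] such that
    [s] followed by [ext u] again starts with [u]. By [catw_per] this forces the [q]-periodic
    pattern of [s], so each cyclically admissible [s] contributes for exactly one [u], the first [m]
    letters of [per s]. *)
Lemma trace_Mop m q g : (0 < m)%N -> (0 < q)%N ->
  \tr (opmx (@Mop m g) ^+ q) =
  \sum_(s : q.-tuple 'I_N | `[< SigmaA A (per s) >])
    \prod_(t < q) gcut m g (iter t (@Defs.shift N) (per s)).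
Proof.
case: q => // q m0 _; set Q := q.+1.
rewrite trace_Mop_Bop// opmxX; last exact: Bop_lin.
rewrite trace_opmx.
rewrite (eq_bigr (fun u : m.-tuple 'I_N => \sum_(s : Q.-tuple 'I_N)
   if adm u && chain s (ext u) && (pret m (catw s (ext u)) == u) then
     \prod_(t < Q) gcut m g (iter t (@Defs.shift N) (catw s (ext u))) else 0)).
  2: { move=> u _; have [au|au] := boolP (adm u); last first.
       by rewrite iterS /Bop (negbTE au) big1.
     rewrite iter_Bop// iter_Lw big_mkcond; apply: eq_bigr => s _ /=.
     by case: ifP => //= _; case: eqP => //= _; rewrite ?mulr1 ?mulr0. }
rewrite exchange_big [in RHS]big_mkcond /=; apply: eq_bigr => s _.
have key (u : m.-tuple 'I_N) : adm u && chain s (ext u) && (pret m (catw s (ext u)) == u) ->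
    (forall t, (t < m + Q)%N -> catw s (ext u) t = per s t).
  move=> /andP[/andP[au _] /eqP E]; apply: catw_per => // t tm.
  rewrite [RHS]ext_lt ?size_tuple// -{2}E pretE nth_pre//.
case: asboolP => Sp; last first.
  apply: big1 => u _; case: ifP => // H; case: Sp.
  have ce := key _ H.
  apply: per_SigmaA; rewrite size_tuple// => t tq.
  move: H => /andP[/andP[_ /forallP ch] _].
  have ts : (t < size s)%N by rewrite size_tuple.
  have /eqP := ch (Ordinal ts); rewrite /= !ce//; lia.
pose u0 := pret m (per s).
have au0 : adm u0 by rewrite pretE adm_pre.
have eu0 t : (t < m)%N -> ext u0 t = per s t.
  by move=> tm; rewrite ext_lt ?size_tuple// pretE nth_pre.
have cu0 t : (t < m + Q)%N -> catw s (ext u0) t = per s t.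
  move=> tm; rewrite catwE size_tuple; case: ltnP => tq.
    by rewrite /per size_tuple modn_small.
  rewrite eu0; last by rewrite ltn_subLR// addnC.
  by have := @per_subn s t; rewrite size_tuple => ->.
have Hu0 : adm u0 && chain s (ext u0) && (pret m (catw s (ext u0)) == u0).
  rewrite au0 /=; apply/andP; split.
    apply/forallP => -[t ts] /=; rewrite size_tuple in ts; rewrite !cu0//.
    - by apply/eqP; apply: Sp.
    - lia.
    - lia.
  apply/eqP/val_inj; apply: (etrans (pretE _ _)).
  apply: etrans (esym (pretE _ _)); apply: (@eq_pre _ i0) => k km.
  by rewrite cu0// (leq_trans km)// leq_addr.
rewrite (bigD1 u0)//= [X in _ + X]big1 ?addr0; last first.
  move=> u uu0; case: ifP => // H; move/eqP: uu0; case.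
  have ce := key _ H; move: H => /andP[_ /eqP <-].
  apply/val_inj; apply: (etrans (pretE _ _)).
  apply: etrans (esym (pretE _ _)); apply: (@eq_pre _ i0) => k km.
  by rewrite ce// (leq_trans km)// leq_addr.
(* The weight at the [t]-th shift reads positions [t] to [t + m], all below [m + Q], which is
   exactly the range where the point agrees with [per s]. *)
rewrite Hu0; apply: eq_bigr => t _; apply: gcut_eq => k km.
have sh (w : seqN N) j : iter t (@Defs.shift N) w j = w (t + j)%N.
  elim: (nat_of_ord t) j => [//|t' IH] j; rewrite iterS /Defs.shift IH.
  by rewrite addnS.
rewrite !sh cu0//; have := ltn_ord t; lia.
Qed.

End TransferAlgebra.

(** * Super-exponential decay *)

Section SuperExponential.
Variables (R : realType) (rr : R).
Hypotheses (rr0 : 0 < rr) (rr1 : rr < 1).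

(** The exponent is a square because the hypothesis bounds the variation of [f] by about [r^(m^2)].
    The cross term [rr^(2ab)] in [kapDe] is what a shift by [b] letters gains at level [a]. *)
Definition kap (a : nat) : R := rr ^+ (a * a).

Lemma kap_gt0 a : 0 < kap a.
Proof. exact: exprn_gt0. Qed.

Lemma kap_ge0 a : 0 <= kap a.
Proof. exact: ltW (kap_gt0 a). Qed.

Lemma kap_le a b : (a <= b)%N -> kap b <= kap a.
Proof. by move=> ab; apply: ler_wiXn2l; rewrite ?ltW// leq_mul. Qed.

Lemma kap_le1 a : kap a <= 1.
Proof. by rewrite (le_trans (kap_le (leq0n a)))// /kap expr0. Qed.

Lemma kapD a b : kap (a + b) <= kap a * rr ^+ b.
Proof. by rewrite /kap -exprD; apply: ler_wiXn2l; rewrite ?ltW//; nia. Qed.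

Lemma kapD2 a b : kap (a + b) <= kap a * kap b.
Proof. by rewrite /kap -exprD; apply: ler_wiXn2l; rewrite ?ltW//; nia. Qed.

Lemma kapDe a b : kap (a + b) = kap a * (rr ^+ (2 * a * b) * kap b).
Proof. by rewrite /kap -!exprD; congr (_ ^+ _); nia. Qed.

Lemma geo_sum_le (q : R) n : 0 <= q -> q < 1 -> \sum_(i < n) q ^+ i <= (1 - q)^-1.
Proof.
move=> q0 q1; have q1' : 0 < 1 - q by rewrite subr_gt0.
rewrite -[leRHS]mul1r ler_pdivlMr//.
have -> : (\sum_(i < n) q ^+ i) * (1 - q) = 1 - q ^+ n.
  by rewrite mulrC -[in RHS](expr1n _ n) subrXX; congr (_ * _);
     apply: eq_bigr => i _; rewrite expr1n mul1r.
by rewrite lerBlDr lerDl exprn_ge0.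
Qed.

Lemma expr_small (q e : R) : 0 <= q -> q < 1 -> 0 < e ->
  exists n0, forall n, (n0 <= n)%N -> q ^+ n <= e.
Proof.
move=> q0 q1 e0.
have /cvgrPdist_le /(_ e e0) : (fun n => q ^+ n) @ \oo --> (0 : R).
  by apply: cvg_expr; rewrite ger0_norm.
move=> [n0 _ H]; exists n0 => n nn; have := H n nn.
by rewrite sub0r normrN ger0_norm// exprn_ge0.
Qed.

Lemma expr_small_mul (q K e : R) : 0 <= q -> q < 1 -> 0 <= K -> 0 < e ->
  exists n0, forall n, (n0 <= n)%N -> K * q ^+ n <= e.
Proof.
move=> q0 q1 K0 e0; have K1 : 0 < K + 1 by exact: ltr_wpDl.
have [n0 H] := expr_small q0 q1 (divr_gt0 e0 K1); exists n0 => n nn.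
apply: le_trans (ler_wpM2l K0 (H n nn)) _.
by rewrite mulrCA ler_piMr ?(ltW e0)// ler_pdivrMr// mul1r lerDl.
Qed.

Lemma bkap_ge0 (b : R) i : 0 <= b -> 0 <= b ^+ i * kap i.
Proof. by move=> b0; apply: mulr_ge0; [exact: exprn_ge0|exact: kap_ge0]. Qed.

(** [b^a * rr^(a*a)] is [(b * rr^a)^a], at most 1 once [rr^a <= 1/(b+1)]; the finitely many earlier
    terms are added to the bound. *)
Lemma kap_superexp (b : R) : 0 <= b -> exists2 S, 0 <= S & forall a, b ^+ a * kap a <= S.
Proof.
move=> b0.
have [n0 H] := @expr_small rr (b + 1)^-1 (ltW rr0) rr1 (ltac:(rewrite invr_gt0; lra)).
have le1 a : (n0 <= a)%N -> b ^+ a * kap a <= 1.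
  move=> na; rewrite /kap exprM -exprMn exprn_ile1//.
    by rewrite mulr_ge0// exprn_ge0// ltW.
  rewrite (le_trans (ler_wpM2l b0 (H _ na)))// ler_pdivrMr; lra.
exists (1 + \sum_(i < n0) b ^+ i * kap i).
  by rewrite addr_ge0// sumr_ge0// => i _; exact: bkap_ge0.
move=> a; have [na|an] := leqP n0 a.
  rewrite (le_trans (le1 _ na))// lerDl sumr_ge0// => i _.
  exact: bkap_ge0.
rewrite (bigD1 (Ordinal an))//= addrCA lerDl addr_ge0// sumr_ge0// => i _.
exact: bkap_ge0.
Qed.

Lemma kap_sum (b : R) : 0 <= b -> exists2 S, 0 <= S &
  forall n, \sum_(i < n) b ^+ i * kap i <= S.
Proof.
move=> b0; have [S S0 H] := kap_superexp (mulr_ge0 (ler0n R 2) b0).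
exists (S * (1 - 2^-1)^-1); first by rewrite mulr_ge0// invr_ge0; lra.
move=> n; apply: le_trans (ler_wpM2l S0 (@geo_sum_le 2^-1 n _ _)); [|lra|lra].
rewrite mulr_sumr; apply: ler_sum => i _.
by rewrite exprVn ler_pdivlMr ?exprn_gt0// mulrC mulrA -exprMn; exact: H.
Qed.

End SuperExponential.

(** * Decay estimates for the transfer operator and its truncations *)

Section Estimates.
Variables (R : realType) (rr : R).
Hypotheses (rr0 : 0 < rr) (rr1 : rr < 1).
Variables (N : nat) (A : 'M[int]_N) (i0 : 'I_N).
Local Notation C := R[i].
Local Notation ext := (ext A i0).
Local Notation adm := (adm A).
Local Notation kap := (kap rr).
Implicit Types (u : seq 'I_N) (w : seqN N) (phi psi : seqN N -> C).

Definition bounded_by phi G := forall w, SigmaA A w -> cmod (phi w) <= G.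

(* Each application of the transfer operator shifts the decay by one letter, so
   eigenfunctions satisfy the bound with every shift [tau]. *)
Definition kreg phi := forall tau, exists2 B, 0 <= B &
  forall a, var_le A phi a (B * kap (a + tau)).

Lemma var_le_trans phi a b c d : (a <= b)%N -> c <= d ->
  var_le A phi a c -> var_le A phi b d.
Proof.
move=> ab cd H w w' Sw Sw' E; apply: le_trans cd; apply: H => // k ka.
by apply: E; apply: leq_trans ab.
Qed.

(** Each point shares its first [M + 1] letters with one of finitely many standard extensions, and
    at that level [phi] varies by at most 1. The length is [M + 1] so that the word is nonempty and
    [SigmaA_ext] applies. *)
Lemma inV_bounded phi : inV A phi -> exists2 G, 0 <= G & bounded_by phi G.
Proof.
move=> /(_ 1 ltr01)[M H].
exists (\sum_(u : M.+1.-tuple 'I_N) cmod (phi (ext u)) + 1).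
  by rewrite addr_ge0// sumr_ge0// => u _; exact: cmod_ge0.
move=> w Sw; apply: le_trans (cmod_dist _ (phi (ext (pret M.+1 w)))) _.
apply: lerD.
  by rewrite (bigD1 (pret M.+1 w))//= lerDl sumr_ge0// => u _; exact: cmod_ge0.
have := H M.+1 (leqnSn M); rewrite expr1n; apply => //.
  by apply: SigmaA_ext; rewrite pretE ?size_pre// adm_pre.
by move=> k kM; rewrite pretE ext_lt ?size_pre// nth_pre.
Qed.

Lemma kreg_bounded phi : kreg phi -> exists2 G, 0 <= G & bounded_by phi G.
Proof.
move=> /(_ 0%N)[B B0 H].
have [[w0 Sw0]|Nw] := pselect (exists w, SigmaA A w); last first.
  by exists 0 => // w Sw; case: Nw; exists w.
exists (cmod (phi w0) + B * kap 0); first by rewrite addr_ge0 ?cmod_ge0// mulr_ge0// kap_ge0.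
move=> w Sw; apply: le_trans (cmod_dist _ (phi w0)) _; rewrite lerD2l.
exact: (H 0%N).
Qed.

Lemma kreg_eq phi psi : (forall w, SigmaA A w -> phi w = psi w) -> kreg phi -> kreg psi.
Proof.
move=> E H tau; have [B B0 HB] := H tau; exists B => // a w w' Sw Sw' ww'.
by rewrite -!E//; apply: HB.
Qed.

Lemma kreg0 : kreg (fun=> 0).
Proof.
move=> tau; exists 0 => // a w w' _ _ _.
by rewrite subrr cmod0 mul0r.
Qed.

Lemma kregD phi psi c : kreg phi -> kreg psi -> kreg (fun w => c * phi w + psi w).
Proof.
move=> H1 H2 tau; have [B1 B10 K1] := H1 tau; have [B2 B20 K2] := H2 tau.
exists (cmod c * B1 + B2); first by rewrite addr_ge0 ?mulr_ge0 ?cmod_ge0.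
move=> a w w' Sw Sw' E.
have -> : c * phi w + psi w - (c * phi w' + psi w') =
   c * (phi w - phi w') + (psi w - psi w') by ring.
rewrite (le_trans (cmodD _ _))// mulrDl lerD//; last exact: K2.
by rewrite cmodM -mulrA ler_wpM2l ?cmod_ge0//; exact: K1.
Qed.

Lemma kreg_sum (I : Type) (s : seq I) (c : I -> C) (v : I -> seqN N -> C) :
  (forall i, kreg (v i)) -> kreg (fun w => \sum_(i <- s) c i * v i w).
Proof.
move=> H; elim: s => [|i s IH].
  by apply: kreg_eq kreg0 => w _; rewrite big_nil.
apply: kreg_eq (kregD (c i) (H i) IH) => w _.
by rewrite big_cons.
Qed.

Lemma inV_dominated phi (K : R) : 0 <= K ->
  (forall e : R, 0 < e -> exists M, forall m, (M <= m)%N -> var_le A phi m (K * e ^+ m)) ->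
  inV A phi.
Proof.
move=> K0 H e e0; have [M HM] := H _ (divr_gt0 e0 (ltr0n R 2)).
have [n0 Hn] := @expr_small_mul R 2^-1 K 1 (ltac:(lra)) (ltac:(lra)) K0 ltr01.
exists (maxn M n0) => m; rewrite geq_max => /andP[mM mn].
apply: var_le_trans (leqnn m) _ (HM m mM).
by rewrite exprMn mulrCA ler_piMr ?exprn_ge0 ?(ltW e0)// Hn.
Qed.

Lemma var_kap_inV phi (B : R) : 0 <= B ->
  (forall a, var_le A phi a (B * kap a)) -> inV A phi.
Proof.
move=> B0 HB; apply: (@inV_dominated _ (B + 1)) => [|e e0]; first exact: addr_ge0.
have b0 : 0 <= e^-1 * 2 by rewrite mulr_ge0// invr_ge0 ltW.
have [S S0 HS] := kap_superexp rr0 rr1 b0.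
have [n0 Hn] := @expr_small_mul R 2^-1 S 1 (ltac:(lra)) (ltac:(lra)) S0 ltr01.
exists n0 => m nm; apply: var_le_trans (leqnn m) _ (HB m).
apply: ler_pM; rewrite ?kap_ge0// ?lerDl//.
have := HS m; rewrite exprMn -mulrA exprVn ler_pdivrMl ?exprn_gt0// mulrC => H.
have := Hn m nm; rewrite exprVn ler_pdivrMr ?exprn_gt0// mul1r => H2.
by rewrite -(ler_pM2r (exprn_gt0 m (ltr0n R 2))) (le_trans H)// ler_wpM2l ?exprn_ge0 ?(ltW e0)//.
Qed.

Lemma kreg_inV phi : kreg phi -> inV A phi.
Proof.
move=> /(_ 0%N)[B B0 HB]; apply: (var_kap_inV B0) => a.
by have := HB a; rewrite addn0.
Qed.

Lemma Sop_tail m (x : seq 'I_N -> C) D tau a w : 0 <= D ->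
  (forall u, (0 < size u)%N -> cmod (x u) <= D * kap (size u + tau)) ->
  \sum_(b < m | (a <= b)%N) cmod (x (pre b.+1 w)) <= D * kap (a.+1 + tau) * (1 - rr)^-1.
Proof.
move=> D0 H.
apply: le_trans (_ : \sum_(b < m | (a <= b)%N) D * kap (a.+1 + tau) * rr ^+ (b - a) <= _).
  apply: ler_sum => b ab; apply: le_trans (H _ _) _; first by rewrite size_pre.
  rewrite size_pre -mulrA ler_wpM2l//.
  have -> : (b.+1 + tau = (a.+1 + tau) + (b - a))%N by lia.
  exact: kapD.
rewrite -mulr_sumr ler_wpM2l ?mulr_ge0 ?kap_ge0//.
apply: le_trans (geo_sum_le (m - a) (ltW rr0) rr1).
rewrite -(big_mkord (fun b => a <= b)%N (fun b => rr ^+ (b - a))).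
rewrite -(big_mkord xpredT (fun b => rr ^+ b)).
have [am|ma] := leqP a m; last first.
  rewrite big_nat_cond big1; first by rewrite sumr_ge0// => i _; rewrite exprn_ge0// ltW.
  by move=> i /andP[/andP[_ im] ai]; lia.
rewrite (big_cat_nat (n := a))//= big_nat_cond big1 ?add0r; last first.
  by move=> i /andP[/andP[_ im] ai]; lia.
rewrite -{1}(add0n a) big_addn.
rewrite big_mkcond; apply: ler_sum => i _; rewrite addnK.
by case: ifP => // _; rewrite exprn_ge0// ltW.
Qed.

Section Weight.
Variables (g : seqN N -> C) (G : R).
Hypotheses (G0 : 0 <= G) (gG : bounded_by g G) (gk : kreg g).

Let S : R := (1 - rr)^-1.

Let S0 : 0 <= S. Proof. by rewrite invr_ge0 subr_ge0 ltW. Qed.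

Lemma cmod_Lw phi F w : SigmaA A w -> 0 <= F -> bounded_by phi F ->
  cmod (Lw A g phi w) <= N%:R * (G * F).
Proof.
move=> Sw F0 H; apply: le_trans (cmod_sum _ _ _) _.
apply: le_trans (_ : \sum_(i < N) G * F <= _); last first.
  by rewrite sumr_const card_ord mulr_natl.
rewrite big_mkcond; apply: ler_sum => i _; case: eqP => [Ai|_]; last exact: mulr_ge0.
have Si := SigmaA_cons Sw Ai.
by rewrite cmodM ler_pM ?cmod_ge0//; [exact: gG|exact: H].
Qed.

(** Since [a > 0], both points admit the same preimage letters, and the preimages agree on one
    letter more. This is the source of the gain of one letter in all later bounds. *)
Lemma var_Lw phi a c d F w w' : (0 < a)%N -> SigmaA A w -> SigmaA A w' ->
  (forall k, (k < a)%N -> w k = w' k) ->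
  (forall i, SigmaA A (consw i w) -> SigmaA A (consw i w') ->
    cmod (phi (consw i w) - phi (consw i w')) <= c) ->
  (forall i, SigmaA A (consw i w') -> cmod (phi (consw i w')) <= F) ->
  0 <= c -> 0 <= d -> 0 <= F -> var_le A g a.+1 d ->
  cmod (Lw A g phi w - Lw A g phi w') <= N%:R * (G * c + d * F).
Proof.
move=> a0 Sw Sw' E Hc HF c0 d0 F0 Hd.
rewrite /Lw -(E 0%N a0) -sumrB.
apply: le_trans (cmod_sum _ _ _) _.
apply: le_trans (_ : \sum_(i < N) (G * c + d * F) <= _); last first.
  by rewrite sumr_const card_ord mulr_natl.
rewrite big_mkcond; apply: ler_sum => i _; case: eqP => [Ai|_]; last first.
  by rewrite addr_ge0 ?mulr_ge0.
have Si := SigmaA_cons Sw Ai.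
have Si' : SigmaA A (consw i w') by apply: SigmaA_cons => //; rewrite -(E 0%N a0).
have -> : g (consw i w) * phi (consw i w) - g (consw i w') * phi (consw i w') =
   g (consw i w) * (phi (consw i w) - phi (consw i w')) +
   (g (consw i w) - g (consw i w')) * phi (consw i w') by ring.
apply: le_trans (cmodD _ _) _; rewrite !cmodM.
apply: lerD; apply: ler_pM; rewrite ?cmod_ge0//.
- exact: gG.
- exact: Hc.
- by apply: Hd => // -[|k] //= ka; rewrite E.
- exact: HF.
Qed.

(** What matters is that [B] does not depend on [m]. The increment at a word of length at least 2
    compares two points whose preimages agree on as many letters as the word has, so only
    coordinates of strictly longer words contribute. Words of length 1 have no such cancellation and
    are charged to [B1], which divides by the constant [kap tau.+2]. *)
Lemma Mop_bound tau : exists2 B, 0 <= B & forall m D (x : m.-bseq 'I_N -> C), 0 <= D ->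
  (forall t, cmod (x t) <= D * kap (size t + tau)) ->
  forall t, cmod (Mop A i0 g x t) <= B * D * kap (size t + tau.+1).
Proof.
have [Bg Bg0 HBg] := gk tau.+1.
pose B1 := N%:R * G * S / kap tau.+2.
pose B2 := N%:R * (G * (2 * S) + Bg * S).
have B10 : 0 <= B1 by rewrite mulr_ge0 ?invr_ge0 ?kap_ge0// !mulr_ge0.
have B20 : 0 <= B2 by rewrite mulr_ge0// addr_ge0// !mulr_ge0.
exists (B1 + B2); first exact: addr_ge0.
move=> m D x D0 H t.
have Hz u : (0 < size u)%N -> cmod (zext x u) <= D * kap (size u + tau).
  move=> _; rewrite /zext; case: insubP => [s _ <-|_] /=; first exact: H.
  by rewrite cmod0 mulr_ge0// kap_ge0.
rewrite /Mop /Jop; case: ifP => [/andP[at' t0]|_]; last first.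
  by rewrite cmod0 !mulr_ge0 ?addr_ge0 ?kap_ge0.
have Sx w : cmod (Sop m (zext x) w) <= D * S.
  apply: le_trans (cmod_sum _ _ _) _.
  apply: le_trans (_ : D * kap (1 + tau) * S <= _).
    exact: (Sop_tail m 0 w D0 Hz).
  by rewrite ler_wpM2r// ler_piMr// kap_le1.
case: ifP => t1; last first.
  have -> : size t = 1%N by apply/eqP; rewrite eqn_leq t0 andbT leqNgt t1.
  rewrite subr0 addSn add0n.
  apply: le_trans (cmod_Lw (F := D * S) _ _ _) _; rewrite ?mulr_ge0//.
    exact: SigmaA_ext.
  have -> : N%:R * (G * (D * S)) = B1 * D * kap tau.+2.
    by rewrite /B1; field; rewrite gt_eqF// kap_gt0.
  by rewrite ler_wpM2r ?kap_ge0// ler_wpM2r// lerDl.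
set u := (t : seq _) in at' t0 t1 *; set u' := take _ u.
have su' : size u' = (size u).-1 by rewrite size_takel// leq_pred.
have au' : adm u' by exact: adm_take.
have u'0 : (0 < size u')%N by rewrite su' -ltnS prednK.
have E k : (k < size u')%N -> ext u k = ext u' k.
  move=> ku; rewrite !ext_lt//; last by rewrite (leq_trans ku)// su' leq_pred.
  by rewrite nth_take// -su'.
apply: le_trans (var_Lw (a := size u') (c := 2 * (D * kap (size u + tau.+1) * S))
   (d := Bg * kap (size u + tau.+1)) (F := D * S) _ _ _ E _ _ _ _ _ _) _ => //.
- exact: SigmaA_ext.
- exact: SigmaA_ext.
- move=> i _ _; rewrite /Sop -sumrB.
  rewrite (bigID (fun b : 'I_m => (size u <= b)%N)) /= [X in _ + X]big1 ?addr0; last first.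
    move=> b bu; rewrite (_ : pre b.+1 (consw i (ext u)) = pre b.+1 (consw i (ext u'))) ?subrr//.
    apply: (@eq_pre _ i0) => -[|k] //= kb; rewrite E// su'.
    by rewrite -ltnNge in bu; rewrite (leq_trans (kb : (k < b)%N))// -ltnS prednK.
  apply: le_trans (cmod_sum _ _ _) _.
  apply: le_trans (ler_sum _ (fun b _ => cmodBD _ _)) _.
  rewrite big_split /= mulr_natl mulr2n.
  have -> : (size u + tau.+1 = (size u).+1 + tau)%N by rewrite addnS addSn.
  by apply: lerD; apply: Sop_tail.
- by rewrite !mulr_ge0// kap_ge0.
- by rewrite mulr_ge0// kap_ge0.
- by rewrite mulr_ge0.
- have -> : (size u').+1 = size u by rewrite su' prednK.
  exact: HBg.
have -> : N%:R * (G * (2 * (D * kap (size u + tau.+1) * S)) +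
   Bg * kap (size u + tau.+1) * (D * S)) = B2 * D * kap (size u + tau.+1).
  by rewrite /B2; ring.
by rewrite ler_wpM2r ?kap_ge0// ler_wpM2r// lerDr.
Qed.

Lemma var_eigen_step phi psi z F Bg Bp tau : z != 0 -> 0 <= F ->
    bounded_by phi F -> 0 <= Bg -> 0 <= Bp ->
    (forall a, var_le A g a (Bg * kap (a + tau))) ->
    (forall a, var_le A psi a (Bp * kap (a + tau))) ->
    (forall w, SigmaA A w -> Lw A g phi w = z * phi w + psi w) ->
  forall a c, (0 < a)%N -> 0 <= c -> var_le A phi a.+1 c ->
  var_le A phi a ((N%:R * G / cmod z) * c +
     ((N%:R * Bg * F + Bp) / cmod z) * kap (a + tau)).
Proof.
move=> z0 F0 pF Bg0 Bp0 HBg HBp Heq a c a0 c0 Hc w w' Sw Sw' E.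
have cz : 0 < cmod z by rewrite cmod_gt0.
rewrite -(ler_pM2l cz) -cmodM.
have -> : z * (phi w - phi w') =
  (Lw A g phi w - Lw A g phi w') - (psi w - psi w').
  by rewrite !Heq//; ring.
apply: le_trans (cmodBD _ _) _.
have ka : kap (a.+1 + tau) <= kap (a + tau) by apply: kap_le => //; rewrite leq_add2r.
have dk : var_le A g a.+1 (Bg * kap (a + tau)).
  by apply: var_le_trans (leqnn _) _ (HBg a.+1); rewrite ler_wpM2l.
have := @var_Lw phi a c (Bg * kap (a + tau)) F w w' a0 Sw Sw' E _ _ c0
   (mulr_ge0 Bg0 (kap_ge0 rr0 _)) F0 dk.
move=> /(_ _ _)H.
apply: le_trans (lerD (H _ _) (HBp a w w' Sw Sw' E)) _.
- by move=> i Si Si'; apply: Hc => // -[|k] //= ka'; rewrite E.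
- by move=> i Si; exact: pF.
by rewrite le_eqVlt; apply/orP; left; apply/eqP; field; rewrite gt_eqF.
Qed.

(** The eigenvalue equation bounds the variation at level [a] by [b] times that at level [a + 1]
    plus a good term. After [n] steps the remainder is [b^n] times the variation at level [a + n].
    Here [b] may be large; membership in V, that is decay faster than every exponential, still sends
    this to 0. *)
Lemma kreg_eigen phi psi z : z != 0 -> inV A phi -> kreg psi ->
  (forall w, SigmaA A w -> Lw A g phi w = z * phi w + psi w) -> kreg phi.
Proof.
move=> z0 pV pk Heq tau.
have [F F0 pF] := inV_bounded pV.
have [Bg Bg0 HBg] := gk tau; have [Bp Bp0 HBp] := pk tau.
have step := var_eigen_step z0 F0 pF Bg0 Bp0 HBg HBp Heq.
have cz : 0 < cmod z by rewrite cmod_gt0.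
set b := N%:R * G / cmod z in step; set B' := (_ / cmod z) in step.
have b0 : 0 <= b by rewrite /b !mulr_ge0// invr_ge0 ltW.
have B'0 : 0 <= B' by rewrite /B' mulr_ge0 ?invr_ge0 ?(ltW cz)// addr_ge0// !mulr_ge0.
have iter n : forall a c, (0 < a)%N -> 0 <= c -> var_le A phi (a + n) c ->
    var_le A phi a (b ^+ n * c + B' * \sum_(i < n) b ^+ i * kap (a + tau + i)).
  elim: n => [|n IH] a c a0 c0 H.
    by rewrite expr0 mul1r big_ord0 mulr0 addr0 -[a]addn0.
  have Sn : 0 <= \sum_(i < n) b ^+ i * kap (a.+1 + tau + i).
    by apply: sumr_ge0 => i _; apply: mulr_ge0; [exact: exprn_ge0|exact: kap_ge0].
  have := IH a.+1 c (ltn0Sn a) c0; rewrite addSnnS => /(_ H) /step.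
  move=> /(_ a0 (ltac:(rewrite addr_ge0// mulr_ge0// exprn_ge0//))).
  apply: var_le_trans => //.
  set T := \sum_(i < n) _.
  have -> : b * (b ^+ n * c + B' * T) + B' * kap (a + tau) =
     b ^+ n.+1 * c + B' * (kap (a + tau) + b * T) by rewrite exprS; ring.
  rewrite lerD2l ler_wpM2l// big_ord_recl expr0 mul1r addn0 lerD2l /T mulr_sumr.
  apply: ler_sum => i _; rewrite mulrA -exprS ler_wpM2l ?exprn_ge0//.
  by have -> : (a + tau + lift ord0 i = a.+1 + tau + i)%N
    by rewrite /= /bump /= add1n addnS !addSn.
have [K K0 HK] := kap_sum rr0 rr1 b0.
have lim a : (0 < a)%N -> var_le A phi a (B' * K * kap (a + tau)).
  move=> a0 w w' Sw Sw' E; apply/ler_addgt0Pr => d d0.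
  (* Chosen so that [b * e <= 1/2]: the remainder after [n] steps is then at most [2^-n]. *)
  pose e : R := (2 * (b + 1))^-1.
  have e0 : 0 < e by rewrite invr_gt0; lra.
  have e1 : e <= 1 by rewrite invf_le1; lra.
  have be : b * e <= 2^-1.
    by rewrite ler_pdivrMr; [rewrite mulrA mulVf ?mul1r; lra|lra].
  have [M HM] := pV e e0.
  have [n0 Hn0] := @expr_small R 2^-1 d (ltac:(lra)) (ltac:(lra)) d0.
  pose n := maxn M n0.
  have HH := HM (a + n)%N (leq_trans (leq_maxl M n0) (leq_addl a n)).
  have /(_ w w' Sw Sw' E) H := iter n a _ a0 (exprn_ge0 _ (ltW e0)) HH.
  apply: le_trans H _; rewrite addrC; apply: lerD.
    rewrite -mulrA ler_wpM2l//.
    apply: le_trans (_ : kap (a + tau) * \sum_(i < n) b ^+ i * kap i <= _).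
      rewrite mulr_sumr; apply: ler_sum => i _.
      by rewrite mulrCA ler_wpM2l ?exprn_ge0//; exact: kapD2.
    by rewrite mulrC ler_wpM2r ?kap_ge0.
  apply: le_trans (Hn0 n (leq_maxr _ _)).
  apply: le_trans (_ : (b * e) ^+ n <= _); last first.
    apply: lerXn2r => //; rewrite nnegrE; first exact: mulr_ge0 b0 (ltW e0).
    by rewrite invr_ge0.
  have -> : (b * e) ^+ n = b ^+ n * e ^+ n by exact: exprMn.
  rewrite ler_wpM2l ?(exprn_ge0 _ b0)//.
  by apply: ler_wiXn2l; rewrite ?(ltW e0)// leq_addl.
have BK0 : 0 <= B' * K by exact: mulr_ge0.
have Fk0 : 0 <= 2 * F / kap tau.
  by apply: divr_ge0; [exact: mulr_ge0|exact: kap_ge0].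
exists (B' * K + 2 * F / kap tau); first exact: addr_ge0.
move=> [|a].
  move=> w w' Sw Sw' _; rewrite add0n mulrDl divfK ?gt_eqF ?kap_gt0//.
  apply: le_trans (cmodBD _ _) _.
  have -> : B' * K * kap tau + 2 * F = B' * K * kap tau + (F + F) by ring.
  rewrite -[leLHS]add0r; apply: lerD; last by apply: lerD; exact: pF.
  by apply: mulr_ge0 => //; exact: kap_ge0.
apply: var_le_trans (leqnn _) _ (lim a.+1 (ltn0Sn a)).
by rewrite ler_wpM2r ?kap_ge0// lerDl.
Qed.

Lemma Jop_kreg phi : kreg phi -> forall tau, exists2 B, 0 <= B &
  forall u, cmod (Jop A i0 phi u) <= B * kap (size u + tau).
Proof.
move=> pk tau; have [F F0 pF] := kreg_bounded pk.
have [B B0 HB] := pk tau.+1.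
have k0 : 0 <= F / kap tau.+1 by rewrite mulr_ge0 ?invr_ge0 ?kap_ge0.
exists (B + F / kap tau.+1); first exact: addr_ge0.
move=> u; rewrite /Jop; case: ifP => [/andP[au u0]|_]; last first.
  by rewrite cmod0 mulr_ge0 ?kap_ge0// addr_ge0.
have Su : SigmaA A (ext u) by exact: SigmaA_ext.
case: ifP => u1; last first.
  have -> : size u = 1%N by apply/eqP; rewrite eqn_leq u0 andbT leqNgt u1.
  rewrite subr0 add1n mulrDl divfK ?gt_eqF ?kap_gt0//.
  by rewrite -[leLHS]add0r lerD ?pF// mulr_ge0 ?kap_ge0.
have su' : size (take (size u).-1 u) = (size u).-1 by rewrite size_takel// leq_pred.
have u'0 : (0 < (size u).-1)%N by rewrite -ltnS prednK.
have := HB (size u).-1 (ext u) (ext (take (size u).-1 u)) Su.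
have -> : ((size u).-1 + tau.+1 = size u + tau)%N by rewrite addnS -addSn prednK.
move=> /(_ _ _) H; apply: le_trans (H _ _) _.
- by apply: SigmaA_ext; rewrite ?su'// adm_take.
- move=> k ku; rewrite !ext_lt ?su'//; last by rewrite (leq_trans ku)// leq_pred.
  by rewrite nth_take.
by rewrite ler_wpM2r ?kap_ge0// lerDl.
Qed.

Lemma Jop_le psi D : 0 <= D -> bounded_by psi D ->
  forall u, cmod (Jop A i0 psi u) <= 2 * D.
Proof.
move=> D0 H u; rewrite /Jop; case: ifP => [/andP[au u0]|_]; last by rewrite cmod0 mulr_ge0.
have H1 : cmod (psi (ext u)) <= D by apply: H; exact: SigmaA_ext.
apply: le_trans (cmodBD _ _) _; rewrite mulr_natl mulr2n lerD//.
case: ifP => u1; last by rewrite cmod0.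
apply: H; apply: SigmaA_ext; last exact: adm_take.
by rewrite size_takel ?leq_pred// -ltnS prednK.
Qed.

(** The error is exactly the increment of [Lw A g psi], where [psi] is the difference between [phi]
    and its value at the extension of the first [m] letters. So it is small in [m], uniformly over
    the word [t]. *)
Lemma err_bound phi : kreg phi -> forall tau, exists2 B, 0 <= B &
  forall m (t : m.-bseq 'I_N), (0 < m)%N ->
  cmod (Jop A i0 (Lw A g phi) t - Mop A i0 g (fun s : m.-bseq 'I_N => Jop A i0 phi s) t)
  <= B * kap (m + tau).
Proof.
move=> pk tau; have [B B0 HB] := pk tau.
exists (2 * (N%:R * (G * B))); first by rewrite !mulr_ge0.
move=> m t m0.
pose psi w := phi w - phi (ext (pre m w)).
have kB : 0 <= B * kap (m + tau) by rewrite mulr_ge0 ?kap_ge0.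
have pB : bounded_by psi (B * kap (m + tau)).
  move=> w Sw; apply: HB => //.
    by apply: SigmaA_ext; rewrite ?size_pre// adm_pre.
  by move=> k km; rewrite ext_lt ?size_pre// nth_pre.
have -> : Jop A i0 (Lw A g phi) t - Mop A i0 g (fun s : m.-bseq 'I_N => Jop A i0 phi s) t
   = Jop A i0 (Lw A g psi) t.
  have E : Mop A i0 g (fun s : m.-bseq 'I_N => Jop A i0 phi s) t =
      Jop A i0 (Lw A g (fun w => phi (ext (pre m w)))) t.
    apply: Jop_eq => v av /andP[v0 vt].
    apply: Lw_eq; first exact: SigmaA_ext.
    move=> w Sw; rewrite -Sop_Jop//; apply: Sop_eq => b /andP[b0 bm].
    by rewrite zext_in// size_pre.
  rewrite E.
  have := Jop_lin A i0 (-1) (Lw A g (fun w => phi (ext (pre m w)))) (Lw A g phi) t.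
  rewrite mulN1r addrC => <-; congr (Jop _ _ _ _).
  apply/funext => w; rewrite -Lw_lin; congr (Lw _ _ _ _).
  by apply/funext => w'; rewrite mulN1r addrC.
have H : bounded_by (Lw A g psi) (N%:R * (G * (B * kap (m + tau)))).
  by move=> w Sw; exact: cmod_Lw.
apply: le_trans (Jop_le _ H _) _; first by rewrite mulr_ge0// mulr_ge0.
by rewrite !mulrA.
Qed.

End Weight.
End Estimates.

(** * Finite-rank models *)

Section FiniteOperators.
Variables (R : realType) (T : finType).
Local Notation C := R[i].
Implicit Types (F : (T -> C) -> T -> C).

Lemma lin_expand F x u : is_lin F ->
  F x u = \sum_(t : T) x t * F (fun s => (s == t)%:R) u.
Proof.
move=> lF; rewrite -(is_lin_sum _ _ _ _ lF); congr (F _ u).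
apply/funext => t; rewrite (bigD1 t)//= eqxx mulr1 big1 ?addr0// => s st.
by rewrite eq_sym (negbTE st) mulr0.
Qed.

Lemma iter_lin F q : is_lin F -> is_lin (iter q F).
Proof.
move=> lF; elim: q => [//|q IH].
exact: (comp_lin IH lF).
Qed.

(** Testing on [x t = k t] times the conjugate phase of the matrix entry turns the sup bound into a
    bound for the weighted sum of moduli of a column. *)
Lemma colsum_le F (k : T -> R) u b : is_lin F -> (forall t, 0 <= k t) ->
  (forall x, (forall t, cmod (x t) <= k t) -> cmod (F x u) <= b) ->
  \sum_t k t * cmod (F (fun s => (s == t)%:R) u) <= b.
Proof.
move=> lF k0 H; pose c t := F (fun s => (s == t)%:R) u.
pose x t : C := (k t)%:C%C * ((c t)^* / (cmod (c t))%:C%C).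
have E : F x u = (\sum_t k t * cmod (c t))%:C%C.
  rewrite (lin_expand _ _ lF) rmorph_sum; apply: eq_bigr => t _ /=.
  rewrite -/(c t) /x; have [->|ct] := eqVneq (c t) 0.
    by rewrite mulr0 cmod0 mulr0.
  have cc : (cmod (c t))%:C%C != 0 :> C.
    by rewrite -cmodE normr_eq0.
  rewrite rmorphM /= -!mulrA; congr (_ * _).
  rewrite mulrCA mulrC [_^* * _]mulrC -cmod_sqr rmorphXn /= expr2.
  by rewrite -mulrA mulfV// mulr1.
have := H x; rewrite E cmodR ger0_norm; last first.
  by apply: sumr_ge0 => t _; rewrite mulr_ge0 ?cmod_ge0.
apply => t; rewrite /x !cmodM cmodV cmodR ger0_norm// cmodJ cmodR.
rewrite (ger0_norm (cmod_ge0 _)).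
have [->|ct] := eqVneq (cmod (c t)) 0; first by rewrite mul0r mulr0.
by rewrite mulfV// mulr1.
Qed.

Lemma mul_diag_pow n m (X : 'M[C]_(n, m)) (d : 'rV[C]_m) q :
  X *m (diag_mx d ^+ q) = \matrix_(i, j) (X i j * d 0 j ^+ q).
Proof.
elim: q => [|q IH].
  by rewrite expr0 mulmx1; apply/matrixP => i j; rewrite !mxE expr0 mulr1.
have -> : diag_mx d ^+ q.+1 = diag_mx d ^+ q *m diag_mx d by exact: exprSr.
rewrite mulmxA IH mul_mx_diag; apply/matrixP => i j.
by rewrite !mxE exprSr mulrA.
Qed.

(* [2 ^ l * (2 * j / 2 ^ l) = 2 * j]: the bound makes the [j]-th power a product of
   [2 ^ l] matrices whose Frobenius norms are controlled by the weights [s]. *)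
Lemma schatten_op F (k s : T -> R) (P : pred T) (l j : nat) (B : R) z :
  is_lin F -> (0 < j)%N -> (forall t, 0 < k t) -> (forall t, 0 < s t) -> 0 <= B ->
  (forall x t, ~~ P t -> F x t = 0) ->
  (forall x, (forall t, cmod (x t) <= k t) ->
    forall u, cmod (iter j F x u) <= B * k u * s u ^+ (2 ^ l)) ->
  roots_of (opmx F) z ->
  \sum_(x <- z) cmod x `^ (2 * j%:R / (2 ^ l)%:R) <=
    (1 + B ^+ 2) * \sum_(u | P u) s u ^+ 2.
Proof.
move=> lF j0 k0 s0 B0 FP HF Fz.
pose kk : 'rV[C]_#|T| := \row_i (k (enum_val i))%:C%C.
pose kv : 'rV[C]_#|T| := \row_i ((k (enum_val i))^-1)%:C%C.
pose X : 'M[C]_#|T| := diag_mx kk *m (opmx F ^+ j) *m diag_mx kv.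
have Xz : roots_of X [seq x ^+ j | x <- z].
  rewrite /roots_of char_poly_conj; first exact: roots_ofX.
  apply/matrixP => a b; rewrite mul_diag_mx !mxE.
  have [->|ab] := eqVneq a b; last by rewrite !mulr0n mulr0.
  by rewrite !mulr1n -rmorphM /= mulfV// gt_eqF.
set K := (2 ^ l)%N in HF *.
have K0 : (0 < K)%N by rewrite expn_gt0.
have XE a b : X a b = (k (enum_val a))%:C%C *
    iter j F (fun t => (t == enum_val a)%:R) (enum_val b) *
    ((k (enum_val b))^-1)%:C%C.
  by rewrite /X mul_mx_diag mxE mul_diag_mx mxE !mxE opmxX// mxE.
have XP a b : ~~ P (enum_val b) -> X a b = 0.
  move=> Pb; rewrite XE; case: (j) j0 => // j' _ /=.
  by rewrite FP// mulr0 mul0r.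
clearbody X.
(* [X] is split as [Y] times [K - 1] copies of [diag_mx d]. Each copy takes one factor [s] out of
   the column bound [B * s^K], so the columns of [Y] keep [B * s]. Columns outside [P] vanish, which
   allows the entry 0 there. *)
pose d : 'rV[C]_#|T| := \row_i (if P (enum_val i) then (s (enum_val i))%:C%C else 0).
pose Y : 'M[C]_#|T| := \matrix_(a, b) (X a b * ((s (enum_val b))^-1)%:C%C ^+ K.-1).
have YX : Y *m (diag_mx d ^+ K.-1) = X.
  rewrite mul_diag_pow; apply/matrixP => a b; rewrite !mxE.
  case: ifP => Pb; last by rewrite XP ?Pb// !mul0r.
  by rewrite -mulrA -exprMn -rmorphM /= mulVf ?gt_eqF// expr1n mulr1.
pose Ai (i : nat) := if i is 0%N then Y else diag_mx d.
have AX : \prod_(i < K) Ai i = X.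
  transitivity (\prod_(i < K.-1.+1) Ai i); first by rewrite prednK.
  rewrite -YX big_ord_recl; congr (_ * _).
  rewrite (eq_bigr (fun=> diag_mx d)) => [|i _]; last by [].
  by rewrite prodr_const card_ord.
have := @schatten_prod R l _ Ai [seq x ^+ j | x <- z].
rewrite -/K AX => /(_ Xz); rewrite big_map => H.
apply: le_trans (_ : _ <= \sum_(x <- z) cmod (x ^+ j) `^ (2 / K%:R)) _.
  apply: ler_sum => x _; rewrite cmodX -powR_mulrn ?cmod_ge0// -powRrM.
  by rewrite mulrCA mulrA.
apply: le_trans H _.
have fd : frob2 (diag_mx d) = \sum_(u | P u) s u ^+ 2.
  rewrite /frob2 [RHS]big_mkcond (reindex (@enum_val T T)) /=; last first.
    by apply: onW_bij; exact: enum_val_bij.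
  apply: eq_bigr => a _; rewrite (bigD1 a)//= big1 ?addr0; last first.
    by move=> b ba; rewrite !mxE eq_sym (negbTE ba) mulr0n cmod0 expr0n.
  rewrite !mxE eqxx mulr1n; case: ifP => _; last by rewrite cmod0 expr0n.
  by rewrite cmodR real_normK// num_real.
have fY : frob2 Y <= B ^+ 2 * \sum_(u | P u) s u ^+ 2.
  rewrite /frob2 exchange_big /= mulr_sumr [leRHS]big_mkcond.
  rewrite [leRHS](reindex (@enum_val T T)) /=; last first.
    by apply: onW_bij; exact: enum_val_bij.
  apply: ler_sum => b _; case: ifP => Pb; last first.
    by rewrite big1// => a _; rewrite mxE XP ?Pb// mul0r cmod0 expr0n.
  set u := enum_val b.
  have col : \sum_a cmod (X a b) <= B * s u ^+ K.
    rewrite (reindex enum_rank) /=; last by apply: onW_bij; exact: enum_rank_bij.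
    have := @colsum_le (iter j F) k u (B * k u * s u ^+ K) (iter_lin j lF)
      (fun t => ltW (k0 t)) (fun x Hx => HF x Hx u).
    rewrite [B * _ * _]mulrAC -ler_pdivrMr// mulr_suml => H1.
    apply: le_trans H1; apply: ler_sum => t _.
    rewrite XE enum_rankK !cmodM !cmodR ger0_norm ?(ltW (k0 t))//.
    by rewrite ger0_norm// invr_ge0 ltW.
  have ent a : cmod (Y a b) = cmod (X a b) * (s u)^-1 ^+ K.-1.
    by rewrite mxE cmodM cmodX cmodR ger0_norm// invr_ge0 ltW.
  have le1 : \sum_a cmod (Y a b) <= B * s u.
    under eq_bigr do rewrite ent.
    rewrite -mulr_suml; apply: le_trans (ler_wpM2r _ col) _.
      by rewrite exprn_ge0// invr_ge0 ltW.
    rewrite -{1}(prednK K0) exprS exprVn -!mulrA.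
    by rewrite mulfV ?mulr1// expf_neq0// gt_eqF.
  (* The column bound is for the sum of moduli, and a sum of squares of nonnegative numbers is at
     most the square of their sum. *)
  rewrite -exprMn; apply: le_trans (_ : (\sum_a cmod (Y a b)) ^+ 2 <= _); last first.
    apply: lerXn2r => //; rewrite nnegrE; last by rewrite mulr_ge0// ltW.
    by apply: sumr_ge0 => a _; exact: cmod_ge0.
  rewrite expr2 mulr_suml; apply: ler_sum => a _.
  rewrite expr2 ler_wpM2l ?cmod_ge0//.
  by rewrite (bigD1 a)//= lerDl sumr_ge0// => c _; exact: cmod_ge0.
have Th0 : 0 <= \sum_(u | P u) s u ^+ 2.
  by apply: sumr_ge0 => u _; rewrite sqr_ge0.
rewrite ler_pdivrMr ?ltr0n//.
have -> : \sum_(i < K) frob2 (Ai i) = \sum_(i < K.-1.+1) frob2 (Ai i).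
  by rewrite prednK.
rewrite big_ord_recl /=.
rewrite (eq_bigr (fun=> frob2 (diag_mx d))) => [|i _]; last by [].
rewrite sumr_const card_ord fd -[_ *+ K.-1]mulr_natr.
have K1 : 1 <= K%:R :> R by rewrite ler1n.
have -> : K.-1%:R = K%:R - 1 :> R by rewrite -subn1 natrB.
set Th := \sum_(u | P u) _ in fY Th0 *.
have BT : 0 <= B ^+ 2 * Th by rewrite mulr_ge0 ?sqr_ge0.
nra.
Qed.

End FiniteOperators.

Lemma sum_bseq (T : finType) (V : nmodType) (P : pred (seq T)) (F : nat -> V) m :
  \sum_(t : m.-bseq T | P t) F (size t) =
  \sum_(a < m.+1) F a *+ #|[set u : a.-tuple T | P u]%SET|.
Proof.
pose sz (t : m.-bseq T) : 'I_m.+1 := Ordinal (size_bseq t : (size t < m.+1)%N).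
rewrite (partition_big sz xpredT)//=.
apply: eq_bigr => a _.
rewrite (eq_bigr (fun=> F a)); last first.
  by move=> t /andP[_ /eqP <-].
rewrite sumr_const; congr (_ *+ _).
pose h (u : a.-tuple T) : m.-bseq T := insubd [bseq] (tval u).
have hE u : h u = u :> seq T.
  by rewrite /h val_insubd size_tuple -ltnS ltn_ord.
rewrite -(@card_imset _ _ h); last first.
  by move=> u v /(congr1 val) /=; rewrite !hE => /val_inj.
apply: eq_card => t; rewrite [LHS]inE; apply/andP/imsetP.
  move=> [Pt /eqP at']; have st : size t == a by rewrite -at'.
  by exists (Tuple st); [rewrite inE|apply/val_inj; rewrite /= hE].
move=> [u]; rewrite inE => Pu ->; rewrite hE; split=> //.
by apply/eqP/val_inj; rewrite /= hE size_tuple.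
Qed.

Section OperatorSplit.
Variables (R : realType) (T : finType).
Local Notation C := R[i].

Lemma nseq_roots n : \prod_(x <- nseq n (0 : C)) ('X - x%:P) = 'X^n.
Proof. by rewrite big_nseq subr0 iter_mulr mulr1. Qed.

(** [Ym] evaluates at the points [P j]. For a nonzero eigenvalue of [opmx F *m (1%:M - Ym *m Vm)],
    the eigenvector is killed by [Ym], because [(1 - Y V) Y = 0]; so it vanishes at all [P j] and is
    an eigenvector of [F] up to a combination of the [V j]. *)
Lemma op_split (F : (T -> C) -> T -> C) n (V : 'I_n -> T -> C) (P : 'I_n -> T)
    (M : 'M[C]_n) (lam z : seq C) :
  is_lin F -> (forall i t, F (V i) t = \sum_k M i k * V k t) ->
  (forall i j, V i (P j) = (i == j)%:R) ->
  roots_of M lam -> roots_of (opmx F) z ->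
  exists s, perm_eq (z ++ nseq n 0) (s ++ lam) /\
    forall e, e \in s -> e != 0 ->
      exists x (c : 'I_n -> C), [/\ exists t, x t != 0, forall j, x (P j) = 0 &
        forall t, F x t = e * x t + \sum_j c j * V j t].
Proof.
move=> lF FV VP Ml Fz.
pose Vm : 'M[C]_(n, #|T|) := \matrix_(i, t) V i (enum_val t).
pose Ym : 'M[C]_(#|T|, n) := \matrix_(t, j) (enum_val t == P j)%:R.
have xY (x : T -> C) : vec x *m Ym = \row_j x (P j).
  apply/rowP => j; rewrite !mxE (bigD1 (enum_rank (P j)))//= !mxE enum_rankK eqxx mulr1.
  rewrite big1 ?addr0// => t tP; rewrite !mxE; case: eqP => [tE|]; last by rewrite mulr0.
  by case/eqP: tP; rewrite -tE enum_valK.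
have rowV i : row i Vm = vec (V i) by apply/rowP => t; rewrite !mxE.
have VF : Vm *m opmx F = M *m Vm.
  apply/row_matrixP => i; rewrite row_mul rowV vec_opmx//; apply/rowP => t.
  by rewrite !mxE FV; apply: eq_bigr => k _; rewrite !mxE.
have VY : Vm *m Ym = 1%:M.
  apply/row_matrixP => i; rewrite row_mul rowV xY; apply/rowP => j.
  by rewrite !mxE VP.
have [s Ns] := roots_of_exists (opmx F *m (1%:M - Ym *m Vm)).
exists s; split.
  apply: prod_XsubC_eq; rewrite !big_cat /= nseq_roots -[X in X * _]Fz -Ns -Ml.
  exact: char_poly_split.
move=> e es e0.
have /eigenvalueP[x xE x0] : eigenvalue (opmx F *m (1%:M - Ym *m Vm)) e.
  by rewrite eigenvalue_root_char (Ns : char_poly _ = _) root_prod_XsubC.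
have xY0 : x *m Ym = 0.
  have : e *: (x *m Ym) = 0.
    rewrite scalemxAl -xE -!mulmxA mulmxBl mul1mx -mulmxA VY mulmx1 subrr.
    by rewrite !mulmx0.
  by move/eqP; rewrite scaler_eq0 (negbTE e0) => /eqP.
pose c : 'rV[C]_n := x *m opmx F *m Ym.
have xF : x *m opmx F = e *: x + c *m Vm.
  by rewrite -xE /c mulmxA mulmxBr mulmx1 !mulmxA subrK.
exists (unvec x), (fun j => c 0 j); split.
- have [t xt] : exists t, x 0 t != 0.
    apply/existsP; apply: contraNT x0; rewrite negb_exists => /forallP H.
    by apply/eqP/rowP => t; rewrite mxE; apply/eqP; have := H t; rewrite negbK.
  by exists (enum_val t); rewrite /unvec enum_valK.
- by move=> j; have := congr1 (fun r : 'rV_n => r 0 j) xY0;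
    rewrite -{1}(unvecK x) xY !mxE.
move=> t; have := congr1 (fun r : 'rV_#|T| => r 0 (enum_rank t)) xF.
rewrite -{1}(unvecK x) vec_opmx// !mxE enum_rankK => ->; congr (_ + _).
by apply: eq_bigr => j _; rewrite !mxE enum_rankK.
Qed.

End OperatorSplit.

(** With [a = m + t + 1] and [b = s + 1], the right side is [(a + b)^2 - a^2]. It covers the rate
    [s * m] wanted for the error and one more [m] that absorbs constants. *)
Lemma shift_exponent_le s m t :
  (s * m + m <= 2 * (m + t.+1) * s.+1 + s.+1 * s.+1)%N.
Proof. by nia. Qed.

(** * The finite-rank correction of the truncated matrices *)

Section Perturbation.
Variables (R : realType) (rr : R).
Hypotheses (rr0 : 0 < rr) (rr1 : rr < 1).
Variables (N : nat) (A : 'M[int]_N) (i0 : 'I_N).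
Local Notation C := R[i].
Local Notation kap := (kap rr).
Local Notation Jw := (Jop A i0).
Local Notation Mw := (Mop A i0).
Variables (g : seqN N -> C) (G : R) (Bf : nat -> R).
Hypotheses (G0 : 0 <= G) (gG : bounded_by A g G) (gk : kreg rr A g).
Hypotheses (Bf0 : forall tau, 0 <= Bf tau)
  (HBf : forall tau m D (x : m.-bseq 'I_N -> C), 0 <= D ->
  (forall t, cmod (x t) <= D * kap (size t + tau)) ->
  forall t, cmod (Mw g x t) <= Bf tau * D * kap (size t + tau.+1)).
Variables (n : nat) (v : 'I_n -> seqN N -> C) (U : 'I_n -> seq 'I_N) (M : 'M[C]_n).
Hypothesis vk : forall i, kreg rr A (v i).
Hypothesis Lv : forall i w, SigmaA A w -> Lw A g (v i) w = \sum_k M i k * v k w.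
Hypothesis Jv : forall i j, Jw (v i) (U j) = (i == j)%:R.

Definition eop m (j : 'I_n) (t : m.-bseq 'I_N) : C :=
  Jw (Lw A g (v j)) t - Mw g (fun s : m.-bseq 'I_N => Jw (v j) s) t.

(* The finite-rank correction makes the span of the [Jw (v j)] invariant. *)
Definition Mp m (x : m.-bseq 'I_N -> C) (t : m.-bseq 'I_N) : C :=
  Mw g x t + \sum_j zext x (U j) * eop j t.

Lemma Mp_lin m : is_lin (@Mp m).
Proof.
move=> a x y t; rewrite /Mp (Mop_lin A i0 g a x y t) mulrDr addrACA; congr (_ + _).
rewrite mulr_sumr -big_split; apply: eq_bigr => j _ /=.
by rewrite zext_lin; ring.
Qed.

Lemma Mp_vanish m (x : m.-bseq 'I_N -> C) (t : m.-bseq 'I_N) :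
  ~~ (adm A t && (0 < size t)%N) -> Mp x t = 0.
Proof.
move=> /negbTE nt; rewrite /Mp /eop /Mop /Jop nt add0r big1// => j _.
by rewrite subr0 mulr0.
Qed.

Lemma Mp_Jv m i (t : m.-bseq 'I_N) : (forall j, size (U j) <= m)%N ->
  Mp (fun s : m.-bseq 'I_N => Jw (v i) s) t = \sum_k M i k * Jw (v k) t.
Proof.
move=> Um; rewrite /Mp (bigD1 i)//= zext_in// Jv eqxx mul1r big1 ?addr0; last first.
  by move=> j ji; rewrite zext_in// Jv eq_sym (negbTE ji) mul0r.
rewrite /eop addrC subrK -(is_lin_sum _ _ _ _ (@Jop_lin _ A i0 _)).
by apply: Jop_eq => u au /andP[u0 _]; rewrite Lv//; exact: SigmaA_ext.
Qed.

(** [err_bound] holds with every shift, so the shift [tau.+1 + sigma.+1] buys an arbitrary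
    exponential rate [sigma] in [m]. This is needed to beat the number of words in [trace_Mp_Mop].
    The spare factor [rr^m] absorbs the sum of the constants [E j]. *)
Lemma Mp_small tau sigma : exists m0, forall m, (m0 <= m)%N ->
  forall D (x : m.-bseq 'I_N -> C), 0 <= D ->
  (forall t, cmod (x t) <= D * kap (size t + tau)) ->
  forall t, cmod (Mp x t - Mw g x t) <= D * rr ^+ (sigma * m) * kap (size t + tau.+1).
Proof.
have H j := err_bound rr0 i0 G0 gG (vk j) (tau.+1 + sigma.+1).
pose E j := s2val (cid2 (H j)).
have E0 j : 0 <= E j by exact: (s2valP (cid2 (H j))).
have HE j := s2valP' (cid2 (H j)).
have [m0 Hm0] := @expr_small R rr (\sum_j E j + 1)^-1 (ltW rr0) rr1
  (ltac:(rewrite invr_gt0 ltr_wpDl ?sumr_ge0//)).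
exists (maxn 1 m0) => m mm D x D0 Hx t.
have m1 : (0 < m)%N by exact: leq_trans (leq_maxl _ _) mm.
have mm0 : (m0 <= m)%N by exact: leq_trans (leq_maxr _ _) mm.
rewrite /Mp addrC addKr; apply: le_trans (cmod_sum _ _ _) _.
have kk : kap (m + (tau.+1 + sigma.+1)) <=
    kap (size t + tau.+1) * rr ^+ (sigma * m) * rr ^+ m.
  rewrite addnA (kapDe rr0 rr1) -mulrA; apply: ler_pM; rewrite ?kap_ge0//.
  - by rewrite mulr_ge0 ?kap_ge0// exprn_ge0// ltW.
  - by apply: kap_le => //; rewrite leq_add2r size_bseq.
  rewrite -exprD -[kap sigma.+1]/(rr ^+ (sigma.+1 * sigma.+1)) -exprD; apply: ler_wiXn2l; rewrite ?ltW//.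
  exact: shift_exponent_le.
apply: le_trans (_ : \sum_j D * (E j * (kap (size t + tau.+1) * rr ^+ (sigma * m) * rr ^+ m)) <= _).
  apply: ler_sum => j _; rewrite cmodM; apply: ler_pM; rewrite ?cmod_ge0//.
    rewrite /zext; case: insubP => [s _ _|_] /=; last by rewrite cmod0.
    by apply: le_trans (Hx s) _; rewrite ler_piMr// kap_le1.
  apply: le_trans (HE j m t m1) _; rewrite ler_wpM2l//; exact: E0.
have Z : (\sum_j E j) * rr ^+ m <= 1.
  apply: le_trans (ler_wpM2l _ (Hm0 m mm0)) _; first exact: sumr_ge0.
  by rewrite ler_pdivrMr ?mul1r ?lerDl// ltr_wpDl ?sumr_ge0.
rewrite -mulr_sumr -mulr_suml.
have -> : (\sum_j E j) * (kap (size t + tau.+1) * rr ^+ (sigma * m) * rr ^+ m) =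
  (\sum_j E j) * rr ^+ m * (rr ^+ (sigma * m) * kap (size t + tau.+1)) by ring.
rewrite -(mulrA D) ler_wpM2l// ler_piMl//.
by rewrite mulr_ge0 ?kap_ge0// exprn_ge0// ltW.
Qed.

Lemma Mp_bound tau : exists m0, forall m, (m0 <= m)%N ->
  forall D (x : m.-bseq 'I_N -> C), 0 <= D ->
  (forall t, cmod (x t) <= D * kap (size t + tau)) ->
  forall t, cmod (Mp x t) <= (Bf tau + 1) * D * kap (size t + tau.+1).
Proof.
have [m0 H] := Mp_small tau 0; exists m0 => m mm D x D0 Hx t.
apply: le_trans (cmod_dist _ (Mw g x t)) _.
rewrite -mulrA mulrDl mul1r mulrA; apply: lerD; first exact: HBf.
by have := H m mm D x D0 Hx t; rewrite mul0n expr0 mulr1.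
Qed.

Lemma iter_Mp_bound j : exists m0, forall m, (m0 <= m)%N ->
  forall (x : m.-bseq 'I_N -> C), (forall t, cmod (x t) <= kap (size t)) ->
  forall t, cmod (iter j (@Mp m) x t) <=
    (\prod_(i < j) (Bf i + 1)) * kap (size t + j).
Proof.
elim: j => [|j [m1 IH]].
  by exists 0%N => m _ x Hx t; rewrite big_ord0 mul1r addn0.
have [m0 H] := Mp_bound j; exists (maxn m0 m1) => m mm x Hx t.
rewrite big_ord_recr /= [X in X * kap _]mulrC; apply: H.
- exact: leq_trans (leq_maxl _ _) mm.
- by apply: prodr_ge0 => i _; rewrite addr_ge0.
by apply: IH => //; exact: leq_trans (leq_maxr _ _) mm.
Qed.

(** Each application gains a letter, so the [j]-th power satisfies the hypothesis of [schatten_op]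
    with [s u = r0^(2 |u| j)]: [kap (|u| + j)] is at most [kap |u| * rr^(2 |u| j)]. Grouping words
    by length turns the sum of [s u ^+ 2] into the word counts bounded by [Th]. *)
Lemma Mp_schatten (r0 Th : R) (l j : nat) : (0 < j)%N -> 0 < r0 ->
  r0 ^+ (2 ^ l) = rr ->
  (forall m, \sum_(a < m.+1) (nwords A a)%:R * (r0 ^+ (2 * a * j)) ^+ 2 <= Th) ->
  exists m0, forall m, (m0 <= m)%N -> forall z, roots_of (opmx (@Mp m)) z ->
  \sum_(x <- z) cmod x `^ (2 * j%:R / (2 ^ l)%:R) <=
    (1 + (\prod_(i < j) (Bf i + 1)) ^+ 2) * Th.
Proof.
move=> j0 r00 r0E HTh; have [m0 H] := iter_Mp_bound j.
exists m0 => m mm z Fz; set B := \prod_(i < j) _.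
have B0 : 0 <= B by apply: prodr_ge0 => i _; rewrite addr_ge0.
pose P (t : seq 'I_N) := adm A t && (0 < size t)%N.
have := @schatten_op R _ (@Mp m) (fun t => kap (size t))
  (fun t : m.-bseq 'I_N => r0 ^+ (2 * size t * j)) (fun t => P t) l j B z
  (@Mp_lin m) j0 (fun t => kap_gt0 rr0 _) (fun t => exprn_gt0 _ r00) B0 _ _ Fz.
move=> /(_ _ _) H1; apply: le_trans (H1 _ _) _.
- by move=> x t; exact: Mp_vanish.
- move=> x Hx u; apply: le_trans (H m mm x Hx u) _.
  rewrite -mulrA ler_wpM2l// (kapDe rr0 rr1) ler_wpM2l ?kap_ge0//.
  have -> : (r0 ^+ (2 * size u * j)) ^+ (2 ^ l) = rr ^+ (2 * size u * j).
    by rewrite -r0E -!exprM mulnC.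
  by rewrite ler_piMr ?kap_le1// exprn_ge0// ltW.
rewrite ler_wpM2l ?addr_ge0 ?sqr_ge0//.
apply: le_trans (HTh m).
apply: le_trans (_ : \sum_(t : m.-bseq 'I_N | adm A t) (r0 ^+ (2 * size t * j)) ^+ 2 <= _).
  rewrite [leRHS](bigID (fun t : m.-bseq 'I_N => (0 < size t)%N)) /= lerDl.
  by apply: sumr_ge0 => t _; rewrite sqr_ge0.
rewrite (sum_bseq (adm A) (fun a => (r0 ^+ (2 * a * j)) ^+ 2)).
by apply: ler_sum => a _; rewrite (nwordsE A i0) mulr_natl.
Qed.

Lemma iter_Mp_diff sigma q : exists m0, exists2 B, 0 <= B & forall m, (m0 <= m)%N ->
  forall (x : m.-bseq 'I_N -> C), (forall t, cmod (x t) <= kap (size t)) ->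
  forall t, cmod (iter q (@Mp m) x t) <= B * kap (size t) /\
   cmod (iter q (@Mp m) x t - iter q (@Mop _ A i0 _ m g) x t) <=
    B * rr ^+ (sigma * m) * kap (size t).
Proof.
elim: q => [|q [m1 [B B0 IH]]].
  exists 0%N; exists 1 => // m _ x Hx t /=.
  by rewrite subrr cmod0 !mul1r mulr_ge0 ?kap_ge0// exprn_ge0// ltW.
have [m2 H2] := Mp_small 0 sigma; have [m3 H3] := Mp_bound 0.
exists (maxn m1 (maxn m2 m3)); exists ((Bf 0 + 1) * B).
  by rewrite mulr_ge0// addr_ge0.
move=> m; rewrite !geq_max => /andP[mm1 /andP[mm2 mm3]] x Hx t /=.
set y := iter q _ x; set y' := iter q (@Mop _ A i0 _ m g) x.
have Hy s : cmod (y s) <= B * kap (size s + 0) by rewrite addn0; case: (IH m mm1 x Hx s).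
have Hyy s : cmod (y s - y' s) <= B * rr ^+ (sigma * m) * kap (size s + 0).
  by rewrite addn0; case: (IH m mm1 x Hx s).
have k1 : kap (size t + 1) <= kap (size t) by apply: kap_le => //; rewrite leq_addr.
have rs0 : 0 <= rr ^+ (sigma * m) by rewrite exprn_ge0// ltW.
split.
  apply: le_trans (H3 m mm3 B y B0 Hy t) _.
  by rewrite ler_wpM2l// mulr_ge0// addr_ge0.
have -> : Mp y t - Mw g y' t = (Mp y t - Mw g y t) + Mw g (fun s => y s - y' s) t.
  have := Mop_lin A i0 g (-1) y' y t; rewrite mulN1r addrC => E.
  rewrite (_ : (fun s => y s - y' s) = (fun s => -1 * y' s + y s)).
    by rewrite Mop_lin; ring.
  by apply/funext => s; rewrite mulN1r addrC.
apply: le_trans (cmodD _ _) _.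
have D0 : 0 <= B * rr ^+ (sigma * m) by exact: mulr_ge0.
apply: le_trans (lerD (H2 m mm2 B y B0 Hy t) (HBf D0 Hyy t)) _.
rewrite -mulrDl.
have -> : B * rr ^+ (sigma * m) + Bf 0 * (B * rr ^+ (sigma * m)) =
  (Bf 0 + 1) * B * rr ^+ (sigma * m) by ring.
by rewrite ler_wpM2l// !mulr_ge0// addr_ge0.
Qed.

Lemma card_bseq_le m : (#|{: m.-bseq 'I_N}| <= (2 * N) ^ m)%N.
Proof.
have N0 : (0 < N)%N by exact: leq_ltn_trans (ltn_ord i0).
have := @sum_bseq 'I_N nat xpredT (fun=> 1%N) m.
rewrite sum1_card => ->.
apply: leq_trans (_ : \sum_(a < m.+1) N ^ m <= _)%N.
  apply: leq_sum => a _; rewrite (_ : #|_| = N ^ a)%N; last first.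
    by rewrite -[in RHS](card_ord N) -card_tuple; apply: eq_card => u; rewrite !inE.
  by rewrite -[leqLHS]/(_ *+ _) natn leq_pexp2l// -ltnS.
rewrite sum_nat_const card_ord expnMn leq_mul//.
exact: ltn_expl.
Qed.

(** Each diagonal entry changes by at most [B * rr^(s m)] and there are at most [(2N)^m] of them.
    With [rr^s <= b = 1/(4N)] the total is at most [B * 2^-m]. *)
Lemma trace_Mp_Mop q (e : R) : 0 < e -> exists m0, forall m, (m0 <= m)%N ->
  cmod (\tr (opmx (@Mp m) ^+ q) - \tr (opmx (@Mop _ A i0 _ m g) ^+ q)) <= e.
Proof.
move=> e0; pose b : R := (2 * (2 * N)%:R)^-1.
have N0 : (0 < N)%N by exact: leq_ltn_trans (ltn_ord i0).
have N0' : 0 < (2 * N)%:R :> R by rewrite ltr0n muln_gt0.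
have b0 : 0 < b by rewrite invr_gt0 mulr_gt0.
have [s Hs] := expr_small (ltW rr0) rr1 b0.
have [m1 [B B0 HB]] := iter_Mp_diff s q.
have [m2 Hm2] := @expr_small_mul R 2^-1 B e (ltac:(lra)) (ltac:(lra)) B0 e0.
exists (maxn m1 m2) => m; rewrite geq_max => /andP[mm1 mm2].
rewrite !opmxX; [|exact: Mop_lin|exact: Mp_lin].
rewrite !trace_opmx -sumrB.
apply: le_trans (cmod_sum _ _ _) _.
apply: le_trans (_ : \sum_(t : m.-bseq 'I_N) B * rr ^+ (s * m) <= _).
  apply: ler_sum => t _.
  (* The basis function is scaled by [kap (size t)] to meet the normalization in [HB]; by linearity
     the same factor returns on the other side and cancels. *)
  pose x u : C := (kap (size t))%:C%C * (u == t)%:R.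
  have Hx u : cmod (x u) <= kap (size u).
    rewrite /x cmodM cmodR ger0_norm ?kap_ge0// cmod_nat.
    by case: eqP => [->|_]; rewrite ?mulr1// mulr0 kap_ge0.
  have [_] := HB m mm1 x Hx t.
  have E F : is_lin F -> iter q F x t = (kap (size t))%:C%C *
      iter q F (fun u : m.-bseq 'I_N => (u == t)%:R) t.
    move=> lF; have lq := iter_lin q lF.
    have := lq (kap (size t))%:C%C (fun u => (u == t)%:R) (fun=> 0) t.
    rewrite (is_lin0 lq) addr0 => <-; congr (iter q F _ t).
    by apply/funext => u; rewrite addr0.
  rewrite !E; [|exact: Mop_lin|exact: Mp_lin].
  rewrite -mulrBr cmodM cmodR ger0_norm ?kap_ge0// mulrC.
  by rewrite ler_pM2r ?kap_gt0.
rewrite sumr_const -[_ *+ _]mulr_natr.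
have H1 : #|{: m.-bseq 'I_N}|%:R <= (2 * N)%:R ^+ m :> R.
  by rewrite -natrX ler_nat card_bseq_le.
have rs0 : 0 <= rr ^+ (s * m) by rewrite exprn_ge0// ltW.
have H2 : rr ^+ (s * m) <= b ^+ m.
  rewrite exprM; apply: lerXn2r; rewrite ?nnegrE ?(ltW b0) ?exprn_ge0 ?(ltW rr0)//.
  exact: Hs.
apply: le_trans (_ : B * b ^+ m * (2 * N)%:R ^+ m <= _).
  apply: ler_pM => //; first by rewrite mulr_ge0.
  by rewrite ler_wpM2l.
rewrite -mulrA -exprMn.
have -> : b * (2 * N)%:R = 2^-1.
  by rewrite /b invfM -mulrA mulVf ?mulr1// gt_eqF.
exact: Hm2.
Qed.

End Perturbation.

(** * Compactness *)

(** Along a free ultrafilter all bounded sequences converge at once, so eigenvalues, coefficients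
    and function values at every point [w] share one passage to the limit, in place of a diagonal
    extraction. *)
Lemma exists_free_ultrafilter : exists U : set_system nat,
  UltraFilter U /\ forall k0, U [set k | (k0 <= k)%N].
Proof.
have [U [UU sub]] := ultraFilterLemma (@eventually_filter).
exists U; split=> // k0; apply: sub.
by exists k0.
Qed.

Section UltraLimits.
Variables (R : realType) (U : set_system nat).
Hypothesis UU : UltraFilter U.
Hypothesis Uoo : forall k0, U [set k | (k0 <= k)%N].
Local Notation C := R[i].
Implicit Types (x y : nat -> C) (l : C).

Definition ucvg x l := forall e : R, 0 < e -> U [set k | cmod (x k - l) <= e].

Lemma ultra_real (y : nat -> R) (b : R) : (forall k, `|y k| <= b) ->
  exists l : R, forall e : R, 0 < e -> U [set k | `|y k - l| <= e].
Proof.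
move=> yb.
have [|l [_ cl]] := @segment_compact R (- b) b (y @ U) _.
  apply: (@filterS _ U _ setT); last exact: filterT.
  by move=> k _ /=; rewrite in_itv /= -ler_norml.
exists l => e e0.
have [//|H] := in_ultra_setVsetC [set k | `|y k - l| <= e] UU.
have Hy : (y @ U) [set z | ~ `|z - l| <= e] by exact: H.
have [z [/= nz]] := cl _ (ball l e) Hy (nbhsx_ballx l _ e0).
by rewrite /ball /= distrC => /ltW.
Qed.

Lemma ucvg_exists x (b : R) : (forall k, cmod (x k) <= b) -> exists l, ucvg x l.
Proof.
move=> xb.
have [l1 H1] := @ultra_real (fun k => complex.Re (x k)) b
  (fun k => le_trans (cmod_Re _) (xb k)).
have [l2 H2] := @ultra_real (fun k => complex.Im (x k)) b
  (fun k => le_trans (cmod_Im _) (xb k)).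
exists (l1 +i* l2)%C => e e0.
have e20 : 0 < e / 2 by rewrite divr_gt0.
apply: filterS (filterI (H1 _ e20) (H2 _ e20)) => k [/= h1 h2].
apply: le_trans (cmod_ReIm _) _; rewrite (splitr e).
by case: (x k) h1 h2 => a c /= h1 h2; apply: lerD.
Qed.

Lemma ucvg_eq x y l : (exists k0, forall k, (k0 <= k)%N -> x k = y k) ->
  ucvg x l -> ucvg y l.
Proof.
move=> [k0 E] H e e0; apply: filterS (filterI (Uoo k0) (H e e0)) => k [/= kk h].
by rewrite -E.
Qed.

Lemma ucvg_cst l : ucvg (fun=> l) l.
Proof.
move=> e e0; apply: (@filterS _ U _ setT); last exact: filterT.
by move=> k _ /=; rewrite subrr cmod0 ltW.
Qed.

Lemma ucvgD x y l l' : ucvg x l -> ucvg y l' -> ucvg (fun k => x k + y k) (l + l').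
Proof.
move=> H1 H2 e e0; have e20 : 0 < e / 2 by rewrite divr_gt0.
apply: filterS (filterI (H1 _ e20) (H2 _ e20)) => k [/= h1 h2].
by rewrite opprD addrACA (splitr e) (le_trans (cmodD _ _))// lerD.
Qed.

Lemma ucvg_le x l b : ucvg x l -> U [set k | cmod (x k) <= b] -> cmod l <= b.
Proof.
move=> H Hb; apply/ler_addgt0Pr => e e0.
have [k [/= h1 h2]] := filter_ex (filterI Hb (H e e0)).
apply: le_trans (cmod_dist l (x k)) _.
by rewrite lerD// cmodB.
Qed.

Lemma ucvg_ge x l b : ucvg x l -> U [set k | b <= cmod (x k)] -> b <= cmod l.
Proof.
move=> H Hb; apply/ler_addgt0Pr => e e0.
have [k [/= h1 h2]] := filter_ex (filterI Hb (H e e0)).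
apply: le_trans h1 _; apply: le_trans (cmod_dist (x k) l) _.
by rewrite lerD.
Qed.

Lemma ucvgM x y l l' : ucvg x l -> ucvg y l' -> ucvg (fun k => x k * y k) (l * l').
Proof.
move=> H1 H2 e e0.
pose d : R := Num.min 1 (e / (cmod l + cmod l' + 1)).
have s0 : 0 < cmod l + cmod l' + 1 by rewrite ltr_wpDl// addr_ge0 ?cmod_ge0.
have d0 : 0 < d by rewrite lt_min ltr01 divr_gt0.
apply: filterS (filterI (H1 _ d0) (H2 _ d0)) => k [/= h1 h2].
have -> : x k * y k - l * l' =
   (x k - l) * (y k - l') + (l * (y k - l') + (x k - l) * l') by ring.
apply: le_trans (cmodD _ _) _; apply: le_trans (lerD (lexx _) (cmodD _ _)) _.
rewrite !cmodM.
have d1 : d <= 1 by rewrite ge_min lexx.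
have de : d * (cmod l + cmod l' + 1) <= e.
  by rewrite -ler_pdivlMr// ge_min lexx orbT.
have := cmod_ge0 (x k - l); have := cmod_ge0 (y k - l').
have := cmod_ge0 l; have := cmod_ge0 l'.
nra.
Qed.

Lemma ucvgB x y l l' : ucvg x l -> ucvg y l' -> ucvg (fun k => x k - y k) (l - l').
Proof.
move=> H1 H2; rewrite -mulN1r; apply: ucvg_eq (ucvgD H1 (ucvgM (ucvg_cst (-1)) H2)).
by exists 0%N => k _; rewrite mulN1r.
Qed.

Lemma ucvg_sum (I : Type) (s : seq I) (P : pred I) (F : I -> nat -> C) (L : I -> C) :
  (forall i, P i -> ucvg (F i) (L i)) ->
  ucvg (fun k => \sum_(i <- s | P i) F i k) (\sum_(i <- s | P i) L i).
Proof.
move=> H; elim: s => [|i s IH].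
  rewrite big_nil; apply: ucvg_eq (ucvg_cst 0); exists 0%N => k _.
  by rewrite big_nil.
rewrite big_cons; case: ifP => Pi.
  apply: ucvg_eq (ucvgD (H i Pi) IH); exists 0%N => k _.
  by rewrite big_cons Pi.
by apply: ucvg_eq IH; exists 0%N => k _; rewrite big_cons Pi.
Qed.

Lemma ucvg0 x (b : nat -> R) : (forall k, cmod (x k) <= b k) ->
  (forall e, 0 < e -> exists k0, forall k, (k0 <= k)%N -> b k <= e) -> ucvg x 0.
Proof.
move=> H Hb e e0; have [k0 Hk] := Hb e e0.
apply: filterS (Uoo k0) => k /= kk; rewrite subr0.
exact: le_trans (H k) (Hk k kk).
Qed.

Lemma ucvg_unique x l l' : ucvg x l -> ucvg x l' -> l = l'.
Proof.
move=> H1 H2; apply/eqP; rewrite -subr_eq0 -cmod_eq0 eq_le cmod_ge0 andbT.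
apply/ler_addgt0Pr => e e0; rewrite add0r.
have e20 : 0 < e / 2 by rewrite divr_gt0.
have [k [/= h1 h2]] := filter_ex (filterI (H1 _ e20) (H2 _ e20)).
rewrite (splitr e); apply: le_trans (cmod_tri l (x k) l') _.
by apply: lerD => //; rewrite cmodB.
Qed.

End UltraLimits.

Lemma small_absurd (R : realType) (eps K q : R) : 0 < eps -> 0 <= K ->
  eps <= K * q -> q <= eps / (2 * (K + 1)) -> False.
Proof.
move=> e0 K0 H1 H2; have K1 : 0 < 2 * (K + 1) by lra.
rewrite ler_pdivlMr// in H2.
nra.
Qed.

Section Compactness.
Variables (R : realType) (rr : R).
Hypotheses (rr0 : 0 < rr) (rr1 : rr < 1).
Variables (N : nat) (A : 'M[int]_N) (i0 : 'I_N).
Local Notation C := R[i].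
Local Notation kap := (kap rr).
Local Notation Jw := (Jop A i0).
Variables (g : seqN N -> C) (G : R) (Bf : nat -> R).
Hypotheses (G0 : 0 <= G) (gG : bounded_by A g G) (gk : kreg rr A g).
Hypotheses (Bf0 : forall tau, 0 <= Bf tau)
  (HBf : forall tau m D (x : m.-bseq 'I_N -> C), 0 <= D ->
  (forall t, cmod (x t) <= D * kap (size t + tau)) ->
  forall t, cmod (Mop A i0 g x t) <= Bf tau * D * kap (size t + tau.+1)).
Variables (n : nat) (v : 'I_n -> seqN N -> C) (U : 'I_n -> seq 'I_N).
Hypothesis vk : forall i, kreg rr A (v i).
Hypothesis Jv : forall i j, Jw (v i) (U j) = (i == j)%:R.

(** The outcome of [op_split]: an eigenvector modulo the span of the [v j], normalized by vanishing
    at their dual words. *)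
Definition quasi_eigen m (e : C) (x : m.-bseq 'I_N -> C) (c : 'I_n -> C) :=
  (forall j, zext x (U j) = 0) /\
  forall t, Mp A i0 g v U x t = e * x t + \sum_j c j * Jw (v j) t.

Definition normalized m (x : m.-bseq 'I_N -> C) :=
  (forall t, cmod (x t) <= kap (size t)) /\ exists t, cmod (x t) = kap (size t).

Lemma quasi_eigen_normalize m e (x : m.-bseq 'I_N -> C) c :
  (exists t, x t != 0) -> quasi_eigen e x c ->
  exists x' c', quasi_eigen (m := m) e x' c' /\ normalized x'.
Proof.
move=> [t0 xt0] [x0 xE].
have [t1 _ t1max] := @Order.TotalTheory.arg_maxP _ _ _ t0 xpredT
  (fun t : m.-bseq 'I_N => cmod (x t) / kap (size t)) isT.
set D := cmod (x t1) / kap (size t1).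
have D0 : 0 < D.
  apply: lt_le_trans (t1max t0 isT); rewrite divr_gt0 ?kap_gt0// cmod_gt0//.
have DC : (D%:C)%C != 0 :> C.
  by rewrite -cmod_eq0 cmodR gtr0_norm// gt_eqF.
exists (fun t => (D%:C)%C^-1 * x t), (fun j => (D%:C)%C^-1 * c j).
have H y : (D%:C)%C^-1 * y = (D%:C)%C^-1 * y + 0 by rewrite addr0.
split; first split.
- move=> j; rewrite (_ : (fun t => _) = (fun t => (D%:C)%C^-1 * x t + 0)); last first.
    by apply/funext => t.
  have := zext_lin (D%:C)%C^-1 x (fun=> 0) (U j); rewrite x0 mulr0 => ->.
  by rewrite add0r (is_lin0 (@zext_lin _ _ m)).
- move=> t; rewrite (_ : (fun t => _) = (fun t => (D%:C)%C^-1 * x t + 0)); last first.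
    by apply/funext => s.
  have Ml := @Mp_lin R N A i0 g n v U m.
  rewrite (Ml (D%:C)%C^-1 x (fun=> 0) t) (is_lin0 Ml) addr0 xE mulrDr mulrCA.
  by congr (_ + _); rewrite mulr_sumr; apply: eq_bigr => j _; rewrite mulrA.
split.
  move=> t; rewrite cmodM cmodV cmodR gtr0_norm// mulrC ler_pdivrMr//.
  by have /= := t1max t isT; rewrite -/D ler_pdivrMr ?kap_gt0// mulrC.
exists t1; rewrite cmodM cmodV cmodR gtr0_norm// /D invf_div mulrAC mulfK//.
by apply: contraTneq D0; rewrite /D => ->; rewrite mul0r ltxx.
Qed.

(** At the word [U j] the vector vanishes and the [v i] are dual, so the equation there reads off
    [c j], which is thus bounded. Then [e * x] is [Mp x] minus a controlled combination, and both
    gain one letter. *)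
Lemma quasi_eigen_decay : exists m0, exists2 K, 0 <= K & forall m, (m0 <= m)%N ->
  forall e (x : m.-bseq 'I_N -> C) c, quasi_eigen e x c -> normalized x ->
  (forall t, cmod e * cmod (x t) <= K * kap (size t + 1)) /\ forall j, cmod (c j) <= K.
Proof.
have [m1 Hm1] := Mp_bound rr0 rr1 G0 gG HBf U vk 0.
have HJ j := Jop_kreg rr0 i0 (vk j) 1.
pose E j := s2val (cid2 (HJ j)).
have E0 j : 0 <= E j by exact: (s2valP (cid2 (HJ j))).
have HE j u : cmod (Jw (v j) u) <= E j * kap (size u + 1).
  exact: (s2valP' (cid2 (HJ j))).
pose B := Bf 0 + 1.
have B0 : 0 <= B by rewrite addr_ge0.
have S0 : 0 <= \sum_j E j by exact: sumr_ge0.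
exists (maxn m1 (\max_j size (U j))), (B + B * \sum_j E j).
  by rewrite addr_ge0// mulr_ge0.
move=> m; rewrite geq_max => /andP[mm1 /bigmax_leqP mU] e x c [x0 xE] [xk _].
have MB t : cmod (Mp A i0 g v U x t) <= B * kap (size t + 1).
  have := Hm1 m mm1 1 x ler01 _ t; rewrite mulr1; apply => s.
  by rewrite mul1r addn0.
have cB j : cmod (c j) <= B.
  have Um : (size (U j) <= m)%N by exact: mU.
  pose t : m.-bseq 'I_N := Bseq Um.
  have := xE t; rewrite /= (_ : x t = 0); last by rewrite -(x0 j) -(zext_val x t).
  rewrite mulr0 add0r (bigD1 j)//= Jv eqxx mulr1 big1 ?addr0; last first.
    by move=> i ij; rewrite Jv (negbTE ij) mulr0.
  by move=> <-; apply: le_trans (MB t) _; rewrite ler_piMr// kap_le1.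
split; last first.
  by move=> j; apply: le_trans (cB j) _; rewrite lerDl mulr_ge0.
move=> t; rewrite -cmodM.
have -> : e * x t = Mp A i0 g v U x t - \sum_j c j * Jw (v j) t.
  by rewrite xE addrK.
apply: le_trans (cmodBD _ _) _; rewrite mulrDl; apply: lerD; first exact: MB.
apply: le_trans (cmod_sum _ _ _) _; rewrite mulr_sumr mulr_suml.
apply: ler_sum => j _; rewrite cmodM -mulrA.
by apply: ler_pM; rewrite ?cmod_ge0.
Qed.

(** The danger is that the normalized vectors concentrate on longer and longer words and converge to
    0. The gained letter together with [eps <= cmod e] confines the maximum to words shorter than a
    fixed [a0]. *)
Lemma quasi_eigen_limit (eps : R) : 0 < eps ->
  (forall m0, exists m, (m0 <= m)%N /\ exists e (x : m.-bseq 'I_N -> C) c,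
     [/\ eps <= cmod e, exists t, x t != 0 & quasi_eigen e x c]) ->
  exists z c s, [/\ eps <= cmod z, inV A s,
    forall w, SigmaA A w -> Lw A g s w = z * s w + \sum_j c j * v j w,
    forall j : 'I_n, Jw s (U j) = 0 & exists w, SigmaA A w /\ s w != 0].
Proof.
move=> eps0 Hq.
have [m1 [K K0 HK]] := quasi_eigen_decay.
have /choice[d Hd] : forall k, exists d : {m : nat & (C * (m.-bseq 'I_N -> C) * ('I_n -> C))%type},
   let: existT m (e, x, c) := d in
   [/\ (k < m)%N, (m1 <= m)%N, eps <= cmod e, quasi_eigen e x c & normalized x].
  move=> k; have [m [mk [e [x [c [ee xt qe]]]]]] := Hq (maxn k.+1 m1).
  have [x' [c' [qe' nx']]] := quasi_eigen_normalize xt qe.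
  exists (existT _ m (e, x', c')); split=> //.
    by apply: leq_trans mk; rewrite leq_maxl.
  by apply: leq_trans mk; rewrite leq_maxr.
pose m k := projT1 (d k).
pose e k : C := (projT2 (d k)).1.1.
pose x k : (m k).-bseq 'I_N -> C := (projT2 (d k)).1.2.
pose c k : 'I_n -> C := (projT2 (d k)).2.
have {}Hd k : [/\ (k < m k)%N, (m1 <= m k)%N, eps <= cmod (e k),
    quasi_eigen (e k) (@x k) (c k) & normalized (@x k)].
  by have := Hd k; rewrite /e /x /c /m; case: (d k) => m' [[e' x'] c'].
clearbody m e x c; clear d Hq.
pose X k := zext (@x k).
pose s k w := Sop (m k) (X k) w.
pose D := K / eps.
have D0 : 0 <= D by rewrite divr_ge0// ltW.
have ek0 k : e k != 0.
  have [_ _ ee _ _] := Hd k; rewrite -cmod_gt0; exact: lt_le_trans ee.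
have dec k t : cmod (e k) * cmod (@x k t) <= K * kap (size t + 1).
  have [_ mm1 _ qe nx'] := Hd k; by have [H _] := HK _ mm1 _ _ _ qe nx'.
have cK k j : cmod (c k j) <= K.
  have [_ mm1 _ qe nx'] := Hd k; by have [_ H] := HK _ mm1 _ _ _ qe nx'.
have XD k u : (0 < size u)%N -> cmod (X k u) <= D * kap (size u + 1).
  move=> _; rewrite /X /zext; case: insubP => [t _ <-|_] /=; last first.
    by rewrite cmod0 mulr_ge0// kap_ge0.
  have [_ _ ee _ _] := Hd k.
  rewrite /D mulrAC ler_pdivlMr// mulrC.
  by apply: le_trans (dec k t); rewrite ler_wpM2r ?cmod_ge0.
pose Sg : R := (1 - rr)^-1.
have Sg0 : 0 <= Sg by rewrite invr_ge0 subr_ge0 ltW.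
have tail k a w : \sum_(b < m k | (a <= b)%N) cmod (X k (pre b.+1 w)) <=
    D * kap (a.+1 + 1) * Sg.
  exact: (Sop_tail rr0 rr1 (m k) a w D0 (XD k)).
have sb k w : cmod (s k w) <= D * Sg.
  apply: le_trans (cmod_sum _ _ _) _; apply: le_trans (tail k 0%N w) _.
  by rewrite ler_wpM2r// ler_piMr// kap_le1.
have svar k a w w' : (forall i, (i < a)%N -> w i = w' i) ->
    cmod (s k w - s k w') <= 2 * (D * Sg) * kap a.
  move=> E; rewrite /s /Sop -sumrB.
  rewrite (bigID (fun b : 'I_(m k) => (a <= b)%N)) /= [X in _ + X]big1 ?addr0; last first.
    move=> b; rewrite -ltnNge => ba.
    rewrite (_ : pre b.+1 w = pre b.+1 w') ?subrr//.
    by apply: (@eq_pre _ i0) => i ib; apply: E; apply: leq_trans ib ba.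
  apply: le_trans (cmod_sum _ _ _) _.
  apply: le_trans (ler_sum _ (fun b _ => cmodBD _ _)) _.
  rewrite big_split /= -mulrA mulr_natl mulr2n.
  have ka : kap (a.+1 + 1) <= kap a by apply: kap_le => //; rewrite addn1 ltnW.
  have le2 w1 : \sum_(b < m k | (a <= b)%N) cmod (X k (pre b.+1 w1)) <= D * Sg * kap a.
    apply: le_trans (tail k a w1) _; rewrite mulrAC ler_wpM2l//; exact: mulr_ge0.
  by apply: lerD; exact: le2.
have eK k : cmod (e k) <= K.
  have [_ _ _ _ [_ [t xt]]] := Hd k; have := dec k t; rewrite xt => H.
  have kt : 0 < kap (size t) by exact: kap_gt0.
  rewrite -(ler_pM2r kt); apply: le_trans H _; rewrite ler_wpM2l//.
  by apply: kap_le => //; rewrite leq_addr.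
have [a0 Ha0] := @expr_small R rr (eps / (2 * (K + 1))) (ltW rr0) rr1
  (divr_gt0 eps0 (mulr_gt0 (ltr0n _ 2) (ltr_wpDl K0 ltr01))).
(* At the word where the weighted maximum 1 is attained, the decay bound gives
   [eps <= K * rr^(size t)], which bounds its length. *)
have tk k : exists t : (m k).-bseq 'I_N,
    cmod (@x k t) = kap (size t) /\ (size t < a0)%N.
  have [_ _ ee _ [_ [t xt]]] := Hd k; exists t; split=> //.
  rewrite ltnNge; apply/negP => at'.
  have := dec k t; rewrite xt => H.
  have kt : 0 < kap (size t) by exact: kap_gt0.
  have H1 : kap (size t + 1) <= kap (size t) * rr ^+ size t.
    rewrite (kapDe rr0 rr1) ler_wpM2l ?kap_ge0// muln1 mul2n -addnn exprD -mulrA.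
    rewrite ler_piMr ?exprn_ge0 ?(ltW rr0)//.
    apply: mulr_ile1; [exact: exprn_ge0 (ltW rr0)|exact: kap_ge0| |exact: kap_le1].
    exact: exprn_ile1 (ltW rr0) (ltW rr1).
  have H2 : cmod (e k) <= K * rr ^+ size t.
    rewrite -(ler_pM2r kt); apply: le_trans H _.
    by rewrite -mulrA ler_wpM2l// mulrC.
  exact: small_absurd eps0 K0 (le_trans ee H2) (Ha0 _ at').
(* By the quasi-eigenvector equation the increments of [psi k] up to length [m k] are the
   coordinates [X k]. Hence [s k] is [psi k] cut after [m k] letters, and its increments are again
   [X k] ([JsX]). *)
pose psi k w := (e k)^-1 * (Lw A g (s k) w - \sum_j c k j * v j w).
have Xpsi k u : (size u <= m k)%N -> X k u = Jw (psi k) u.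
  move=> um; have [_ _ _ [x0 xE] _] := Hd k.
  pose t : (m k).-bseq 'I_N := Bseq um.
  have := xE t; rewrite /Mp big1 ?addr0; last by move=> j _; rewrite x0 mul0r.
  rewrite /Mop -/(X k) -[Sop (m k) (X k)]/(s k) /= => H.
  have Xu : X k u = x k t by rewrite /X -(zext_val (@x k) t).
  rewrite Xu; apply: (mulfI (ek0 k)); rewrite -[LHS](addrK (\sum_j c k j * Jw (v j) u)) -H.
  have JL := @Jop_lin N A i0 C.
  have -> : \sum_j c k j * Jw (v j) u = Jw (fun w => \sum_j c k j * v j w) u.
    by rewrite (is_lin_sum _ _ _ _ JL).
  have := JL (-1) (fun w => \sum_j c k j * v j w) (Lw A g (s k)) u.
  rewrite mulN1r addrC => <-.
  have := JL (e k) (psi k) (fun=> 0) u; rewrite (is_lin0 JL) addr0 => <-.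
  congr (Jop _ _ _ _); apply/funext => w.
  by rewrite /psi mulrA mulfV// mul1r addr0 mulN1r addrC.
have spsi k w : SigmaA A w -> s k w = psi k (ext A i0 (pre (m k) w)).
  move=> Sw; have [mk _ _ _ _] := Hd k; have mk0 : (0 < m k)%N by exact: leq_ltn_trans mk.
  rewrite -Sop_Jop//; apply: Sop_eq => b /andP[_ bm].
  by rewrite Xpsi// size_pre.
have JsX k u : (size u <= m k)%N -> Jw (s k) u = X k u.
  move=> um; rewrite Xpsi//; apply: Jop_eq => w aw /andP[w0 wu].
  rewrite spsi; last exact: SigmaA_ext.
  by rewrite ext_pre_ext// (leq_trans wu).
have [Bg Bg0 HBg] := gk 0.
have HV j := vk j 0%N.
pose Bv j := s2val (cid2 (HV j)).
have Bv0 j : 0 <= Bv j by exact: (s2valP (cid2 (HV j))).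
have HBv j a : var_le A (v j) a (Bv j * kap a).
  by have := s2valP' (cid2 (HV j)) a; rewrite addn0.
pose Err := N%:R * (Bg * (D * Sg)) + \sum_j K * Bv j.
have Err0 : 0 <= Err.
  apply: addr_ge0; first by apply: mulr_ge0 => //; apply: mulr_ge0 => //; exact: mulr_ge0.
  by apply: sumr_ge0 => j _; exact: mulr_ge0.
(* The equation holds exactly at the standard extension [w']; moving from [w'] to [w] costs the
   variation of [g] and of the [v j] beyond level [m k], while [s k] itself does not change on the
   preimages. *)
have near k w : SigmaA A w ->
    cmod (e k * s k w + \sum_j c k j * v j w - Lw A g (s k) w) <= Err * rr ^+ k.
  move=> Sw; have [mk _ _ _ _] := Hd k; have mk0 : (0 < m k)%N by exact: leq_ltn_trans mk.
  set w' := ext A i0 (pre (m k) w).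
  have Sw' : SigmaA A w' by apply: SigmaA_ext; rewrite ?size_pre// adm_pre.
  have ww' i : (i < m k)%N -> w' i = w i.
    by move=> im; rewrite /w' ext_lt ?size_pre// nth_pre.
  rewrite spsi// /psi mulrA mulfV// mul1r -/w'.
  have -> : Lw A g (s k) w' - \sum_j c k j * v j w' + \sum_j c k j * v j w - Lw A g (s k) w =
    (Lw A g (s k) w' - Lw A g (s k) w) - \sum_j c k j * (v j w' - v j w).
    under [in RHS]eq_bigr do rewrite mulrBr.
    by rewrite sumrB; ring.
  have km : kap (m k) <= rr ^+ k.
    by apply: ler_wiXn2l; rewrite ?ltW// (leq_trans (ltnW mk))// leq_pmulr.
  apply: le_trans (_ : Err * kap (m k) <= _); last by rewrite ler_wpM2l.
  apply: le_trans (cmodBD _ _) _; rewrite mulrDl; apply: lerD.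
    have dg : var_le A g (m k).+1 (Bg * kap (m k)).
      apply: var_le_trans (leqnn _) _ (HBg (m k).+1); rewrite ler_wpM2l// addn0.
      by apply: kap_le => //; exact: leqnSn.
    have := @var_Lw R N A g G G0 gG (s k) (m k) 0 (Bg * kap (m k)) (D * Sg) w' w
      mk0 Sw' Sw ww' _ _ (lexx 0) _ _ dg.
    move=> /(_ _ _ _ _) H; apply: le_trans (H _ _ _ _) _.
    - move=> i _ _; rewrite (_ : s k (consw i w') = s k (consw i w)) ?subrr ?cmod0//.
      by apply: (Sop_pre i0); apply: (@eq_pre _ i0) => -[|j] //= jm; rewrite ww'// ltnW.
    - by move=> i _; exact: sb.
    - by rewrite mulr_ge0// kap_ge0.
    - exact: mulr_ge0.
    by rewrite mulr0 add0r le_eqVlt; apply/orP; left; apply/eqP; ring.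
  apply: le_trans (cmod_sum _ _ _) _; rewrite mulr_suml; apply: ler_sum => j _.
  rewrite cmodM -mulrA; apply: ler_pM; rewrite ?cmod_ge0//.
  exact: HBv.
have [UF [UU Uoo]] := exists_free_ultrafilter.
have [z Hz] := ucvg_exists UU eK.
have /choice[cc Hcc] : forall j, exists l, ucvg UF (fun k => c k j) l.
  by move=> j; apply: (@ucvg_exists _ _ UU _ K).
have /choice[sl Hsl] : forall w, exists l, ucvg UF (fun k => s k w) l.
  by move=> w; apply: (@ucvg_exists _ _ UU _ (D * Sg)).
have HJs u : ucvg UF (fun k => Jw (s k) u) (Jw sl u).
  rewrite /Jop; case: ifP => _; last exact: ucvg_cst.
  by case: ifP => _; apply: ucvgB => //; exact: ucvg_cst.
exists z, cc, sl; split.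
- by apply: ucvg_ge Hz _; apply: filterS (Uoo 0%N) => k _ /=; case: (Hd k).
- apply: (@var_kap_inV _ _ rr0 rr1 _ _ _ (2 * (D * Sg))).
    by rewrite mulr_ge0// mulr_ge0.
  move=> a w w' _ _ E.
  apply: ucvg_le (ucvgB UU Uoo (Hsl w) (Hsl w')) _.
  by apply: filterS (Uoo 0%N) => k _ /=; exact: svar.
- move=> w Sw.
  have H1 : ucvg UF (fun k => e k * s k w + \sum_j c k j * v j w - Lw A g (s k) w) 0.
    apply: (@ucvg0 _ _ UU Uoo _ (fun k => Err * rr ^+ k)) => [k|d d0]; first exact: near.
    exact: expr_small_mul (ltW rr0) rr1 Err0 d0.
  have H2 : ucvg UF (fun k => e k * s k w + \sum_j c k j * v j w - Lw A g (s k) w)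
     (z * sl w + \sum_j cc j * v j w - Lw A g sl w).
    apply: ucvgB => //; last first.
      by apply: ucvg_sum => // i _; apply: ucvgM => //; exact: ucvg_cst.
    apply: ucvgD => //; first exact: ucvgM.
    by apply: ucvg_sum => // j _; apply: ucvgM => //; exact: ucvg_cst.
  by have /eqP := ucvg_unique UU H1 H2; rewrite eq_sym subr_eq0 => /eqP <-.
- move=> j; apply: ucvg_unique (HJs (U j)) _ => //.
  apply: (@ucvg_eq _ _ UU Uoo (fun=> 0)); last exact: ucvg_cst.
  exists (size (U j)) => k kj; have [mk _ _ [x0 _] _] := Hd k.
  rewrite JsX; first exact: esym (x0 j).
  exact: leq_trans kj (ltnW mk).
(* If the limit vanished, the increments of some [s k] with [k >= a0] would be at most [kap a0 / 2]
   at all words of length at most [a0], contradicting the value [kap (size t) >= kap a0] at the word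
   given by [tk]. *)
apply: contrapT => Hno.
have sl0 w : SigmaA A w -> sl w = 0.
  by move=> Sw; apply/eqP; apply: contraPT isT => sw; case: Hno; exists w.
have Jsl0 u : Jw sl u = 0.
  rewrite (@Jop_eq _ _ _ _ sl (fun=> 0)).
    exact: is_lin0 (@Jop_lin N A i0 C) u.
  by move=> w aw /andP[w0 _]; apply: sl0; exact: SigmaA_ext.
pose F0 (t : a0.-bseq 'I_N) := [set k | cmod (Jw (s k) t - 0) <= kap a0 / 2].
have FA : forall t, UF (F0 t).
  by move=> t; rewrite /F0 -(Jsl0 t); apply: HJs; rewrite divr_gt0 ?kap_gt0.
have [k [ka Fk]] := filter_ex (filterI (Uoo a0) (@filter_forall _ _ F0 UF _ FA)).
have [t [xt ta]] := tk k.
have := Fk (Bseq (ltnW ta)); rewrite /F0 /= subr0 JsX; last first.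
  by have [mk _ _ _ _] := Hd k; exact: size_bseq.
rewrite /X zext_val xt => H.
have H1 : kap a0 <= kap (size t) by apply: kap_le => //; exact: ltnW.
have := le_trans H1 H; rewrite ler_pdivlMr// ger_pMr ?kap_gt0//.
by rewrite lern1.
Qed.

End Compactness.

(** * Triangular families of generalized eigenvectors *)

Section TriangularMatrices.
Variable F : fieldType.

(** Adding 1 at each zero diagonal entry makes the triangular matrix invertible and changes the rank
    by at most the number of these entries. *)
Lemma trig_rank n (M : 'M[F]_n) : is_trig_mx M ->
  (n <= \rank M + #|[set i | M i i == 0%R]%SET|)%N.
Proof.
move=> Mt; set Z := [set i | M i i == 0%R]%SET.
pose D : 'M[F]_n := \sum_(i in Z) delta_mx i i.
have DE i j : D i j = ((i == j) && (i \in Z))%:R.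
  rewrite summxE; have [iZ|iZ] := boolP (i \in Z).
    rewrite (bigD1 i)//= big1 ?addr0; first by rewrite mxE eqxx /= eq_sym andbT.
    by move=> k /andP[_ ki]; rewrite mxE eq_sym (negbTE ki).
  rewrite big1 ?andbF// => k kZ; rewrite mxE.
  by case: eqP => // ik; rewrite ik kZ in iZ.
have MDt : is_trig_mx (M + D).
  apply/is_trig_mxP => i j ij; rewrite mxE DE (is_trig_mxP Mt)// add0r.
  by rewrite -val_eqE /= ltn_eqF.
have MDu : M + D \in unitmx.
  rewrite unitmxE det_trig// unitfE; apply/prodf_neq0 => i _.
  rewrite mxE DE eqxx /= inE; have [->|Mi] := eqVneq (M i i) 0.
    by rewrite add0r oner_eq0.
  by rewrite addr0.
have rD : (\rank D <= #|Z|)%N.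
  rewrite /D -sum1_card; elim/big_rec2: _ => [|i r X _ H].
    by rewrite mxrank0.
  apply: leq_trans (mxrank_add _ _) _.
  by rewrite leq_add// mxrank_delta.
have := mxrank_add M D; rewrite (mxrank_unit MDu) => H.
by apply: leq_trans H _; rewrite leq_add2l.
Qed.

End TriangularMatrices.

Section TriangularSpectrum.
Variable C : numClosedFieldType.

Lemma trig_pow_rank n (M : 'M[C]_n) k : is_trig_mx M ->
  (n <= \rank (M ^+ k) + #|[set i | M i i == 0%R]%SET|)%N.
Proof.
move=> Mt; have [Tk Ek] := is_trig_mxX k Mt.
apply: leq_trans (trig_rank Tk) _; rewrite leq_add2l.
apply: subset_leq_card; apply/fintype.subsetP => i; rewrite !inE Ek.
by rewrite expf_eq0 => /andP[].
Qed.

Lemma trig_prod (n : nat) (I : Type) (s : seq I) (M : I -> 'M[C]_n) :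
  (forall i, is_trig_mx (M i)) ->
  is_trig_mx (\prod_(i <- s) M i) /\
  forall j, (\prod_(i <- s) M i) j j = \prod_(i <- s) M i j j.
Proof.
move=> H; elim: s => [|i s [IH1 IH2]].
  rewrite big_nil; split; first exact: scalar_mx_is_trig.
  by move=> j; rewrite big_nil mxE eqxx.
rewrite big_cons -mulmxE; have [T E] := is_trig_mxM (H i) IH1.
by split=> // j; rewrite E IH2 big_cons.
Qed.

(* The rows of [\prod_(T i i != mu) (T - T i i)] are killed by a power of
   [T - mu], by Cayley-Hamilton. *)
Lemma trig_gen_eigen n (T : 'M[C]_n) mu : is_trig_mx T ->
  exists H : 'M[C]_n, exists c : nat,
   (#|[set i | T i i == mu]%SET| <= \rank H)%N /\ H *m (T - mu%:M) ^+ c = 0.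
Proof.
case: n T => [|n] T Tt.
  exists 0; exists 0%N; split; last by rewrite mul0mx.
  by apply: leq_trans (max_card _) _; rewrite card_ord.
pose s := [seq i <- enum 'I_n.+1 | T i i != mu].
pose s' := [seq i <- enum 'I_n.+1 | T i i == mu].
pose B i : 'M[C]_n.+1 := T - (T i i)%:M.
have Bt i : is_trig_mx (B i).
  apply/is_trig_mxP => a b ab; rewrite !mxE (is_trig_mxP Tt)// add0r.
  by rewrite -val_eqE /= ltn_eqF// mulr0n oppr0.
exists (\prod_(i <- s) B i), (size s'); have [Ht HE] := trig_prod s Bt.
split.
  have := trig_rank Ht; rewrite addnC -leq_subLR => H; apply: leq_trans H.
  rewrite leq_subRL; last by apply: leq_trans (max_card _) _; rewrite card_ord.
  rewrite addnC -[X in (_ <= X)%N]card_ord -(cardsC [set i | T i i == mu]%SET) leq_add2l.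
  apply: subset_leq_card; apply/fintype.subsetP => j; rewrite !inE HE.
  apply: contraL => /eqP Tj; rewrite prodf_seq_neq0; apply/allP => i.
  rewrite mem_filter => /andP[Ti _]; apply/implyP => _.
  by rewrite !mxE eqxx mulr1n subr_eq0 Tj eq_sym.
have -> : (T - mu%:M) ^+ size s' = \prod_(i <- s') B i.
  have : all (fun i => T i i == mu) s' by exact: filter_all.
  elim: s' => [|i r IH] /=; first by rewrite big_nil expr0.
  by move=> /andP[/eqP Ti /IH E]; rewrite big_cons exprS E /B Ti.
have horn (r : seq 'I_n.+1) :
    \prod_(i <- r) B i = horner_mx T (\prod_(i <- r) ('X - (T i i)%:P)).
  rewrite rmorph_prod; apply: eq_bigr => i _.
  by rewrite rmorphB /= horner_mx_X horner_mx_C.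
rewrite mulmxE !horn -rmorphM /=.
have -> : \prod_(i <- s) ('X - (T i i)%:P) * \prod_(i <- s') ('X - (T i i)%:P) = char_poly T.
  rewrite char_poly_trig// !big_filter mulrC !big_enum_cond /=.
  by rewrite [RHS](bigID (fun i => T i i == mu)).
exact: Cayley_Hamilton.
Qed.

End TriangularSpectrum.

Section Flags.
Variables (R : realType) (rr : R).
Hypotheses (rr0 : 0 < rr) (rr1 : rr < 1).
Variables (N : nat) (A : 'M[int]_N) (i0 : 'I_N).
Local Notation C := R[i].
Local Notation Jw := (Jop A i0).
Variables (f : seqN N -> C) (G : R).
Let g : seqN N -> C := fun w => expC (f w).
Hypotheses (G0 : 0 <= G) (gG : bounded_by A g G) (gk : kreg rr A g).
Implicit Types (phi psi : seqN N -> C) (v : nat -> seqN N -> C).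

Definition eqS phi psi := forall w, SigmaA A w -> phi w = psi w.

Definition comb n (a : 'rV[C]_n) v : seqN N -> C := fun w => \sum_(j < n) a 0 j * v j w.

Definition Lmu mu phi : seqN N -> C := fun w => Lw A g phi w - mu * phi w.

Lemma Lmu_eq mu phi psi : eqS phi psi -> eqS (Lmu mu phi) (Lmu mu psi).
Proof. by move=> E w Sw; rewrite /Lmu E// (Lw_eq g Sw E). Qed.

Lemma iter_Lmu_eq mu k phi psi : eqS phi psi -> eqS (iter k (Lmu mu) phi) (iter k (Lmu mu) psi).
Proof. by move=> E; elim: k => [//|k IH]; exact: Lmu_eq. Qed.

Lemma inV_lin c phi psi : inV A phi -> inV A psi -> inV A (fun w => c * phi w + psi w).
Proof.
move=> pV qV; apply: (@inV_dominated R N A _ (cmod c + 1)); first by rewrite addr_ge0 ?cmod_ge0.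
move=> e e0; have [M1 H1] := pV e e0; have [M2 H2] := qV e e0.
exists (maxn M1 M2) => m; rewrite geq_max => /andP[mM1 mM2] w w' Sw Sw' E.
have -> : c * phi w + psi w - (c * phi w' + psi w') =
   c * (phi w - phi w') + (psi w - psi w') by ring.
rewrite mulrDl mul1r; apply: le_trans (cmodD _ _) _; apply: lerD; last exact: H2.
by rewrite cmodM ler_wpM2l ?cmod_ge0//; exact: H1.
Qed.

Lemma inV_eq phi psi : eqS phi psi -> inV A phi -> inV A psi.
Proof.
move=> E H e e0; have [M HM] := H e e0; exists M => m mM w w' Sw Sw' ww'.
by rewrite -!E//; exact: HM.
Qed.

Lemma inV_Lw phi : inV A phi -> inV A (Lw A g phi).
Proof.
move=> pV; have [F F0 pF] := inV_bounded i0 pV; have gV := kreg_inV rr0 rr1 gk.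
apply: (@inV_dominated R N A _ (N%:R * (G + F))); first by rewrite mulr_ge0// addr_ge0.
move=> e e0; pose d := Num.min e 1.
have d0 : 0 < d by rewrite lt_min e0 ltr01.
have d1 : d <= 1 by rewrite ge_min lexx orbT.
have [M1 H1] := pV d d0; have [M2 H2] := gV d d0.
exists (maxn 1 (maxn M1 M2)) => m; rewrite !geq_max => /andP[m0 /andP[mM1 mM2]].
move=> w w' Sw Sw' E.
have dm : 0 <= d ^+ m.+1 by rewrite exprn_ge0// ltW.
have := @var_Lw R N A g G G0 gG phi m (d ^+ m.+1) (d ^+ m.+1) F w w' m0 Sw Sw' E _ _ dm dm F0
  (H2 _ (leqW mM2)).
move=> /(_ _ _) H; apply: le_trans (H _ _) _.
- by move=> i Si Si'; apply: H1 => //; [exact: leqW|move=> -[|k] //= km; rewrite E].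
- by move=> i Si; exact: pF.
have -> : N%:R * (G * d ^+ m.+1 + d ^+ m.+1 * F) = N%:R * (G + F) * d ^+ m.+1 by ring.
rewrite ler_wpM2l ?mulr_ge0 ?addr_ge0//.
apply: le_trans (_ : d ^+ m <= _).
  by rewrite exprSr ler_piMr ?exprn_ge0 ?(ltW d0).
by apply: lerXn2r; rewrite ?nnegrE ?(ltW d0) ?(ltW e0)// ge_min lexx.
Qed.

Lemma inV_iter_Lmu mu k phi : inV A phi -> inV A (iter k (Lmu mu) phi).
Proof.
move=> pV; elim: k => [//|k IH] /=.
apply: inV_eq (inV_lin (- mu) IH (inV_Lw IH)) => w _.
by rewrite /Lmu mulNr addrC.
Qed.

(** A basis of an invariant space in which the transfer operator is lower triangular. Equal
    eigenvalues need not be adjacent, so the basis can follow the order of the enumeration without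
    separating generalized eigenspaces. *)
Definition flag n (lam : nat -> C) v (t : nat -> nat -> C) :=
  [/\ forall i, (i < n)%N -> kreg rr A (v i),
      forall i w, (i < n)%N -> SigmaA A w ->
        Lw A g (v i) w = lam i * v i w + \sum_(j < i) t i j * v j w &
      forall a : 'rV[C]_n, eqS (comb a v) (fun=> 0) -> a = 0].

Definition flagmx n (lam : nat -> C) (t : nat -> nat -> C) : 'M[C]_n :=
  \matrix_(i, j) (if (j < i)%N then t i j else if i == j then lam i else 0).

Lemma flagmx_trig n lam t : is_trig_mx (flagmx n lam t).
Proof.
apply/is_trig_mxP => i j ij; rewrite mxE ltnNge (ltnW ij) /=.
by rewrite -val_eqE /= ltn_eqF.
Qed.

Lemma flagmx_diag n lam t i : flagmx n lam t i i = lam i.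
Proof. by rewrite mxE ltnn eqxx. Qed.

Section FlagLemmas.
Variables (n : nat) (lam : nat -> C) (v : nat -> seqN N -> C) (t : nat -> nat -> C).
Hypothesis Fl : flag n lam v t.
Let T := flagmx n lam t.

Lemma flag_L (i : 'I_n) w : SigmaA A w -> Lw A g (v i) w = \sum_(j < n) T i j * v j w.
Proof.
move=> Sw; have [_ H _] := Fl; rewrite H//.
rewrite (bigID (fun j : 'I_n => (j < i)%N)) /= [RHS]addrC; congr (_ + _); last first.
  rewrite (big_ord_widen n (fun j => t i j * v j w)) ?(ltnW (ltn_ord i))//.
  by apply: eq_bigr => j ji; rewrite mxE ji.
rewrite (bigD1 i) ?ltnn//= /T flagmx_diag big1 ?addr0// => j /andP[ji jn].
by rewrite mxE (negbTE ji) eq_sym (negbTE jn) mul0r.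
Qed.

Lemma comb_Lmu mu (a : 'rV_n) : eqS (Lmu mu (comb a v)) (comb (a *m (T - mu%:M)) v).
Proof.
move=> w Sw; rewrite /Lmu /comb (is_lin_sum _ _ _ _ (Lw_lin A g)).
under eq_bigr do rewrite flag_L// mulr_sumr.
rewrite exchange_big /= mulr_sumr -sumrB; apply: eq_bigr => j _.
have -> : (a *m (T - mu%:M)) 0 j = \sum_k a 0 k * T k j - mu * a 0 j.
  by rewrite mulmxBr mul_mx_scalar !mxE.
rewrite mulrBl mulr_suml mulrA; congr (_ - _).
by apply: eq_bigr => k _; rewrite mulrA.
Qed.

Lemma comb_iter_Lmu mu k (a : 'rV_n) :
  eqS (iter k (Lmu mu) (comb a v)) (comb (a *m (T - mu%:M) ^+ k) v).
Proof.
elim: k => [|k IH]; first by rewrite expr0 mulmx1.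
have -> : (T - mu%:M) ^+ k.+1 = (T - mu%:M) ^+ k *m (T - mu%:M) by exact: exprSr.
move=> w Sw; rewrite /= (Lmu_eq _ IH)// mulmxA.
exact: comb_Lmu.
Qed.

Lemma comb_kreg (a : 'rV_n) : kreg rr A (comb a v).
Proof. by apply: kreg_sum => i; have [H _ _] := Fl; exact: H. Qed.

(** [trig_gen_eigen] provides as many independent coefficient rows killed by a power of [T - mu] as
    there are diagonal entries [mu]. Their combinations are generalized eigenvectors in V, so more
    than [m] of them would contradict the multiplicity. *)
Lemma flag_mult_le mu m : alg_mult_is A f mu m ->
  (#|[set i : 'I_n | lam i == mu]%SET| <= m)%N.
Proof.
move=> [_ Hm]; rewrite leqNgt; apply/negP => lm.
have [H [c [rH HT]]] := trig_gen_eigen mu (flagmx_trig n lam t).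
have mH : (m.+1 <= \rank H)%N.
  apply: leq_trans lm _; apply: leq_trans rH.
  by apply: subset_leq_card; apply/fintype.subsetP => i; rewrite !inE flagmx_diag.
pose E : 'M[C]_(m.+1, n) := pid_mx m.+1 *m row_base H.
have Efree : row_free E.
  by rewrite /row_free mxrankMfree ?row_base_free// rank_pid_mx.
have ET : E *m (T - mu%:M) ^+ c = 0.
  rewrite /E; have /submxP[D ->] : (row_base H <= H)%MS by rewrite eq_row_base.
  by rewrite -!mulmxA HT !mulmx0.
apply: (Hm (fun j => comb (row j E) v)).
  move=> j; split; first exact: kreg_inV (comb_kreg _).
  exists c => w Sw.
  have -> : Lshift_pow A f mu c (comb (row j E) v) w = iter c (Lmu mu) (comb (row j E) v) w.
    by [].
  rewrite comb_iter_Lmu// -row_mul ET row0 /comb big1// => k _.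
  by rewrite mxE mul0r.
move=> a Ha j; have [_ _ ind] := Fl.
have /ind : eqS (comb ((\row_k a k) *m E) v) (fun=> 0).
  move=> w Sw; rewrite -[RHS](Ha w Sw) /comb.
  under eq_bigr do rewrite mxE mulr_suml.
  rewrite exchange_big; apply: eq_bigr => k _; rewrite mulr_sumr.
  by apply: eq_bigr => l _; rewrite !mxE mulrA.
move=> /eqP; rewrite mulmx_free_eq0// => /eqP/rowP/(_ j).
by rewrite !mxE.
Qed.

Definition upd (T : Type) (h : nat -> T) k y : nat -> T :=
  fun j => if j == k then y else h j.

Lemma upd_lt (S : Type) (h : nat -> S) k y j : (j < k)%N -> upd h k y j = h j.
Proof. by move=> jk; rewrite /upd ltn_eqF. Qed.

Lemma upd_eq (S : Type) (h : nat -> S) k y : upd h k y k = y.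
Proof. by rewrite /upd eqxx. Qed.

Lemma flag_cons x z (c : 'rV[C]_n) : kreg rr A x ->
  (forall w, SigmaA A w -> Lw A g x w = z * x w + comb c v w) ->
  (forall a : 'rV_n, ~ eqS x (comb a v)) ->
  exists tn, flag n.+1 (upd lam n z) (upd v n x) (upd t n tn).
Proof.
move=> xk xL xn; have [vk vL vi] := Fl.
exists (fun j => if insub j is Some o then c 0 o else 0); split.
- move=> i; rewrite ltnS leq_eqVlt => /orP[/eqP ->|ni]; first by rewrite upd_eq.
  by rewrite upd_lt//; exact: vk.
- move=> i w; rewrite ltnS leq_eqVlt => /orP[/eqP ->|ni] Sw; last first.
    rewrite !upd_lt// vL//; congr (_ + _); apply: eq_bigr => j _.
    by rewrite upd_lt// (leq_trans (ltn_ord j))// ltnW.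
  rewrite !upd_eq xL//; congr (_ + _); apply: eq_bigr => j _.
  by rewrite upd_lt// valK.
move=> a Ha.
pose b : 'rV[C]_n := \row_j a 0 (widen_ord (leqnSn n) j).
have Hb w : SigmaA A w -> comb b v w + a 0 ord_max * x w = 0.
  move=> /Ha H; rewrite -[RHS]H /comb big_ord_recr /= upd_eq; congr (_ + _).
  by apply: eq_bigr => j _; rewrite mxE upd_lt.
have an : a 0 ord_max = 0.
  apply/eqP; apply: contrapT => /negP an; apply: (xn (- (a 0 ord_max)^-1 *: b)).
  move=> w Sw; have := Hb w Sw => /eqP; rewrite addrC addr_eq0 => /eqP E.
  apply: (mulfI an); rewrite E /comb !mulr_sumr -sumrN; apply: eq_bigr => j _.
  have -> : (- (a 0 ord_max)^-1 *: b) 0 j = - (a 0 ord_max)^-1 * b 0 j by rewrite mxE.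
  by field.
have b0 : b = 0.
  by apply: (vi) => w Sw; have := Hb w Sw; rewrite an mul0r addr0.
apply/rowP => j; rewrite mxE; have [jn|nj] := ltnP j n.
  have := congr1 (fun r : 'rV_n => r 0 (Ordinal jn)) b0.
  by rewrite !mxE => <-; congr (a 0 _); apply/val_inj.
rewrite -an; congr (a 0 _); apply/val_inj/eqP; rewrite /= eqn_leq nj andbT.
by rewrite -ltnS.
Qed.

(** The span of the flag has room for fewer than [m] independent generalized eigenvectors, so one of
    the given [m] lies outside. Applying [L - mu] to it repeatedly enters the span; the last iterate
    still outside is the new vector. *)
Lemma flag_extend mu m : mu != 0 -> alg_mult_is A f mu m ->
  (#|[set i : 'I_n | lam i == mu]%SET| < m)%N ->
  exists x tn, flag n.+1 (upd lam n mu) (upd v n x) (upd t n tn).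
Proof.
move=> mu0 [[h [hg hi]] _] cm.
have [_ _ vi] := Fl.
pose insp phi := exists a : 'rV[C]_n, eqS phi (comb a v).
have [j hj] : exists j, ~ insp (h j).
  apply: contrapT => /forallNP H.
  have {}H j : insp (h j) by apply: contrapT; exact: H.
  have /choice[a Ha] := H.
  pose X : 'M[C]_(m, n) := \matrix_(j, k) a j 0 k.
  have Xr j : row j X = a j by apply/rowP => k; rewrite !mxE.
  have Xfree : row_free X.
    apply/row_freeP; apply: contrapT => nX.
    have : \rank X = m.
      apply/eqP; rewrite -/(row_free X) -kermx_eq0; apply/eqP/row_matrixP => i.
      rewrite row0; set y := row i _.
      have yX : y *m X = 0 by apply/sub_kermxP; exact: row_sub.
      apply/rowP => k; rewrite [RHS]mxE; apply: hi k => w Sw.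
      under eq_bigr do rewrite Ha//.
      rewrite /comb; under eq_bigr do rewrite mulr_sumr.
      rewrite exchange_big big1// => l _ /=.
      under eq_bigr do rewrite mulrA.
      rewrite -mulr_suml.
      have -> : \sum_i y 0 i * a i 0 l = (y *m X) 0 l.
        by rewrite mxE; apply: eq_bigr => q _; rewrite [X q l]mxE.
      by rewrite yX mxE mul0r.
    by move=> rX; apply: nX; apply/row_freeP; rewrite /row_free rX.
  have /choice[K HK] : forall j, exists k, forall w, SigmaA A w -> iter k (Lmu mu) (h j) w = 0.
    by move=> j; have [_ [k Hk]] := hg j; exists k.
  pose KK := \max_j K j.
  have XT : X *m (T - mu%:M) ^+ KK = 0.
    apply/row_matrixP => j; rewrite row0 row_mul Xr; apply: (vi) => w Sw.
    have KE : (T - mu%:M) ^+ KK = (T - mu%:M) ^+ K j *m (T - mu%:M) ^+ (KK - K j).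
      rewrite mulmxE -exprD subnKC//; exact: leq_bigmax.
    rewrite KE mulmxA (_ : a j *m (T - mu%:M) ^+ K j = 0); last first.
      apply: (vi) => w' Sw'; rewrite -comb_iter_Lmu//.
      have Hs : eqS (comb (a j) v) (h j) by move=> w1 Sw1; rewrite Ha.
      by rewrite (iter_Lmu_eq _ _ Hs)// HK.
    by rewrite mul0mx /comb big1// => k _; rewrite mxE mul0r.
  have Tt : is_trig_mx (T - mu%:M).
    apply/is_trig_mxP => i k ik; rewrite !mxE.
    have /is_trig_mxP/(_ i k ik) := flagmx_trig n lam t; rewrite mxE => ->.
    by rewrite add0r -val_eqE /= ltn_eqF// mulr0n oppr0.
  (* If all [m] vectors lay in the span, their [m] independent coefficient rows would lie in the
     kernel of a power of [T - mu], whose dimension is at most the number of diagonal entries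
     [mu]. *)
  have := trig_pow_rank KK Tt.
  have -> : #|[set i | (T - mu%:M) i i == 0%R]%SET| = #|[set i : 'I_n | lam i == mu]%SET|.
    by apply: eq_card => i; rewrite !inE !mxE ltnn eqxx mulr1n subr_eq0.
  have : (\rank X <= \rank (kermx ((T - mu%:M) ^+ KK)))%N.
    by apply: mxrankS; apply/sub_kermxP.
  rewrite mxrank_ker; move/eqP: Xfree => ->.
  have := rank_leq_row ((T - mu%:M) ^+ KK).
  move: (\rank _) (#|_|) cm => r c; clear; lia.
have [hV [K HK]] := hg j.
(* The least exponent that enters the span is positive because [h j] is outside. The iterate just
   before it satisfies [L x = mu x + comb c v]. *)
have ex : exists k, `[< insp (iter k (Lmu mu) (h j)) >].
  exists K; apply/asboolP; exists 0 => w Sw.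
  rewrite (_ : iter K (Lmu mu) (h j) w = 0); last exact: HK.
  by rewrite /comb big1// => k _; rewrite mxE mul0r.
have [k0 /asboolP[c Hc] k0min] := ex_minnP ex.
case: k0 Hc k0min => [|k] Hc k0min; first by case: hj; exists c.
pose x := iter k (Lmu mu) (h j).
have xn (a : 'rV_n) : ~ eqS x (comb a v).
  move=> xa; have := k0min k; rewrite ltnn => /(_ _)/negP; apply; last by [].
  by apply/asboolP; exists a.
have xV : inV A x by exact: inV_iter_Lmu.
have xL w : SigmaA A w -> Lw A g x w = mu * x w + comb c v w.
  by move=> Sw; rewrite -Hc// /x iterS /Lmu addrC subrK.
have xk : kreg rr A x.
  exact: (kreg_eigen rr0 rr1 i0 G0 gG gk mu0 xV (comb_kreg c) xL).
by have [tn Htn] := flag_cons xk xL xn; exists x, tn.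
Qed.

End FlagLemmas.

End Flags.

Section DualWords.
Variables (F : fieldType) (W : Type).

(** Greedy choice: while fewer than [n] points are chosen, some nonzero row [a] annihilates all
    their columns. By independence the combination [a] is nonzero at a further point [u], whose
    column is therefore new. *)
Lemma dual_points n (P : 'I_n -> W -> F) :
  (forall a : 'rV[F]_n, (forall u, \sum_i a 0 i * P i u = 0) -> a = 0) ->
  exists U : 'I_n -> W, (\matrix_(i, j) P i (U j) : 'M[F]_n) \in unitmx.
Proof.
move=> ind; suff H k : (k <= n)%N ->
    exists U : 'I_k -> W, \rank (\matrix_(i < n, j < k) P i (U j)) = k.
  by have [U rU] := H n (leqnn n); exists U; rewrite -row_full_unit /row_full rU.
elim: k => [|k IH] kn.
  exists (fun i : 'I_0 => match notF (ltn_ord i) with end).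
  by apply/eqP; rewrite -leqn0 rank_leq_col.
have [U rU] := IH (ltnW kn); set E := \matrix_(i, j) _ in rU.
have [a a0 aE] : exists2 a : 'rV[F]_n, a != 0 & a *m E = 0.
  have : kermx E != 0.
    by rewrite kermx_eq0 /row_free rU neq_ltn kn.
  by move=> /rowV0Pn[a /sub_kermxP aE a0]; exists a.
have [u ua] : exists u, \sum_i a 0 i * P i u != 0.
  apply: contrapT => /forallNP H; case/eqP: a0; apply: ind => u.
  by apply/eqP; apply: contrapT => /negP; exact: H.
exists (fun j : 'I_k.+1 => if insub (j : nat) is Some o then U o else u).
set E' := \matrix_(i, j) _.
have EE i (j : 'I_k) : E' i (widen_ord (leqnSn k) j) = E i j.
  by rewrite !mxE /= valK.
have Eu i : E' i ord_max = P i u.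
  by rewrite !mxE /= insubF ?ltnn.
apply/eqP; rewrite -mxrank_tr -/(row_free _) -kermx_eq0; apply/eqP/row_matrixP => r.
rewrite row0; set y := row r _.
have yE : E' *m y^T = 0.
  have : y *m E'^T = 0 by apply/sub_kermxP; exact: row_sub.
  by move=> /(congr1 trmx); rewrite trmx_mul trmxK trmx0.
clearbody y; clearbody E'.
have yEi i : \sum_(j < k) E i j * y 0 (widen_ord (leqnSn k) j) + P i u * y 0 ord_max = 0.
  have := congr1 (fun M : 'M[F]_(n, 1) => M i 0) yE; rewrite !mxE big_ord_recr /= !mxE Eu => H.
  by rewrite -[RHS]H; congr (_ + _); apply: eq_bigr => j _; rewrite EE !mxE.
have ylast : y 0 ord_max = 0.
  have : (\sum_i a 0 i * P i u) * y 0 ord_max = 0.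
    transitivity (\sum_i a 0 i * (\sum_(j < k) E i j * y 0 (widen_ord (leqnSn k) j) +
       P i u * y 0 ord_max)); last first.
      by apply: big1 => q _; rewrite yEi mulr0.
    under [RHS]eq_bigr do rewrite mulrDr mulr_sumr mulrA.
    rewrite big_split /= -mulr_suml exchange_big [X in _ = X + _]big1 ?add0r// => j _.
    under eq_bigr do rewrite mulrA.
    rewrite -mulr_suml; have := congr1 (fun r : 'rV[F]_k => r 0 j) aE.
    by rewrite [LHS]mxE [RHS]mxE => ->; rewrite mul0r.
  by move/eqP; rewrite mulf_eq0 (negbTE ua) => /eqP.
pose y' : 'rV[F]_k := \row_j y 0 (widen_ord (leqnSn k) j).
have y'0 : y' = 0.
  have Ef : row_free E^T by rewrite /row_free mxrank_tr rU.
  apply/eqP; rewrite -(mulmx_free_eq0 _ Ef); apply/eqP/rowP => i.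
  rewrite !mxE; have := yEi i; rewrite ylast mulr0 addr0 => H.
  by rewrite -[RHS]H; apply: eq_bigr => j _; rewrite [y' 0 j]mxE [E^T j i]mxE mulrC.
apply/rowP => j; rewrite [RHS]mxE; have [jk|kj] := ltnP j k.
  have := congr1 (fun r : 'rV[F]_k => r 0 (Ordinal jk)) y'0.
  by rewrite !mxE => <-; congr (y 0 _); apply/val_inj.
rewrite -ylast; congr (y 0 _); apply/val_inj/eqP; rewrite /= eqn_leq kj andbT.
by rewrite -ltnS.
Qed.

End DualWords.

Lemma size_le_card k (P : pred nat) (s : seq nat) : uniq s ->
  (forall i, i \in s -> (i < k)%N /\ P i) -> (size s <= #|[set i : 'I_k | P i]%SET|)%N.
Proof.
move=> su H; rewrite cardE -(size_map val); apply: uniq_leq_size => // i /H[ik Pi].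
by apply/mapP; exists (Ordinal ik) => //; rewrite mem_enum inE.
Qed.

Lemma card_le_size k (P : pred nat) (s : seq nat) :
  (forall i, (i < k)%N -> P i -> i \in s) -> (#|[set i : 'I_k | P i]%SET| <= size s)%N.
Proof.
move=> H; rewrite cardE -(size_map val); apply: uniq_leq_size.
  by rewrite map_inj_uniq ?enum_uniq//; exact: val_inj.
by move=> i /mapP[j]; rewrite mem_enum inE => Pj ->; exact: H (ltn_ord j) Pj.
Qed.

Section EigenFlags.
Variables (R : realType) (rr : R).
Hypotheses (rr0 : 0 < rr) (rr1 : rr < 1).
Variables (N : nat) (A : 'M[int]_N) (i0 : 'I_N).
Local Notation C := R[i].
Local Notation Jw := (Jop A i0).
Variables (f : seqN N -> C) (G : R).
Let g : seqN N -> C := fun w => expC (f w).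
Hypotheses (G0 : 0 <= G) (gG : bounded_by A g G) (gk : kreg rr A g).
Variable lam : nat -> C.
Hypothesis He : eigen_enum A f lam.

Lemma Jop_inj phi : kreg rr A phi -> (forall u, Jw phi u = 0) -> eqS A phi (fun=> 0).
Proof.
move=> pk J0 w Sw; have [B B0 HB] := pk 0%N.
apply/eqP; rewrite -cmod_eq0 eq_le cmod_ge0 andbT; apply/ler_addgt0Pr => e e0.
have [n0 Hn] := expr_small_mul (ltW rr0) rr1 B0 e0.
have := HB n0.+1 w (ext A i0 (pre n0.+1 w)) Sw.
rewrite addn0 -(Sop_Jop i0 phi Sw (ltn0Sn n0)) [X in phi w - X]big1 ?subr0; last first.
  by move=> b _; exact: J0.
move=> /(_ _ _) H; rewrite add0r; apply: le_trans (H _ _) _.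
- by apply: SigmaA_ext; rewrite ?size_pre// adm_pre.
- by move=> k km; rewrite ext_lt ?size_pre// nth_pre.
apply: le_trans (Hn n0.+1 (leqnSn n0)); rewrite ler_wpM2l//.
by apply: ler_wiXn2l; rewrite ?ltW// leq_pmulr.
Qed.

(** Index [n] is itself one of the [m] indices carrying the value [lam n], so fewer than [m] of them
    precede it and [flag_extend] applies. *)
Lemma flag_of_enum n : (forall i, (i < n)%N -> lam i != 0) ->
  exists v t, flag rr A f n lam v t.
Proof.
elim: n => [|n IH] Hn.
  exists (fun _ _ => 0), (fun _ _ => 0); split=> // a _.
  by apply/rowP => -[].
have [v [t Fl]] := IH (fun i ni => Hn i (leqW ni)).
have [_ /(_ (lam n) (Hn n (ltnSn n)))[m [Hm [s [us ss Hs]]]]] := He.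
have cm : (#|[set i : 'I_n | lam i == lam n]%SET| < m)%N.
  rewrite -ss; have ns : n \in s by apply/Hs.
  have -> : size s = (size (rem n s)).+1 by rewrite size_rem// prednK// -has_predT;
    apply/hasP; exists n.
  rewrite ltnS; apply: (@card_le_size n (fun i => lam i == lam n)) => i ni /eqP/Hs is_.
  by rewrite (mem_rem_uniq _ us) inE is_ andbT ltn_eqF.
have [x [tn Fl']] := flag_extend rr0 rr1 i0 G0 gG gk Fl (Hn n (ltnSn n)) Hm cm.
exists (upd v n x), (upd t n tn).
rewrite (_ : upd lam n (lam n) = lam) in Fl' => //.
by apply/funext => j; rewrite /upd; case: eqP => [->|].
Qed.

Section FlagWords.
Variables (n : nat) (v : nat -> seqN N -> C) (t : nat -> nat -> C).
Hypothesis Fl : flag rr A f n lam v t.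

(** All indices carrying [z] are already below [n]. Adjoining [x] would put one more [z] on the
    diagonal than the multiplicity allows. *)
Lemma no_extra_eigenvector x z (c : 'rV[C]_n) : z != 0 -> inV A x ->
  (forall w, SigmaA A w -> Lw A g x w = z * x w + comb c v w) ->
  (forall a : 'rV_n, ~ eqS A x (comb a v)) ->
  (forall i, lam i = z -> (i < n)%N) -> False.
Proof.
move=> z0 xV xL xn Hz.
have xk : kreg rr A x.
  exact: (kreg_eigen rr0 rr1 i0 G0 gG gk z0 xV (comb_kreg Fl c) xL).
have [tn Fl'] := flag_cons Fl xk xL xn.
have [_ /(_ z z0)[m [Hm [s [us ss Hs]]]]] := He.
have := flag_mult_le rr0 rr1 Fl' Hm; rewrite leqNgt => /negP; apply.
rewrite -ss; apply: (@size_le_card n.+1 (fun i => upd lam n z i == z) (n :: s)).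
  rewrite /= us andbT; apply/negP => /Hs/Hz; by rewrite ltnn.
move=> i; rewrite inE => /orP[/eqP ->|/Hs iz]; first by rewrite upd_eq eqxx.
have ni := Hz _ iz; split; first exact: leqW.
by rewrite upd_lt// iz.
Qed.

(** The basis is changed by the inverse of the evaluation matrix at the points of [dual_points]. The
    matrix of the operator is conjugated, hence keeps its eigenvalues; the two span clauses
    translate results back to [v]. *)
Lemma flag_dual : exists (v' : 'I_n -> seqN N -> C) (U : 'I_n -> seq 'I_N) (M : 'M[C]_n),
  [/\ forall i, kreg rr A (v' i),
      forall i w, SigmaA A w -> Lw A g (v' i) w = \sum_k M i k * v' k w,
      forall i j, Jw (v' i) (U j) = (i == j)%:R,
      roots_of M [seq lam i | i <- iota 0 n] &
      (forall c : 'I_n -> C, exists a : 'rV[C]_n,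
        eqS A (fun w => \sum_j c j * v' j w) (comb a v)) /\
      (forall a : 'rV[C]_n, exists c : 'I_n -> C,
        eqS A (comb a v) (fun w => \sum_j c j * v' j w))].
Proof.
have [vk vL vi] := Fl; have JL := @Jop_lin N A i0 C.
have [|U HU] := @dual_points C _ n (fun i u => Jw (v i) u).
  move=> a Ha; apply: vi; apply: Jop_inj; first exact: comb_kreg Fl a.
  move=> u; rewrite -[RHS](Ha u) -(is_lin_sum _ _ _ _ JL).
  by congr (Jop _ _ _ _).
set E := \matrix_(i, j) _ in HU.
pose Q := invmx E; pose T := flagmx n lam t.
have EQ : E *m Q = 1%:M by exact: mulmxV HU.
pose v' i := comb (row i Q) v.
exists v', U, (Q *m T *m E).
have back (c : 'I_n -> C) w : \sum_j c j * v' j w = comb ((\row_j c j) *m Q) v w.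
  rewrite /v' /comb; under eq_bigr do rewrite mulr_sumr.
  rewrite exchange_big; apply: eq_bigr => k _; rewrite mxE mulr_suml.
  by apply: eq_bigr => j _; rewrite !mxE mulrA.
split.
- by move=> i; exact: comb_kreg Fl _.
- move=> i w Sw; rewrite (back (fun k => (Q *m T *m E) i k)).
  have := comb_Lmu Fl 0 (row i Q) Sw; rewrite /Lmu mul0r subr0 => ->.
  rewrite raddf0 subr0 -/T; congr (comb _ v w).
  have -> : \row_j (Q *m T *m E) i j = row i (Q *m T *m E) by apply/rowP => j; rewrite !mxE.
  by rewrite -!row_mul -!mulmxA EQ mulmx1.
- move=> i j; have := mulVmx HU; rewrite -/Q => QE.
  have := congr1 (fun M : 'M[C]_n => M i j) QE; rewrite [RHS]mxE => <-.
  rewrite [RHS]mxE /v' /comb (is_lin_sum _ _ _ _ JL).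
  by apply: eq_bigr => k _; rewrite [row i Q 0 k]mxE [E k j]mxE.
- rewrite /roots_of char_poly_conj; last by rewrite mulVmx.
  rewrite char_poly_trig; last exact: flagmx_trig.
  rewrite big_map -val_enum_ord big_map big_enum /=.
  by apply: eq_bigr => i _; rewrite flagmx_diag.
split=> [c|a].
  by exists ((\row_j c j) *m Q) => w _; exact: back.
exists (fun j => (a *m E) 0 j) => w _; rewrite back.
have -> : \row_j (a *m E) 0 j = a *m E by apply/rowP => j; rewrite !mxE.
by rewrite -mulmxA EQ mulmx1.
Qed.

End FlagWords.
End EigenFlags.

(** * The complex exponential *)

Section ComplexExponential.
Variable R : realType.
Local Notation C := R[i].
Implicit Types (x y : R) (u v z : C).

Lemma mvt0 (h dh : R -> R) x : (forall y, is_derive y 1 h (dh y)) ->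
  exists2 c, `|c| <= `|x| & h x - h 0 = dh c * x.
Proof.
move=> hd; have hc : continuous h.
  by move=> y; apply/differentiable_continuous/derivable1_diffP; have [] := hd y.
have [x0|x0] := leP 0 x.
  have [|c cx E] := @MVT_segment R h dh 0 x x0 (fun y _ => hd y).
    exact: continuous_subspaceT.
  exists c; last by rewrite E subr0.
  by move: cx; rewrite in_itv /= => /andP[c0 cx]; rewrite !ger0_norm.
have [|c cx E] := @MVT_segment R h dh x 0 (ltW x0) (fun y _ => hd y).
  exact: continuous_subspaceT.
exists c; last by rewrite -opprB E sub0r mulrN opprK.
by move: cx; rewrite in_itv /= => /andP[c0 cx]; rewrite !ler0_norm ?lerN2// ltW.
Qed.

Lemma sin_le_norm x : `|sin x| <= `|x|.
Proof.
have [c cx] := @mvt0 sin cos x (fun y => is_derive_sin y).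
rewrite sin0 subr0 => ->; rewrite normrM ler_piMl//.
exact: cos_max.
Qed.

Lemma cos_quadratic x : `|cos x - 1| <= x ^+ 2.
Proof.
have [c cx] := @mvt0 cos (fun y => - sin y) x (fun y => is_derive_cos y).
rewrite cos0 => ->; rewrite normrM normrN -normr_id -real_normK ?num_real// expr2.
by rewrite ler_wpM2r// normr_id (le_trans (sin_le_norm _)).
Qed.

Lemma sin_quadratic x : `|x| <= 1 -> `|sin x - x| <= x ^+ 2.
Proof.
move=> x1; have [c cx] := @mvt0 (fun y => sin y - y) (fun y => cos y - 1) x _.
rewrite sin0 !subr0 => ->; rewrite normrM -[leRHS]real_normK ?num_real// expr2.
rewrite ler_wpM2r//; apply: le_trans (cos_quadratic c) _.
rewrite -real_normK ?num_real// expr2.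
by apply: le_trans (ler_pM _ _ cx cx) _; rewrite // ler_piMl.
Qed.

Lemma expR_quadratic x : `|x| <= 2^-1 -> `|expR x - 1 - x| <= 2 * x ^+ 2.
Proof.
rewrite ler_norml => /andP[x1 x2].
have e1 := expR_ge1Dx x; have e2 := expR_ge1Dx (- x).
have e3 := expRxMexpNx_1 x; have e0 := expR_gt0 x.
rewrite ger0_norm; last by lra.
have := ler_wpM2l (ltW e0) e2; rewrite e3.
nra.
Qed.

Lemma expCD u v : expC (u + v) = expC u * expC v.
Proof.
case: u v => [a b] [c d]; rewrite /expC /=; simpc.
rewrite expRD sinD cosD.
by congr (_ +i* _)%C; ring.
Qed.

Lemma expC0 : expC (0 : C) = 1.
Proof. by rewrite /expC /= expR0 cos0 sin0 mul1r. Qed.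

Lemma expC_sum (I : Type) (s : seq I) (P : pred I) (F : I -> C) :
  expC (\sum_(i <- s | P i) F i) = \prod_(i <- s | P i) expC (F i).
Proof. exact: (big_morph _ expCD expC0). Qed.

Lemma cmod_expC u : cmod (expC u) = expR (complex.Re u).
Proof.
rewrite /expC cmodM cmodR (ger0_norm (expR_ge0 _)) /cmod /= cos2Dsin2 sqrtr1.
by rewrite mulr1.
Qed.

Lemma expC_quadratic u : cmod u <= 2^-1 -> cmod (expC u - 1 - u) <= 6 * cmod u ^+ 2.
Proof.
move=> u1; have x1 := le_trans (cmod_Re u) u1; have y1 := le_trans (cmod_Im u) u1.
have -> : cmod u ^+ 2 = complex.Re u ^+ 2 + complex.Im u ^+ 2.
  by rewrite /cmod sqr_sqrtr// addr_ge0 ?sqr_ge0.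
apply: le_trans (cmod_ReIm _) _.
move: x1 y1; case: u u1 => a b /= _ x1 y1.
rewrite /expC /=; simpc.
have ea := expR_quadratic x1; have ca := cos_quadratic b.
have sb : `|sin b - b| <= b ^+ 2 by apply: sin_quadratic; lra.
have e2 : expR a <= 2.
  move: ea x1; rewrite !ler_norml => /andP[_ h] /andP[h1 h2]; nra.
have e0 := expR_gt0 a.
have H1 : `|expR a * cos b - 1 - a| <= 2 * a ^+ 2 + 2 * b ^+ 2.
  have -> : expR a * cos b - 1 - a = (expR a - 1 - a) + expR a * (cos b - 1) by ring.
  apply: le_trans (ler_normD _ _) _; apply: lerD => //.
  by rewrite normrM (gtr0_norm e0) ler_pM// ltW.
have H2 : `|expR a * sin b - b| <= 2 * b ^+ 2 + 2 * (`|a| * `|b|).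
  have -> : expR a * sin b - b = expR a * (sin b - b) + (expR a - 1) * b by ring.
  apply: le_trans (ler_normD _ _) _; apply: lerD.
    by rewrite normrM (gtr0_norm e0) ler_pM// ltW.
  rewrite normrM mulrA ler_wpM2r//.
  have -> : expR a - 1 = (expR a - 1 - a) + a by ring.
  apply: le_trans (ler_normD _ _) _.
  have : 2 * a ^+ 2 <= `|a|.
    rewrite -real_normK ?num_real// expr2 mulrA ler_piMl//.
    by rewrite mulrC -ler_pdivlMr// mul1r.
  lra.
have H3 : 2 * (`|a| * `|b|) <= a ^+ 2 + b ^+ 2.
  rewrite -(real_normK (num_real a)) -(real_normK (num_real b)) -subr_ge0.
  have -> : `|a| ^+ 2 + `|b| ^+ 2 - 2 * (`|a| * `|b|) = (`|a| - `|b|) ^+ 2 by ring.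
  exact: sqr_ge0.
have := sqr_ge0 a; have := sqr_ge0 b; lra.
Qed.

Lemma expC_lip (b : R) : exists2 K, 0 <= K & forall u v,
  cmod u <= b -> cmod v <= b -> cmod (expC u - expC v) <= K * cmod (u - v).
Proof.
(* The 4 serves differences of modulus at most 1/2, where [6 |d|^2 + |d| <= 4 |d|]. For larger ones
   [expR (2 * b) + 1] is at most twice itself times [|d|]. *)
pose K0 : R := 4 + 2 * (expR (2 * b) + 1).
have K00 : 0 <= K0 by have := expR_ge0 (2 * b); rewrite /K0; lra.
exists (expR b * K0); first by rewrite mulr_ge0// expR_ge0.
move=> u v ub vb.
have -> : expC u - expC v = expC v * (expC (u - v) - 1).
  by rewrite mulrBr mulr1 -expCD [v + _]addrC subrK.
rewrite cmodM -mulrA; apply: ler_pM; rewrite ?cmod_ge0//.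
  by rewrite cmod_expC ler_expR (le_trans (ler_norm _))// (le_trans (cmod_Re _)).
set d := u - v; have d2 : cmod d <= 2 * b.
  by apply: le_trans (cmodBD _ _) _; lra.
have d0 := cmod_ge0 d.
have [dh|dh] := leP (cmod d) 2^-1.
  have := expC_quadratic dh => H.
  have -> : expC d - 1 = (expC d - 1 - d) + d by ring.
  apply: le_trans (cmodD _ _) _.
  have : cmod d ^+ 2 <= 2^-1 * cmod d by rewrite expr2 ler_wpM2r.
  have := expR_ge0 (2 * b); rewrite /K0; nra.
apply: le_trans (cmodBD _ _) _; rewrite cmod_expC cmod1.
have : expR (complex.Re d) <= expR (2 * b).
  by rewrite ler_expR (le_trans (ler_norm _))// (le_trans (cmod_Re _)).
rewrite /K0; have := expR_ge0 (2 * b); nra.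
Qed.

End ComplexExponential.

(** * Periodic points and the spectrum *)

Section PeriodicSums.
Variables (R : realType) (N : nat) (A : 'M[int]_N) (i0 : 'I_N).
Local Notation C := R[i].

Lemma per_inj q (s s' : q.-tuple 'I_N) : (0 < q)%N -> per i0 s = per i0 s' -> s = s'.
Proof.
move=> q0 E; apply/val_inj/(@eq_from_nth _ i0); rewrite ?size_tuple// => k kq.
by have := congr1 (fun w => w k) E; rewrite /per !size_tuple modn_small.
Qed.

Lemma iter_shiftE k (w : seqN N) t : iter k (@Defs.shift N) w t = w (k + t)%N.
Proof. by elim: k t => [//|k IH] t; rewrite iterS /Defs.shift IH addnS. Qed.

Lemma iter_shift_SigmaA k (w : seqN N) : SigmaA A w -> SigmaA A (iter k (@Defs.shift N) w).
Proof. by move=> Sw t; rewrite !iter_shiftE addnS; exact: Sw. Qed.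

Lemma PerE q : (0 < q)%N ->
  Per A q = [set` map (fun s : q.-tuple 'I_N => per i0 s)
    (seq.filter (fun s : q.-tuple 'I_N => `[< SigmaA A (per i0 s) >]) (enum {: q.-tuple 'I_N}))].
Proof.
move=> q0; apply/seteqP; split=> w /=.
  move=> [Sw wq]; have wE : w = per i0 (pret q w).
    apply/funext => t; rewrite /per size_tuple pretE nth_pre ?ltn_pmod//.
    rewrite {1}(divn_eq t q); elim: (t %/ q)%N => [//|k IH].
    by rewrite mulSn -addnA -iter_shiftE wq.
  apply/mapP; exists (pret q w) => //.
  by rewrite mem_filter mem_enum andbT; apply/asboolP; rewrite -wE.
move=> /mapP[s]; rewrite mem_filter => /andP[/asboolP Ss _] ->; split=> //.
apply/funext => t; rewrite iter_shiftE.
by rewrite /per -[in X in (X + t)%N](size_tuple s) modnDl.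
Qed.

Lemma ZperE (f : seqN N -> C) q : (0 < q)%N ->
  Zper A f q = \sum_(s : q.-tuple 'I_N | `[< SigmaA A (per i0 s) >])
    \prod_(t < q) expC (f (iter t (@Defs.shift N) (per i0 s))).
Proof.
move=> q0; rewrite /Zper PerE// -fsbig_seq; last first.
  rewrite map_inj_uniq => [|s s']; last exact: per_inj.
  exact/filter_uniq/(@enum_uniq (q.-tuple 'I_N)).
rewrite big_map big_filter big_enum_cond /=.
by apply: eq_bigr => s _; rewrite /Ssum expC_sum.
Qed.

Lemma cmod_prod_diff q (a b : 'I_q -> C) (G d : R) : 1 <= G -> 0 <= d ->
  (forall t, cmod (a t) <= G) -> (forall t, cmod (b t) <= G) ->
  (forall t, cmod (a t - b t) <= d) ->
  cmod (\prod_(t < q) a t - \prod_(t < q) b t) <= q%:R * d * G ^+ q.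
Proof.
move=> G1 d0; have G0 : 0 <= G by exact: le_trans G1.
elim: q a b => [|q IH] a b Ha Hb Hab.
  by rewrite !big_ord0 subrr cmod0 !mul0r.
rewrite !big_ord_recl.
set a' := \prod_(i < q) _; set b' := \prod_(i < q) _.
have -> : a ord0 * a' - b ord0 * b' = a ord0 * (a' - b') + (a ord0 - b ord0) * b' by ring.
apply: le_trans (cmodD _ _) _; rewrite !cmodM.
have Hb' : cmod b' <= G ^+ q.
  rewrite cmod_prod -[X in G ^+ X]card_ord -prodr_const; apply: ler_prod => i _.
  by rewrite cmod_ge0 Hb.
have H1 : cmod (a ord0) * cmod (a' - b') <= G * (q%:R * d * G ^+ q).
  by apply: ler_pM; rewrite ?cmod_ge0//; apply: IH => t; [exact: Ha|exact: Hb|exact: Hab].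
have H2 : cmod (a ord0 - b ord0) * cmod b' <= d * G ^+ q.
  by apply: ler_pM; rewrite ?cmod_ge0.
apply: le_trans (lerD H1 H2) _.
rewrite -[q.+1%:R]natr1 exprS.
have -> : (q%:R + 1) * d * (G * G ^+ q) = G * (q%:R * d * G ^+ q) + G * (d * G ^+ q) by ring.
by rewrite lerD2l ler_peMl// mulr_ge0// exprn_ge0.
Qed.

End PeriodicSums.

Section Spectrum.
Variables (R : realType) (rr : R).
Hypotheses (rr0 : 0 < rr) (rr1 : rr < 1).
Variables (N : nat) (A : 'M[int]_N) (i0 : 'I_N).
Local Notation C := R[i].
Local Notation Jw := (Jop A i0).
Variables (f : seqN N -> C) (G : R).
Let g : seqN N -> C := fun w => expC (f w).
Hypotheses (G0 : 0 <= G) (gG : bounded_by A g G) (gk : kreg rr A g).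
Variable lam : nat -> C.
Hypothesis He : eigen_enum A f lam.
Variables (r0 Th : R) (l j : nat).
Hypotheses (j0 : (0 < j)%N) (r00 : 0 < r0) (r0E : r0 ^+ (2 ^ l) = rr).
Hypothesis HTh : forall m,
  \sum_(a < m.+1) (nwords A a)%:R * (r0 ^+ (2 * a * j)) ^+ 2 <= Th.

Local Notation pp := (2 * j%:R / (2 ^ l)%:R : R).

Let pp_gt0 : 0 < pp.
Proof. by rewrite divr_gt0 ?mulr_gt0 ?ltr0n// expn_gt0. Qed.

(** Both sides sum over the same finite set of cycles, independent of [m]. The factors differ by the
    variation of [g] at level [m + 1]. *)
Lemma trace_Mop_cvg q (e : R) : (0 < q)%N -> 0 < e -> exists m0, forall m, (m0 <= m)%N ->
  cmod (\tr (opmx (@Mop _ A i0 _ m g) ^+ q) - Zper A f q) <= e.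
Proof.
move=> q0 e0; have [Bg Bg0 HBg] := gk 0.
pose G1 := G + 1; have G11 : 1 <= G1 by rewrite lerDr.
have G10 : 0 <= G1 by exact: le_trans G11.
pose K : R := #|{: q.-tuple 'I_N}|%:R * (q%:R * Bg * G1 ^+ q).
have K0 : 0 <= K by rewrite mulr_ge0// mulr_ge0 ?exprn_ge0// mulr_ge0.
have [n0 Hn] := expr_small_mul (ltW rr0) rr1 K0 e0.
exists n0.+1 => m nm; have m0 : (0 < m)%N by exact: leq_trans nm.
rewrite trace_Mop// (ZperE A i0)// -sumrB.
apply: le_trans (cmod_sum _ _ _) _.
apply: le_trans (_ : \sum_(s : q.-tuple 'I_N) q%:R * Bg * G1 ^+ q * rr ^+ m <= _).
  rewrite big_mkcond; apply: ler_sum => s _.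
  have RHS0 : 0 <= q%:R * Bg * G1 ^+ q * rr ^+ m.
    by rewrite mulr_ge0 ?exprn_ge0 ?(ltW rr0)// mulr_ge0 ?exprn_ge0// mulr_ge0.
  case: ifP => // /asboolP Ss.
  have Sk k : SigmaA A (iter k (@Defs.shift N) (per i0 s)) by exact: iter_shift_SigmaA.
  have cut w : SigmaA A w ->
      SigmaA A (consw (w 0%N) (ext A i0 (pre m (Defs.shift w)))).
    move=> Sw; have Ssw : SigmaA A (Defs.shift w) by move=> t; exact: Sw.
    apply: SigmaA_cons; first by apply: SigmaA_ext; rewrite ?size_pre// adm_pre.
    by rewrite ext_lt ?size_pre// nth_pre//; exact: Sw.
  apply: le_trans (@cmod_prod_diff _ q _ _ G1 (Bg * rr ^+ m) G11 _ _ _ _) _.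
  - by rewrite mulr_ge0// exprn_ge0// ltW.
  - by move=> t; apply: le_trans (gG (cut _ (Sk t))) _; rewrite lerDl.
  - by move=> t; apply: le_trans (gG (Sk t)) _; rewrite lerDl.
  - move=> t; have := HBg m.+1 _ _ (cut _ (Sk t)) (Sk t).
    move=> H; apply: le_trans (H _) _.
      move=> [|k] //= km; rewrite ext_lt ?size_pre// nth_pre//.
    rewrite addn0 ler_wpM2l//; apply: ler_wiXn2l; rewrite ?(ltW rr0) ?(ltW rr1)//.
    by rewrite (leq_trans (leqnSn m))// leq_pmulr.
  by rewrite le_eqVlt; apply/orP; left; apply/eqP; ring.
by rewrite sumr_const -[_ *+ _]mulr_natl mulrA -/K Hn// ltnW.
Qed.

(** The list [s] holds the eigenvalues of one corrected matrix that remain after the flag is split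
    off. [B] precedes all other data, and the smallness clause is conditional, so that [lam_sum_le]
    can use flags that do not reach every large eigenvalue. *)
Lemma finite_model : exists2 B, 0 <= B & forall n v t, flag rr A f n lam v t ->
  forall (eps d : R) q, 0 < eps -> 0 < d -> (0 < q)%N ->
  exists s : seq C,
   [/\ \sum_(i < n) cmod (lam i) `^ pp + \sum_(x <- s) cmod x `^ pp <= B,
      (forall i, eps <= cmod (lam i) -> (i < n)%N) -> forall x, x \in s -> cmod x < eps &
      cmod (\sum_(i < n) lam i ^+ q + \sum_(x <- s) x ^+ q - Zper A f q) <= d].
Proof.
have /choice[Bf HBf] := fun tau => let: ex_intro2 B B0 H :=
  Mop_bound rr0 rr1 i0 G0 gG gk tau in ex_intro (fun B => 0 <= B /\ _) B (conj B0 H).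
have Bf0 tau : 0 <= Bf tau by case: (HBf tau).
have {}HBf tau := (HBf tau).2.
have Th0 : 0 <= Th.
  by apply: le_trans (HTh 0); apply: sumr_ge0 => a _; rewrite mulr_ge0// sqr_ge0.
exists ((1 + (\prod_(i < j) (Bf i + 1)) ^+ 2) * Th).
  by rewrite mulr_ge0// addr_ge0// sqr_ge0.
move=> n v t Fl eps d q eps0 d0 q0.
have [v' [U [M [v'k v'L v'J Ml [span1 span2]]]]] := flag_dual rr0 rr1 i0 Fl.
have [m1 Hm1] := Mp_schatten rr0 rr1 G0 gG Bf0 HBf U v'k j0 r00 r0E HTh.
have d20 : 0 < d / 2 by rewrite divr_gt0.
have [m2 Hm2] := trace_Mp_Mop rr0 rr1 G0 gG Bf0 HBf U v'k q d20.
have [m3 Hm3] := trace_Mop_cvg q0 d20.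
(* If eigenvalues of modulus at least [eps] persisted for arbitrarily large [m], [quasi_eigen_limit]
   would produce an eigenfunction modulo the span, excluded by [no_extra_eigenvector]. *)
have [m4 Hm4] : exists m4, (forall i, eps <= cmod (lam i) -> (i < n)%N) ->
   forall m, (m4 <= m)%N -> ~ exists e (x : m.-bseq 'I_N -> C) c,
     [/\ eps <= cmod e, exists t, x t != 0 & quasi_eigen A i0 g v' U e x c].
  have [Hn|Hn] := pselect (forall i, eps <= cmod (lam i) -> (i < n)%N); last first.
    by exists 0%N.
  apply: contrapT => /forallNP Hno.
  have [|z [c [s [ez sV sL sJ [w0 [Sw0 sw0]]]]]] :=
    @quasi_eigen_limit R rr rr0 rr1 N A i0 g G Bf G0 gG gk Bf0 HBf n v' U v'k v'J eps eps0.
    move=> m0; apply: contrapT => Hm; apply: (Hno m0) => _ m mm Hb.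
    by apply: Hm; exists m.
  have z0 : z != 0 by rewrite -cmod_gt0; exact: lt_le_trans ez.
  have [a Ha] := span1 c.
  apply: (@no_extra_eigenvector R rr rr0 rr1 N A i0 f G G0 gG gk lam He n v t Fl s z a z0 sV).
  - by move=> w Sw; rewrite sL// Ha.
  (* The limit is outside the span: its increments vanish at the dual words, so any expansion in the
     [v'] has zero coefficients, while the limit is nonzero. *)
  - move=> b sb; have [cc Hcc] := span2 b.
    have JL := @Jop_lin N A i0 C.
    have scc : eqS A s (fun w => \sum_j cc j * v' j w).
      by move=> w Sw; rewrite sb// Hcc.
    have cc0 k : cc k = 0.
      have := sJ k; rewrite (@Jop_eq _ _ _ _ s (fun w => \sum_j cc j * v' j w)).
        rewrite (is_lin_sum _ _ _ _ JL) (bigD1 k)//= v'J eqxx mulr1 big1 ?addr0//.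
        by move=> i ik; rewrite v'J (negbTE ik) mulr0.
      by move=> u au /andP[u0 _]; apply: scc; exact: SigmaA_ext.
    by move/eqP: sw0; apply; rewrite scc// big1// => k _; rewrite cc0 mul0r.
  by move=> i iz; apply: Hn; rewrite iz.
pose mU := \max_k size (U k).
pose m := maxn m1 (maxn m2 (maxn m3 (maxn m4 mU))).
have [mm1 mm2 mm3 mm4 mmU] :
    [/\ (m1 <= m)%N, (m2 <= m)%N, (m3 <= m)%N, (m4 <= m)%N & (mU <= m)%N].
  by rewrite /m !leq_max !leqnn ?orbT.
have UmU k : (size (U k) <= m)%N by apply: leq_trans mmU; exact: leq_bigmax.
clearbody m.
pose P k : m.-bseq 'I_N := Bseq (UmU k).
have Ml' := @Mp_lin R N A i0 g n v' U m.
have [z Hz] := roots_of_exists (opmx (Mp A i0 g v' U (m := m))).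
have [||s [perm Hs]] := @op_split R _ (Mp A i0 g v' U (m := m)) n
  (fun i t => Jw (v' i) t) P M _ z Ml' _ _ Ml Hz.
- by move=> i t'; apply: (Mp_Jv v'L v'J).
- by move=> i k; exact: v'J.
have split (V : nmodType) (h : C -> V) : h 0 = 0 ->
    \sum_(x <- z) h x = \sum_(i < n) h (lam i) + \sum_(x <- s) h x.
  move=> h0; have := perm_big (op := +%R) (x := 0) _ perm (P := xpredT) (F := h).
  rewrite !big_cat /= big_nseq.
  have -> : iter n (+%R (h 0)) 0 = 0 :> V by elim: (n) => //= k ->; rewrite h0 addr0.
  rewrite addr0 => ->; rewrite addrC; congr (_ + _).
  by rewrite big_map -val_enum_ord big_map big_enum.
exists s; split.
- rewrite -(split R (fun x => cmod x `^ pp)); last by rewrite cmod0 powR0 ?gt_eqF.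
  exact: Hm1 mm1 _ Hz.
- move=> Hn x xs; rewrite ltNge; apply/negP => ex.
  have x0 : x != 0 by rewrite -cmod_gt0; exact: lt_le_trans ex.
  have [y [c [y0 yP yE]]] := Hs x xs x0.
  apply: (Hm4 Hn m mm4); exists x, y, c; split=> //; split=> // k.
  by rewrite -[U k]/(P k : seq _) zext_val.
rewrite -(split C (fun x => x ^+ q)); last by rewrite expr0n gtn_eqF.
rewrite -(roots_of_trace q Hz).
apply: le_trans (cmod_tri _ (\tr (opmx (@Mop _ A i0 _ m g) ^+ q)) _) _.
by rewrite (splitr d); apply: lerD; [exact: Hm2|exact: Hm3].
Qed.

Lemma lam_decreasing i k : (i <= k)%N -> cmod (lam k) <= cmod (lam i).
Proof.
have [H _] := He; elim: k => [|k IH]; first by rewrite leqn0 => /eqP ->.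
rewrite leq_eqVlt => /orP[/eqP ->//|ik].
by apply: le_trans (H k) (IH _).
Qed.

Lemma lam_sum_le : exists2 B, 0 <= B & forall n, \sum_(i < n) cmod (lam i) `^ pp <= B.
Proof.
have [B B0 HB] := finite_model; exists B => //.
elim=> [|n IH]; first by rewrite big_ord0.
have [ln|ln] := eqVneq (lam n) 0.
  by rewrite big_ord_recr /= ln cmod0 powR0 ?gt_eqF// addr0.
have [|v [t Fl]] := @flag_of_enum R rr rr0 rr1 N A i0 f G G0 gG gk lam He n.+1.
  move=> i ni; rewrite -cmod_gt0; apply: lt_le_trans (lam_decreasing (ni : (i <= n)%N)).
  by rewrite cmod_gt0.
have [s [H _ _]] := HB _ _ _ Fl 1 1 1%N ltr01 ltr01 isT.
by apply: le_trans H; rewrite lerDl sumr_ge0// => x _; exact: powR_ge0.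
Qed.

(** Both the tail of [lam] and the leftover list [s] have moduli below [eps] and a bounded sum of
    [pp]-th powers. As [q > pp], each contributes at most [eps^(q - pp) * B] to the sum of [q]-th
    powers. *)
Lemma lam_trace q : (0 < q)%N -> pp < q%:R ->
  cvgC (fun n => \sum_(i < n) lam i ^+ q) (Zper A f q).
Proof.
move=> q0 pq e e0.
have [B0 B00 HB0] := lam_sum_le; have [B1 B10 HB1] := finite_model.
pose B := B0 + B1 + 1; have Bp : 0 < B by rewrite /B ltr_wpDl// addr_ge0.
have k0 : 0 < q%:R - pp by rewrite subr_gt0.
(* Solves [eps^(q - pp) * B = e / 4]; the tail, the leftover eigenvalues and the trace error each
   cost at most [e / 4]. *)
pose eps := (e / (4 * B)) `^ (q%:R - pp)^-1.
have eB : 0 < e / (4 * B) by rewrite divr_gt0// mulr_gt0.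
have eps0 : 0 < eps by exact: powR_gt0.
have epsE : eps `^ (q%:R - pp) = e / (4 * B).
  by rewrite /eps -powRrM mulVf ?gt_eqF// powRr1// ltW.
have small (x : C) : cmod x < eps -> cmod (x ^+ q) <= e / (4 * B) * cmod x `^ pp.
  move=> xe; have [->|x0] := eqVneq x 0.
    by rewrite expr0n gtn_eqF// cmod0 mulr_ge0 ?powR_ge0// ltW.
  rewrite cmodX -powR_mulrn ?cmod_ge0// -[q%:R](subrK pp) powRD; last first.
    by rewrite cmod_eq0 x0 implybT.
  rewrite ler_wpM2r ?powR_ge0// -epsE.
  by apply: ge0_ler_powR; rewrite ?nnegrE ?cmod_ge0// ltW.
have smallB (S : R) : 0 <= S -> S <= B -> e / (4 * B) * S <= e / 4.
  move=> S0 SB; apply: le_trans (ler_wpM2l (ltW eB) SB) _.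
  by rewrite invfM mulrA mulfVK// gt_eqF.
have [n1 Hn1] : exists n1, cmod (lam n1) < eps.
  apply: contrapT => /forallNP H.
  have ge n : n%:R * eps `^ pp <= B0.
    apply: le_trans (HB0 n); rewrite -[n in n%:R]card_ord mulr_natl -sumr_const.
    apply: ler_sum => i _; apply: ge0_ler_powR; rewrite ?nnegrE ?cmod_ge0 ?(ltW eps0) ?(ltW pp_gt0)//.
    by rewrite leNgt; apply/negP; exact: H.
  have ep : 0 < eps `^ pp by exact: powR_gt0.
  have := ge (Num.truncn (B0 / eps `^ pp)).+1.
  rewrite -ler_pdivlMr// leNgt => /negP; apply.
  exact: truncnS_gt.
(* At the first index below [eps], everything earlier is nonzero, so a flag of length [n2] exists,
   and everything later is small by monotonicity. *)
have [n2 Hn2 n2min] := ex_minnP (ex_intro (fun n => cmod (lam n) < eps) n1 Hn1).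
have [|v [t Fl]] := @flag_of_enum R rr rr0 rr1 N A i0 f G G0 gG gk lam He n2.
  move=> i ni; rewrite -cmod_gt0; apply: lt_le_trans eps0 _; rewrite leNgt.
  by apply/negP => /n2min; rewrite leqNgt ni.
have e20 : 0 < e / 4 by rewrite divr_gt0.
have [s [sB ss sZ]] := HB1 _ _ _ Fl eps (e / 4) q eps0 e20 q0.
have {}ss x : x \in s -> cmod x < eps.
  apply: ss => i ei; rewrite ltnNge; apply/negP => ni.
  have := le_lt_trans (lam_decreasing ni) Hn2.
  by rewrite ltNge ei.
exists n2 => n nn.
have S1 : cmod (\sum_(x <- s) x ^+ q) <= e / 4.
  apply: le_trans (cmod_sum _ _ _) _.
  apply: le_trans (_ : \sum_(x <- s) e / (4 * B) * cmod x `^ pp <= _).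
    by rewrite !big_seq; apply: ler_sum => x xs; exact: small (ss x xs).
  rewrite -mulr_sumr; apply: smallB.
    by apply: sumr_ge0 => x _; exact: powR_ge0.
  apply: le_trans (_ : B1 <= _); last by rewrite /B -addrA addrCA lerDl addr_ge0.
  by apply: le_trans sB; rewrite lerDr sumr_ge0// => i _; exact: powR_ge0.
have S2 : cmod (\sum_(n2 <= i < n) lam i ^+ q) <= e / 4.
  apply: le_trans (cmod_sum _ _ _) _.
  apply: le_trans (_ : \sum_(n2 <= i < n) e / (4 * B) * cmod (lam i) `^ pp <= _).
    rewrite !big_nat; apply: ler_sum => i /andP[ni _]; apply: small.
    exact: le_lt_trans (lam_decreasing ni) Hn2.
  rewrite -mulr_sumr; apply: smallB.
    by apply: sumr_ge0 => x _; exact: powR_ge0.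
  apply: le_trans (_ : B0 <= _); last by rewrite /B -addrA lerDl addr_ge0.
  apply: le_trans (HB0 n); rewrite -(big_mkord xpredT (fun i => cmod (lam i) `^ pp)).
  rewrite [leRHS](big_cat_nat (n := n2))//= lerDr sumr_ge0// => i _; exact: powR_ge0.
rewrite -(big_mkord xpredT (fun i => lam i ^+ q)) (big_cat_nat (n := n2))//= big_mkord.
have -> : \sum_(i < n2) lam i ^+ q + \sum_(n2 <= i < n) lam i ^+ q - Zper A f q =
  (\sum_(i < n2) lam i ^+ q + \sum_(x <- s) x ^+ q - Zper A f q) +
  (\sum_(n2 <= i < n) lam i ^+ q - \sum_(x <- s) x ^+ q) by ring.
apply: le_trans (cmodD _ _) _.
apply: le_trans (lerD sZ (le_trans (cmodBD _ _) (lerD S2 S1))) _.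
lra.
Qed.

End Spectrum.

(** * The zeta function *)

Section LogExpansion.
Variable R : realType.
Local Notation C := R[i].
Implicit Types (u d w z : C).

(** A mean value inequality stated through increments instead of derivatives: over [n] equal steps
    the quadratic errors add up to [K / n]. *)
Lemma mean_value_quadratic (F : R -> C) (M K h0 : R) : 0 <= K -> 0 < h0 ->
  (forall t h, 0 <= t -> 0 < h -> h <= h0 -> t + h <= 1 ->
     cmod (F (t + h) - F t) <= M * h + K * h ^+ 2) ->
  cmod (F 1 - F 0) <= M.
Proof.
move=> K0 h00 HF; apply/ler_addgt0Pr => e e0.
pose n := (Num.truncn (Num.max h0^-1 (K / e))).+1.
have nb : Num.max h0^-1 (K / e) <= n%:R by exact: ltW (truncnS_gt _).
have h1 : n%:R^-1 <= h0.
  rewrite -[h0]invrK lef_pV2 ?posrE ?invr_gt0//.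
  by apply: le_trans nb; rewrite le_max lexx.
have h2 : K / n%:R <= e.
  rewrite ler_pdivrMr// mulrC -ler_pdivrMr//.
  by apply: le_trans nb; rewrite le_max lexx orbT.
have nE (i : nat) : i%:R / n%:R + n%:R^-1 = i.+1%:R / n%:R :> R.
  by rewrite -[i.+1%:R]natr1 mulrDl mul1r.
have -> : F 1 - F 0 = \sum_(i < n) (F (i%:R / n%:R + n%:R^-1) - F (i%:R / n%:R)).
  under eq_bigr => i _ do rewrite nE.
  rewrite -(big_mkord xpredT (fun i => F (i.+1%:R / n%:R) - F (i%:R / n%:R))).
  by rewrite telescope_sumr// divff ?gt_eqF// mul0r.
apply: le_trans (cmod_sum _ _ _) _.
apply: le_trans (_ : \sum_(i < n) (M * n%:R^-1 + K * n%:R^-1 ^+ 2) <= _).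
  apply: ler_sum => i _; apply: HF; rewrite ?invr_gt0 ?divr_ge0//.
  by rewrite nE ler_pdivrMr// mul1r ler_nat.
rewrite sumr_const card_ord -[leLHS]mulr_natr mulrDl mulfVK ?gt_eqF// lerD2l.
by rewrite expr2 mulrA mulfVK ?gt_eqF.
Qed.

Lemma pow_quadratic u d q : cmod u <= 1 -> cmod (u + d) <= 1 ->
  cmod ((u + d) ^+ q - u ^+ q - q%:R * d * u ^+ q.-1) <= q%:R ^+ 2 * cmod d ^+ 2.
Proof.
move=> u1 ud1; elim: q => [|q IH].
  by rewrite !expr0 subrr !mul0r subr0 cmod0 expr0n mul0r.
have -> : (u + d) ^+ q.+1 - u ^+ q.+1 - q.+1%:R * d * u ^+ q.+1.-1 =
  (u + d) * ((u + d) ^+ q - u ^+ q - q%:R * d * u ^+ q.-1) + q%:R * d ^+ 2 * u ^+ q.-1.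
  case: q {IH} => [|q]; first by rewrite /= !expr0 !mul0r subrr !subr0 mulr0 add0r; ring.
  by rewrite /= -[q.+2%:R]natr1 !exprS; ring.
apply: le_trans (cmodD _ _) _; rewrite !cmodM !cmodX cmod_nat.
apply: le_trans (_ : q%:R ^+ 2 * cmod d ^+ 2 + q%:R * cmod d ^+ 2 <= _).
  apply: lerD.
    by rewrite -[leRHS]mul1r; apply: ler_pM; rewrite ?cmod_ge0.
  apply: ler_piMr; last by apply: exprn_ile1; rewrite ?cmod_ge0.
  by apply: mulr_ge0; [exact: ler0n|apply: mulr_ge0; exact: cmod_ge0].
rewrite -mulrDl ler_wpM2r ?exprn_ge0 ?cmod_ge0// -natr1 sqrrD mulr1 expr1n.
have := ler0n R q.
set x := q%:R; set y := x ^+ 2; rewrite -mulr_natr; lra.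
Qed.

Local Notation logpoly n u := (\sum_(1 <= q < n.+1) u ^+ q / q%:R).

Lemma cmod_natV q : cmod ((q%:R)^-1 : C) = q%:R^-1.
Proof. by rewrite cmodV cmod_nat. Qed.

Lemma geo_big1 n u :
  (\sum_(1 <= q < n.+1) u ^+ q.-1) * (1 - u) = 1 - u ^+ n.
Proof.
rewrite big_add1 big_mkord /= -[RHS]opprB subrX1 -mulNr opprB mulrC.
by congr (_ * _).
Qed.

Lemma logpoly_quadratic n u d : cmod u <= 1 -> cmod (u + d) <= 1 ->
  cmod (logpoly n (u + d) - logpoly n u - d * \sum_(1 <= q < n.+1) u ^+ q.-1)
    <= (\sum_(1 <= q < n.+1) q%:R) * cmod d ^+ 2.
Proof.
move=> u1 ud1; rewrite mulr_sumr -!sumrB mulr_suml.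
apply: le_trans (cmod_sum _ _ _) _; rewrite !big_nat; apply: ler_sum => q /andP[q0 _].
have qC : (q%:R : C) != 0 by rewrite pnatr_eq0 -lt0n.
have qR : 0 < q%:R :> R by rewrite ltr0n.
have -> : (u + d) ^+ q / q%:R - u ^+ q / q%:R - d * u ^+ q.-1 =
  ((u + d) ^+ q - u ^+ q - q%:R * d * u ^+ q.-1) / q%:R by field.
rewrite cmodM cmod_natV ler_pdivrMr//.
by apply: le_trans (pow_quadratic q u1 ud1) _; rewrite [leRHS]mulrAC -expr2.
Qed.

Lemma cmod_logpoly n u : cmod u <= 2^-1 -> cmod (logpoly n u) <= 1.
Proof.
move=> u1; apply: le_trans (cmod_sum _ _ _) _.
apply: le_trans (_ : \sum_(1 <= q < n.+1) 2^-1 ^+ q <= _).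
  rewrite !big_nat; apply: ler_sum => q /andP[q0 _].
  rewrite cmodM cmodX cmod_natV ler_pdivrMr ?ltr0n//.
  apply: le_trans (_ : 2^-1 ^+ q <= _); first by rewrite lerXn2r ?nnegrE ?cmod_ge0.
  by rewrite ler_peMr ?exprn_ge0// ler1n.
have -> : \sum_(1 <= q < n.+1) 2^-1 ^+ q = 1 - 2^-1 ^+ n :> R.
  elim: n => [|n IH]; first by rewrite big_geq// expr0 subrr.
  by rewrite big_nat_recr//= IH exprS; lra.
by rewrite gerBl exprn_ge0.
Qed.

(* The derivative of t |-> (1 - t w) exp (sum_(q <= n) (t w)^q / q) is
   - w (t w)^n exp (...). *)
Lemma Efac_near1 n w : cmod w <= 2^-1 ->
  cmod (Efac n w - 1) <= expR 1 * cmod w ^+ n.+1.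
Proof.
move=> w1; pose F (t : R) : C := Efac n (t%:C%C * w).
have <- : F 1 = Efac n w by rewrite /F mul1r.
have <- : F 0 = 1.
  rewrite /F mul0r /Efac subr0 mul1r big_nat big1 ?expC0// => q /andP[q0 _].
  by rewrite expr0n gtn_eqF// mul0r.
pose a : R := \sum_(1 <= q < n.+1) q%:R.
have a0 : 0 <= a by apply: sumr_ge0.
pose b : R := n%:R + a; have b0 : 0 <= b by rewrite addr_ge0.
pose K : R := expR 1 * (b + 6 * b ^+ 2 + 2 * (6 * b ^+ 2 + a)).
have b2 : 0 <= b ^+ 2 by exact: sqr_ge0.
have K0 : 0 <= K by rewrite mulr_ge0 ?expR_ge0//; lra.
have bp : 0 < 2 * (b + 1) by lra.
apply: (@mean_value_quadratic F _ K (2 * (b + 1))^-1 K0); first by rewrite invr_gt0.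
move=> t h t0 h0 hh th.
have h1 : h <= 1 by apply: le_trans th; rewrite lerDr.
have t1 : t <= 1 by apply: le_trans th; rewrite lerDl ltW.
rewrite /F /Efac; set u := t%:C%C * w; pose d := h%:C%C * w.
have -> : (t + h)%:C%C * w = u + d by rewrite rmorphD mulrDl.
have cd : cmod d = h * cmod w by rewrite cmodM cmodR ger0_norm// ltW.
have cu : cmod u = t * cmod w by rewrite cmodM cmodR ger0_norm.
have w0 := cmod_ge0 w.
have dh : cmod d <= h by rewrite cd ler_piMr ?(ltW h0)//; lra.
have uh : cmod u <= 2^-1.
  by rewrite cu; apply: le_trans w1; rewrite ler_piMl.
have udh : cmod (u + d) <= 1.
  rewrite -mulrDl -rmorphD cmodM cmodR ger0_norm ?addr_ge0// ?(ltW h0)//.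
  by apply: mulr_ile1; rewrite ?addr_ge0 ?(ltW h0)//; lra.
have u1 : cmod u <= 1 by lra.
have := logpoly_quadratic n u1 udh; rewrite -/a.
set L := logpoly n u; set L' := logpoly n (u + d).
set s := \sum_(1 <= q < n.+1) u ^+ q.-1; set e2 := L' - L - d * s => He2.
pose D := L' - L; have De : D = d * s + e2 by rewrite /e2 /D; ring.
have d0 := cmod_ge0 d.
have {}He2 : cmod e2 <= a * h ^+ 2.
  apply: le_trans He2 _; rewrite ler_wpM2l// lerXn2r ?nnegrE// ltW//.
have sn : cmod s <= n%:R.
  apply: le_trans (cmod_sum _ _ _) _.
  apply: le_trans (_ : \sum_(1 <= q < n.+1) 1 <= _).
    by apply: ler_sum => q _; rewrite cmodX exprn_ile1 ?cmod_ge0.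
  by rewrite sumr_const_nat subn1.
have Dh : cmod D <= b * h.
  rewrite De; apply: le_trans (cmodD _ _) _; rewrite cmodM /b mulrDl.
  apply: lerD; first by rewrite [leRHS]mulrC ler_pM ?cmod_ge0.
  by apply: le_trans He2 _; rewrite ler_wpM2l// expr2 ler_piMr ?(ltW h0).
have D2 : cmod D <= 2^-1.
  apply: le_trans Dh _; apply: le_trans (ler_wpM2l b0 hh) _.
  rewrite ler_pdivrMr//; lra.
pose e1 := expC D - 1 - D.
have He1 : cmod e1 <= 6 * (b * h) ^+ 2.
  apply: le_trans (expC_quadratic D2) _; rewrite ler_wpM2l//.
  by rewrite lerXn2r ?nnegrE ?cmod_ge0// mulr_ge0// ltW.
have -> : L' = L + D by rewrite /D addrC subrK.
have sE : s * (1 - u) = 1 - u ^+ n by exact: geo_big1.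
(* The first-order terms [- d] and [(1 - u) * d * s] combine to [- d * u^n] by [sE]; every other
   term is of second order in [h]. *)
have -> : (1 - (u + d)) * expC (L + D) - (1 - u) * expC L =
    expC L * (- (d * u ^+ n) - d * (D + e1) + (1 - u) * (e1 + e2)).
  rewrite expCD; have -> : expC D = 1 + D + e1 by rewrite /e1; ring.
  have -> : u ^+ n = 1 - s * (1 - u) by rewrite sE subKr.
  have -> : e2 = D - d * s by rewrite De; ring.
  ring.
clearbody D s e2 L' e1.
have LL : cmod (expC L) <= expR 1.
  rewrite cmod_expC ler_expR; apply: le_trans (ler_norm _) _.
  exact: le_trans (cmod_Re _) (cmod_logpoly n uh).
rewrite cmodM.
have -> : expR 1 * cmod w ^+ n.+1 * h + K * h ^+ 2 = expR 1 *
   (h * cmod w ^+ n.+1 + (b + 6 * b ^+ 2 + 2 * (6 * b ^+ 2 + a)) * h ^+ 2).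
  by rewrite /K; ring.
apply: ler_pM; rewrite ?cmod_ge0//.
have T1 : cmod (- (d * u ^+ n)) <= h * cmod w ^+ n.+1.
  rewrite cmodN cmodM cmodX cd cu exprS mulrA ler_wpM2l ?mulr_ge0 ?(ltW h0)//.
  by rewrite lerXn2r ?nnegrE ?mulr_ge0// ler_piMl.
have h2h : h ^+ 2 <= h by rewrite expr2 ler_piMr// ltW.
have T2 : cmod (d * (D + e1)) <= (b + 6 * b ^+ 2) * h ^+ 2.
  rewrite cmodM; apply: le_trans (_ : h * (b * h + 6 * b ^+ 2 * h) <= _); last first.
    by rewrite le_eqVlt; apply/orP; left; apply/eqP; ring.
  apply: ler_pM; rewrite ?cmod_ge0//; apply: le_trans (cmodD _ _) _.
  apply: lerD => //; apply: le_trans He1 _; rewrite exprMn mulrA ler_wpM2l//.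
  by rewrite mulr_ge0.
have T3 : cmod ((1 - u) * (e1 + e2)) <= 2 * (6 * b ^+ 2 + a) * h ^+ 2.
  rewrite cmodM -mulrA; apply: ler_pM; rewrite ?cmod_ge0//.
    by apply: le_trans (cmodBD _ _) _; rewrite cmod1; lra.
  apply: le_trans (cmodD _ _) _; rewrite mulrDl; apply: lerD => //.
  by apply: le_trans He1 _; rewrite exprMn mulrA.
apply: le_trans (cmodD _ _) _.
apply: le_trans (lerD (le_trans (cmodBD _ _) (lerD T1 T2)) T3) _.
by rewrite [X in _ <= _ + X]mulrDl addrA.
Qed.

End LogExpansion.

(** * The canonical product and its exponential form near 0 *)

Section CanonicalProduct.
Variable R : realType.
Local Notation C := R[i].
Implicit Types (z w l : C) (u : nat -> C).

Lemma cvgC_ucvg (U : set_system nat) u l : UltraFilter U ->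
  (forall k0, U [set k | (k0 <= k)%N]) -> cvgC u l -> ucvg U u l.
Proof.
move=> UU Uoo H e e0; have [M HM] := H e e0.
by apply: filterS (Uoo M) => n; exact: HM.
Qed.

Lemma ucvg_expC (U : set_system nat) u l : UltraFilter U ->
  ucvg U u l -> ucvg U (fun n => expC (u n)) (expC l).
Proof.
move=> UU H e e0; have [K K0 HK] := expC_lip (cmod l + 1).
have K1 : 0 < K + 1 by rewrite ltr_wpDl.
pose d := Num.min 1 (e / (K + 1)).
have d0 : 0 < d by rewrite lt_min ltr01 divr_gt0.
apply: filterS (H d d0) => n /= Hn.
have d1 : d <= 1 by rewrite ge_min lexx.
have de : d * (K + 1) <= e by rewrite -ler_pdivlMr// ge_min lexx orbT.
apply: le_trans (HK _ _ _ _) _; last 2 first.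
- by rewrite lerDl.
- apply: le_trans de; rewrite mulrC; apply: ler_pM; rewrite ?cmod_ge0//.
  by rewrite lerDl.
by apply: le_trans (cmod_dist _ l) _; rewrite lerD2l (le_trans Hn).
Qed.

(** The limit along a free ultrafilter of the bounded tail is the candidate; the Cauchy condition
    upgrades it to an ordinary limit. *)
Lemma cauchy_cvgC u :
  (forall e : R, 0 < e -> exists M, forall m n, (M <= m)%N -> (m <= n)%N ->
     cmod (u n - u m) <= e) -> exists l, cvgC u l.
Proof.
move=> H; have [U [UU Uoo]] := exists_free_ultrafilter.
have [M HM] := H 1 ltr01.
have [|l Hl] := @ucvg_exists R U UU (fun n => u (n + M)%N) (cmod (u M) + 1).
  by move=> n; apply: le_trans (cmod_dist _ (u M)) _; rewrite lerD2l HM ?leq_addl.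
exists l => e e0; have [M' HM'] := H e e0; exists M' => n Mn.
rewrite cmodB; apply: (ucvg_le UU (ucvgD UU Hl (ucvg_cst UU (- u n)))).
apply: filterS (Uoo n) => m /= nm; apply: HM' => //.
exact: leq_trans nm (leq_addr _ _).
Qed.

Lemma cvgC_dist_le u l a (e : R) n : cvgC u l ->
  (forall m, (n <= m)%N -> cmod (u m - a) <= e) -> cmod (a - l) <= e.
Proof.
move=> H Ha; have [U [UU Uoo]] := exists_free_ultrafilter.
rewrite cmodB.
apply: (ucvg_le UU (ucvgD UU (cvgC_ucvg UU Uoo H) (ucvg_cst UU (- a)))).
by apply: filterS (Uoo n) => m /= nm; exact: Ha.
Qed.

Lemma prod_cauchy (x : nat -> C) (c : nat -> R) (B : R) m n :
  (forall j, cmod (x j - 1) <= c j) -> (forall n, \sum_(j < n) c j <= B) ->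
  (m <= n)%N ->
  cmod (\prod_(j < n) x j - \prod_(j < m) x j) <= expR B * \sum_(m <= j < n) c j.
Proof.
move=> Hx HB; have c0 j : 0 <= c j by apply: le_trans (Hx j); exact: cmod_ge0.
have P i : cmod (\prod_(j < i) x j) <= expR B.
  apply: le_trans (_ : expR (\sum_(j < i) c j) <= _); last by rewrite ler_expR.
  elim: i => [|i IH]; first by rewrite !big_ord0 cmod1 expR0.
  rewrite !big_ord_recr /= expRD cmodM; apply: ler_pM; rewrite ?cmod_ge0//.
  apply: le_trans (expR_ge1Dx _); apply: le_trans (cmod_dist _ 1) _.
  by rewrite cmod1 lerD2l.
elim: n => [|n IH]; first by rewrite leqn0 => /eqP ->; rewrite subrr cmod0 big_geq// mulr0.
rewrite leq_eqVlt => /orP[/eqP ->|mn]; first by rewrite subrr cmod0 big_geq// mulr0.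
rewrite big_nat_recr//= big_ord_recr /= mulrDr.
have -> : \prod_(j < n) x j * x n - \prod_(j < m) x j =
  (\prod_(j < n) x j - \prod_(j < m) x j) + \prod_(j < n) x j * (x n - 1) by ring.
apply: le_trans (cmodD _ _) _; apply: lerD; first exact: IH.
by rewrite cmodM; apply: ler_pM; rewrite ?cmod_ge0.
Qed.

(** Near 0 this is [Efac_near1]. For [cmod w > 1/2] the factor [2^(k+1) * cmod w ^+ k.+1] exceeds 1,
    so a crude bound on the disc suffices. *)
Lemma Efac_bound k (rho : R) : exists2 K, 0 <= K & forall w, cmod w <= rho ->
  cmod (Efac k w - 1) <= K * cmod w ^+ k.+1.
Proof.
pose B : R := (1 + rho) * expR (\sum_(1 <= q < k.+1) rho ^+ q) + 1.
have [rho0|rho0] := leP 0 rho; last first.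
  by exists 0 => // w /le_lt_trans /(_ rho0); rewrite ltNge cmod_ge0.
have B0 : 0 <= B by rewrite addr_ge0// mulr_ge0 ?expR_ge0// addr_ge0.
have K20 : 0 <= B * 2 ^+ k.+1 by rewrite mulr_ge0// exprn_ge0.
exists (expR 1 + B * 2 ^+ k.+1); first by rewrite addr_ge0.
move=> w wr; have wk0 : 0 <= cmod w ^+ k.+1 by rewrite exprn_ge0// cmod_ge0.
have [w1|w1] := leP (cmod w) 2^-1.
  by apply: le_trans (Efac_near1 k w1) _; rewrite ler_wpM2r// lerDl.
apply: le_trans (_ : B <= _).
  apply: le_trans (cmodBD _ _) _; rewrite cmod1 lerD2r cmodM.
  apply: ler_pM; rewrite ?cmod_ge0//.
    by apply: le_trans (cmodBD _ _) _; rewrite cmod1 lerD2l.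
  rewrite cmod_expC ler_expR; apply: le_trans (ler_norm _) _.
  apply: le_trans (cmod_Re _) _; apply: le_trans (cmod_sum _ _ _) _.
  rewrite !big_nat; apply: ler_sum => q /andP[q0 _].
  rewrite cmodM cmodX cmod_natV ler_pdivrMr ?ltr0n//.
  apply: le_trans (_ : rho ^+ q <= _); first by rewrite lerXn2r ?nnegrE ?cmod_ge0.
  by rewrite ler_peMr ?exprn_ge0// ler1n.
apply: le_trans (_ : B * 2 ^+ k.+1 * cmod w ^+ k.+1 <= _); last first.
  by rewrite ler_wpM2r// lerDr.
rewrite -mulrA -exprMn ler_peMr// exprn_ege1//.
by rewrite -ler_pdivrMl// mulr1 ltW.
Qed.

Lemma Efac_expC k n w :
  Efac k w * expC (\sum_(k.+1 <= q < (n + k).+1) w ^+ q / q%:R) = Efac (n + k) w.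
Proof.
rewrite /Efac -mulrA -expCD -big_cat_nat//=.
by rewrite ltnS leq_addl.
Qed.

Variables (lam Z : nat -> C) (k : nat).
Hypothesis Hsum : cvgn (series (fun n => cmod (lam n) ^+ k.+1)).
Hypothesis Htr : forall q, (k < q)%N -> cvgC (fun n => \sum_(j < n) lam j ^+ q) (Z q).

Lemma lam_sum_bound : exists2 S, 0 <= S &
  forall n, \sum_(j < n) cmod (lam j) ^+ k.+1 <= S.
Proof.
have H n : \sum_(j < n) cmod (lam j) ^+ k.+1 <= limn (series (fun n => cmod (lam n) ^+ k.+1)).
  rewrite -(big_mkord xpredT (fun j => cmod (lam j) ^+ k.+1)).
  apply: (nondecreasing_cvgn_le _ Hsum) => a b ab; rewrite /series /=.
  rewrite [leRHS](big_cat_nat (n := a))//= lerDl sumr_ge0// => j _.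
  by rewrite exprn_ge0// cmod_ge0.
exists (limn (series (fun n => cmod (lam n) ^+ k.+1))) => //.
by apply: le_trans (H 0%N); rewrite big_ord0.
Qed.

Lemma lam_sum_tail (e : R) : 0 < e -> exists M, forall m n, (M <= m)%N -> (m <= n)%N ->
  \sum_(m <= j < n) cmod (lam j) ^+ k.+1 <= e.
Proof.
move=> e0; have e20 : 0 < e / 2 by rewrite divr_gt0.
have /cvgrPdist_le/(_ _ e20)[M _ HM] := Hsum.
exists M => m n Mm mn.
have Hm := HM m Mm; have Hn := HM n (leq_trans Mm mn).
have -> : \sum_(m <= j < n) cmod (lam j) ^+ k.+1 =
   series (fun n => cmod (lam n) ^+ k.+1) n - series (fun n => cmod (lam n) ^+ k.+1) m.
  by rewrite /series /= (big_cat_nat (leq0n m) mn) /= [RHS]addrC addKr.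
move: Hm Hn => /=; rewrite !ler_norml => /andP[h1 h2] /andP[h3 h4]; lra.
Qed.

Lemma canonical_product : exists F : C -> C,
  (forall rho eps : R, 0 < eps -> exists M, forall n, (M <= n)%N ->
     forall z, cmod z <= rho -> cmod (\prod_(j < n) Efac k (z * lam j) - F z) <= eps) /\
  (exists delta : R, 0 < delta /\ forall z, cmod z < delta -> exists s : C,
     cvgC (fun n => \sum_(1 <= q < n.+1) z ^+ q / q%:R * Z q) s /\
     expC (- s) = expC (- \sum_(1 <= q < k.+1) z ^+ q / q%:R * Z q) * F z).
Proof.
have [S S0 HS] := lam_sum_bound.
(* [b] bounds every [cmod (lam j)]: a modulus above 1 is at most its [k.+1]-st power, hence at most
   [S]. The radius [1/(2b)] below then keeps every [z * lam j] in the disc of radius 1/2 where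
   [Efac_near1] applies. *)
pose b := S + 1; have b1 : 1 <= b by rewrite lerDr.
have b0 : 0 < b by exact: lt_le_trans b1.
have lamb j : cmod (lam j) <= b.
  have [l1|l1] := leP (cmod (lam j)) 1; first exact: le_trans b1.
  have := HS j.+1; rewrite big_ord_recr /= => H.
  apply: le_trans (_ : cmod (lam j) ^+ k.+1 <= _); first by rewrite ler_eXnr// ltW.
  apply: le_trans (_ : S <= _); last by rewrite lerDl.
  apply: le_trans H; rewrite lerDr sumr_ge0// => i _.
  by rewrite exprn_ge0// cmod_ge0.
have unif (rho eps : R) : 0 < eps -> exists M, forall m n, (M <= m)%N -> (m <= n)%N ->
    forall z, cmod z <= rho ->
    cmod (\prod_(j < n) Efac k (z * lam j) - \prod_(j < m) Efac k (z * lam j)) <= eps.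
  move=> eps0; have [K K0 HK] := Efac_bound k (`|rho| * b).
  pose a := K * `|rho| ^+ k.+1; have a0 : 0 <= a by rewrite mulr_ge0// exprn_ge0.
  have ea0 : 0 < expR (a * S) * a + 1 by rewrite ltr_wpDl// mulr_ge0// expR_ge0.
  have [M HM] := lam_sum_tail (divr_gt0 eps0 ea0).
  exists M => m n Mm mn z zr.
  have {}zr : cmod z <= `|rho| by apply: le_trans zr (ler_norm _).
  have aS N : \sum_(j < N) a * cmod (lam j) ^+ k.+1 <= a * S.
    by rewrite -mulr_sumr ler_wpM2l.
  apply: le_trans (prod_cauchy (x := fun j => Efac k (z * lam j))
    (c := fun j => a * cmod (lam j) ^+ k.+1) _ aS mn) _.
    move=> j; apply: le_trans (HK _ _) _.
      by rewrite cmodM; apply: ler_pM; rewrite ?cmod_ge0.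
    rewrite cmodM exprMn mulrA ler_wpM2r ?exprn_ge0 ?cmod_ge0//.
    by rewrite ler_wpM2l// lerXn2r ?nnegrE ?cmod_ge0.
  rewrite -mulr_sumr mulrA.
  apply: le_trans (ler_wpM2l _ (HM m n Mm mn)) _; first by rewrite mulr_ge0// expR_ge0.
  by rewrite mulrCA ler_piMr ?(ltW eps0)// ler_pdivrMr// mul1r lerDl.
have /choice[F HF] : forall z, exists l, cvgC (fun n => \prod_(j < n) Efac k (z * lam j)) l.
  move=> z; apply: cauchy_cvgC => e e0; have [M HM] := unif (cmod z) e e0.
  by exists M => m n Mm mn; apply: HM.
exists F; split.
  move=> rho eps eps0; have [M HM] := unif rho eps eps0.
  exists M => n Mn z zr; apply: (cvgC_dist_le (n := n) (HF z)) => m nm.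
  exact: HM n m Mn nm z zr.
have bb0 : 0 < 2 * b by rewrite mulr_gt0.
exists (2 * b)^-1; split; first by rewrite invr_gt0.
move=> z zd; have [U [UU Uoo]] := exists_free_ultrafilter.
have zb : cmod z * b <= 2^-1.
  by rewrite -ler_pdivlMr// -invfM mulrC ltW// mulrC.
have z1 : cmod z <= 1.
  by apply: le_trans (_ : cmod z * b <= _); [rewrite ler_peMr ?cmod_ge0|lra].
have zlam j : cmod (z * lam j) <= 2^-1.
  by rewrite cmodM; apply: le_trans zb; rewrite ler_wpM2l ?cmod_ge0.
have ZS q : (k < q)%N -> cmod (Z q) <= S * b ^+ q.
  move=> kq; apply: (ucvg_le UU (cvgC_ucvg UU Uoo (Htr kq))).
  apply: filterS (Uoo 0%N) => n /= _; apply: le_trans (cmod_sum _ _ _) _.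
  apply: le_trans (_ : \sum_(j < n) cmod (lam j) ^+ k.+1 * b ^+ q <= _).
    apply: ler_sum => j _; rewrite cmodX -{1}(subnKC kq) exprD.
    rewrite ler_wpM2l ?exprn_ge0 ?cmod_ge0//.
    apply: le_trans (_ : b ^+ (q - k.+1) <= _); first by rewrite lerXn2r ?nnegrE ?cmod_ge0 ?(ltW b0).
    by rewrite ler_weXn2l// leq_subr.
  by rewrite -mulr_suml ler_wpM2r// exprn_ge0// ltW.
pose T n := \sum_(k.+1 <= q < (n + k).+1) z ^+ q / q%:R * Z q.
pose Hk := \sum_(1 <= q < k.+1) z ^+ q / q%:R * Z q.
have term q : (k < q)%N -> cmod (z ^+ q / q%:R * Z q) <= S * 2^-1 ^+ q.
  move=> kq; have q0 : (0 < q)%N by exact: leq_trans kq.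
  rewrite !cmodM cmodX cmod_natV.
  apply: le_trans (_ : cmod z ^+ q * (S * b ^+ q) <= _).
    apply: ler_pM; rewrite ?mulr_ge0 ?exprn_ge0 ?cmod_ge0 ?invr_ge0//; last exact: ZS.
    rewrite ler_piMr ?exprn_ge0 ?cmod_ge0//.
    by rewrite invf_le1 ?ltr0n// ler1n.
  rewrite mulrCA -exprMn ler_wpM2l// lerXn2r ?nnegrE ?mulr_ge0 ?cmod_ge0//.
  exact: ltW.
have geo m n : (m <= n)%N -> \sum_(m.+1 <= q < n.+1) 2^-1 ^+ q <= 2^-1 ^+ m :> R.
  move=> mn; have -> : \sum_(m.+1 <= q < n.+1) 2^-1 ^+ q = 2^-1 ^+ m - 2^-1 ^+ n :> R.
    elim: n mn => [|n IH]; first by rewrite leqn0 => /eqP ->; rewrite big_geq// subrr.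
    rewrite leq_eqVlt => /orP[/eqP ->|mn]; first by rewrite big_geq// subrr.
    by rewrite big_nat_recr//= IH// exprS; lra.
  by rewrite gerBl exprn_ge0.
have half0 : (0 : R) <= 2^-1 by rewrite invr_ge0.
have half1 : (2^-1 : R) < 1 by rewrite invf_lt1// ltr1n.
have [T0 HT0] : exists l, cvgC T l.
  apply: cauchy_cvgC => e e0; have [M HM] := expr_small_mul half0 half1 S0 e0.
  exists M => m n Mm mn.
  have mnk : (m + k <= n + k)%N by rewrite leq_add2r.
  have -> : T n - T m = \sum_((m + k).+1 <= q < (n + k).+1) z ^+ q / q%:R * Z q.
    rewrite /T (big_cat_nat (n := (m + k).+1)) ?ltnS ?leq_addl//=.
    by rewrite [LHS]addrC addKr.
  apply: le_trans (cmod_sum _ _ _) _.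
  apply: le_trans (_ : \sum_((m + k).+1 <= q < (n + k).+1) S * 2^-1 ^+ q <= _).
    rewrite !big_nat; apply: ler_sum => q /andP[mq _]; apply: term.
    by apply: leq_ltn_trans mq; exact: leq_addl.
  rewrite -mulr_sumr; apply: le_trans (ler_wpM2l S0 (geo _ _ mnk)) _.
  by apply: HM; exact: leq_trans Mm (leq_addr _ _).
exists (Hk + T0); split.
  move=> e e0; have [M HM] := HT0 e e0; exists (M + k)%N => n Mn.
  have kn : (k <= n)%N by exact: leq_trans (leq_addl _ _) Mn.
  rewrite (big_cat_nat (n := k.+1))//= -/Hk.
  rewrite opprD addrACA subrr add0r -(subnK kn); apply: HM.
  by rewrite leq_subRL// addnC.
(* For fixed [n] the exponent is a finite sum of the limits [Z q], so the number [m] of factors can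
   tend to infinity first. The rate [2^-n] comes from [|z lam_j|^(n+k+1) <= 2^-n |lam_j|^(k+1)],
   which uses [cmod z <= 1]. *)
have near1 n : cmod (F z * expC (T n) - 1) <=
    expR (expR 1 * S) * (expR 1 * S) * 2^-1 ^+ n.
  pose X m := \sum_(k.+1 <= q < (n + k).+1) z ^+ q / q%:R * \sum_(j < m) lam j ^+ q.
  have XT : ucvg U X (T n).
    rewrite /T big_nat; apply: (@ucvg_eq R U UU Uoo (fun m =>
      \sum_(k.+1 <= q < (n + k).+1 | (k.+1 <= q < (n + k).+1)%N)
        z ^+ q / q%:R * \sum_(j < m) lam j ^+ q)).
      by exists 0%N => m _; rewrite /X [RHS]big_nat.
    apply: ucvg_sum => // q /andP[kq _]; apply: ucvgM => //; first exact: ucvg_cst.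
    exact: cvgC_ucvg (Htr kq).
  have PX m : \prod_(j < m) Efac k (z * lam j) * expC (X m) =
      \prod_(j < m) Efac (n + k) (z * lam j).
    have -> : X m = \sum_(j < m) \sum_(k.+1 <= q < (n + k).+1) (z * lam j) ^+ q / q%:R.
      rewrite /X exchange_big /=; apply: eq_bigr => q _; rewrite mulr_sumr.
      by apply: eq_bigr => j _; rewrite exprMn mulrAC.
    rewrite expC_sum -big_split /=; apply: eq_bigr => j _; exact: Efac_expC.
  apply: (ucvg_le UU (ucvgD UU (ucvgM UU (cvgC_ucvg UU Uoo (HF z))
    (ucvg_expC UU XT)) (ucvg_cst UU (- 1)))).
  apply: filterS (Uoo 0%N) => m /= _; rewrite PX.
  pose c j := expR 1 * 2^-1 ^+ n * cmod (lam j) ^+ k.+1.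
  have cs i : \sum_(j < i) c j <= expR 1 * 2^-1 ^+ n * S.
    by rewrite -mulr_sumr ler_wpM2l// mulr_ge0// exprn_ge0.
  have cS i : \sum_(j < i) c j <= expR 1 * S.
    apply: le_trans (cs i) _; rewrite ler_wpM2r// ler_piMr//.
    by rewrite exprn_ile1// ltW.
  have := prod_cauchy (x := fun j => Efac (n + k) (z * lam j)) (c := c) _ cS (leq0n m).
  rewrite big_ord0 big_mkord => H; apply: le_trans (H _) _.
    move=> j; apply: le_trans (Efac_near1 _ (zlam j)) _.
    rewrite /c -mulrA ler_wpM2l// -addnS exprD.
    apply: ler_pM; rewrite ?exprn_ge0 ?cmod_ge0//.
      by rewrite lerXn2r ?nnegrE ?cmod_ge0.
    by rewrite lerXn2r ?nnegrE ?cmod_ge0// cmodM ler_piMl ?cmod_ge0.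
  rewrite -mulrA ler_wpM2l ?expR_ge0//.
  by apply: le_trans (cs m) _; rewrite mulrAC.
have FT : F z * expC T0 = 1.
  apply: (ucvg_unique UU (x := fun n => F z * expC (T n))).
    exact: ucvgM (ucvg_cst _ _) (ucvg_expC UU (cvgC_ucvg UU Uoo HT0)).
  move=> e e0; set Q := expR (expR 1 * S) * (expR 1 * S) in near1.
  have Q0 : 0 <= Q by rewrite !mulr_ge0// expR_ge0.
  have [M HM] := expr_small_mul half0 half1 Q0 e0.
  by apply: filterS (Uoo M) => n /= Mn; apply: le_trans (near1 n) (HM n Mn).
rewrite -/Hk opprD expCD; congr (_ * _).
by rewrite -[RHS]mulr1 -expC0 -(subrr T0) expCD mulrA FT mul1r.
Qed.

End CanonicalProduct.

(** * Word growth and the choice of exponents *)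

Section Fekete.
Variables (R : realType) (a : nat -> R).
Hypotheses (a0 : forall n, 0 <= a n) (aD : forall m n, a (m + n)%N <= a m + a n).

(** Fekete's argument: the limit is the infimum of the quotients. Division with remainder by a
    nearly optimal length gives the bound for every [n], the remainders going into [M]. *)
Lemma subadditive_limn (e : R) : 0 < e -> exists M, forall n,
  a n <= n%:R * (limn (fun n => a n / n%:R) + e) + M.
Proof.
pose S := [set x : R | exists n, x = a n.+1 / n.+1%:R].
have Sinf : has_inf S.
  split; first by exists (a 1%N / 1%:R), 0%N.
  by exists 0 => _ [n ->]; rewrite divr_ge0.
have upper (d : R) : 0 < d -> exists2 M, 0 <= M & forall n, a n <= n%:R * (inf S + d) + M.
  move=> d0; have [_ [k ->] kd] := inf_adherent d0 Sinf.
  exists (\sum_(s < k.+1) a s); first exact: sumr_ge0.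
  move=> n; rewrite {1}(divn_eq n k.+1).
  have amul q s : a (q * k.+1 + s)%N <= q%:R * a k.+1 + a s.
    elim: q => [|q IH]; first by rewrite mul0n mul0r add0r.
    rewrite mulSn -addnA -natr1 mulrDl mul1r addrAC.
    by apply: le_trans (aD _ _) _; rewrite [leLHS]addrC lerD2r.
  apply: le_trans (amul _ _) _; apply: lerD; last first.
    have sk := ltn_pmod n (ltn0Sn k).
    by rewrite (bigD1 (Ordinal sk))//= lerDl sumr_ge0.
  apply: le_trans (_ : (n %/ k.+1)%:R * (k.+1%:R * (inf S + d)) <= _).
    by rewrite ler_wpM2l// -ler_pdivrMl// mulrC ltW.
  rewrite mulrA -natrM; apply: ler_wpM2r; last by rewrite ler_nat leq_trunc_div.
  by apply: le_trans (ltW kd); rewrite divr_ge0.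
have lower n : inf S <= a n.+1 / n.+1%:R by apply: ge_inf => //; [case: Sinf|exists n].
have -> : limn (fun n => a n / n%:R) = inf S.
  apply: cvg_lim => //; apply/cvgrPdist_le => d d0.
  have d20 : 0 < d / 2 by rewrite divr_gt0.
  have [M M0 HM] := upper _ d20.
  exists (Num.truncn (M / (d / 2))).+1 => // -[//|n] /= nM.
  rewrite distrC ger0_norm ?subr_ge0// lerBlDl ler_pdivrMr// mulrC.
  apply: le_trans (HM n.+1) _.
  rewrite [X in _ <= _ * (_ + X)](splitr d) addrA [leRHS]mulrDr lerD2l.
  rewrite -ler_pdivrMr//; apply: le_trans (ltW (truncnS_gt _)) _.
  by rewrite ler_nat.
by move=> e0; have [M _ HM] := upper e e0; exists M.
Qed.

End Fekete.

Section WordGrowth.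
Variables (R : realType) (N : nat) (A : 'M[int]_N) (i0 : 'I_N).
Local Notation C := R[i].

Lemma adm_drop (u : seq 'I_N) a : adm A u -> adm A (drop a u).
Proof.
move=> /asboolP[w Sw wu]; apply/asboolP.
exists (fun t => w (a + t)%N); first by move=> t; rewrite addnS; exact: Sw.
apply: (@eq_from_nth _ i0); rewrite size_pre// => k ks.
rewrite nth_pre// nth_drop -[in RHS]wu nth_pre//.
by move: ks; rewrite size_drop ltn_subRL.
Qed.

Lemma nwordsD m n : (nwords A (m + n) <= nwords A m * nwords A n)%N.
Proof.
rewrite !(nwordsE A i0) -cardsX.
pose h (u : (m + n).-tuple 'I_N) : m.-tuple 'I_N * n.-tuple 'I_N :=
  ([tuple nth i0 u i | i < m], [tuple nth i0 u (m + i) | i < n]).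
have h1 u : val (h u).1 = take m u.
  apply: (@eq_from_nth _ i0); rewrite size_tuple ?size_takel ?size_tuple ?leq_addr// => k km.
  by rewrite nth_take// -[k]/(val (Ordinal km)) -tnth_nth tnth_mktuple.
have h2 u : val (h u).2 = drop m u.
  apply: (@eq_from_nth _ i0); rewrite size_tuple ?size_drop ?size_tuple ?addKn// => k kn.
  by rewrite nth_drop -[k]/(val (Ordinal kn)) -tnth_nth tnth_mktuple.
have hI : injective h.
  move=> u v uv; apply/val_inj; rewrite /= -(cat_take_drop m u) -(cat_take_drop m v).
  by rewrite -!h1 -!h2 uv.
rewrite -(card_imset _ hI); apply/subset_leq_card/fintype.subsetP => x /imsetP[u + ->].
rewrite inE => uA; rewrite finset.in_setX !inE h1 h2 adm_drop// andbT.
exact: (@adm_take N A i0).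
Qed.

Lemma nwords_le_exp (e : R) : 0 < e -> exists2 M, 0 <= M & forall n,
  (nwords A n)%:R <= M * expR (n%:R * (htop R A + e)).
Proof.
(* For an empty shift all word counts are 0 and [ln] would return a junk value, so this case is
   separated; otherwise all counts are positive. *)
move=> e0; have [[w Sw]|no] := pselect (exists w, SigmaA A w); last first.
  exists 0 => // n; rewrite mul0r -[0]/(0%:R) ler_nat leqn0 (nwordsE A i0).
  apply/eqP/eq_card0 => u; rewrite !inE; apply/negP => /asboolP[w Sw _].
  by apply: no; exists w.
have n1 n : (0 < nwords A n)%N.
  rewrite (nwordsE A i0); apply/card_gt0P; exists (pret n w).
  by rewrite inE pretE adm_pre.
have p1 n : 1 <= (nwords A n)%:R :> R by rewrite ler1n.
have p0 n : (nwords A n)%:R \in (Num.pos : {pred R}) by rewrite posrE ltr0n.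
have [||M HM] := @subadditive_limn R (fun n => ln (nwords A n)%:R) _ _ e e0.
- by move=> n; exact: ln_ge0.
- move=> m n; rewrite -lnM// ler_ln ?posrE ?mulr_gt0 ?ltr0n//.
  by rewrite -natrM ler_nat nwordsD.
exists (expR M) => [|n]; first exact: expR_ge0.
by rewrite -expRD addrC -[leLHS]lnK ?ler_expR.
Qed.

Lemma dyadic_between (x y : R) : 0 <= x -> x < y ->
  exists l j, [/\ (0 < j)%N, x < 2 * j%:R / (2 ^ l)%:R & 2 * j%:R / (2 ^ l)%:R < y].
Proof.
move=> x0 xy; have d0 : 0 < y - x by rewrite subr_gt0.
pose l := (Num.truncn (2 / (y - x))).+1.
have l0 : 0 < (2 ^ l)%:R :> R by rewrite ltr0n expn_gt0.
have lb : 2 < (2 ^ l)%:R * (y - x).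
  rewrite -ltr_pdivrMr//; apply: lt_le_trans (truncnS_gt _) _.
  by rewrite -/l ler_nat ltnW// ltn_expl.
have z0 : 0 <= x * (2 ^ l)%:R / 2 by rewrite divr_ge0// mulr_ge0// ltW.
exists l, (Num.truncn (x * (2 ^ l)%:R / 2)).+1; split=> //.
  by rewrite ltr_pdivlMr// [ltRHS]mulrC -ltr_pdivrMr// truncnS_gt.
have /andP[+ _] := truncn_itv z0; rewrite ltr_pdivrMr// -[(Num.truncn _).+1%:R]natr1.
move: l0 lb; set t := (Num.truncn _)%:R; set P := (2 ^ l)%:R => l0 lb; lra.
Qed.

(** With [L = - ln r] the hypothesis reads [h < 2 p L]. A dyadic exponent strictly between
    [h' / (2 L)] and [p] gives [D > h'], and [c] is chosen so that [c * D] is the midpoint of [h']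
    and [D]. A quarter of the gap is given to the word count, and a quarter remains as the geometric
    rate [q]. *)
Lemma params (r p : R) : 0 < r -> r < 1 -> 0 < p -> r `^ (2 * p) * expR (htop R A) < 1 ->
  exists (c r0 Th : R) (l j : nat), [/\ 0 < c, c < 1, (0 < j)%N, 0 < r0 &
   [/\ r0 ^+ (2 ^ l) = r `^ c, 2 * j%:R / (2 ^ l)%:R < p &
   forall m, \sum_(a < m.+1) (nwords A a)%:R * (r0 ^+ (2 * a * j)) ^+ 2 <= Th]].
Proof.
move=> r0 r1 p0; set h := htop R A => hp.
pose L := - ln r; have L0 : 0 < L by rewrite oppr_gt0 ln_lt0// r0.
have {}hp : h < 2 * p * L.
  move: hp; rewrite /powR gt_eqF// -expRD -expR0 ltr_expR /L mulrN; lra.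
(* The truncation at 0 keeps the lower end nonnegative, as [dyadic_between] requires. *)
pose h' := Num.max 0 h; have h'0 : 0 <= h' by rewrite le_max lexx.
have hh' : h <= h' by rewrite le_max lexx orbT.
have {}hp : h' < 2 * p * L by rewrite gt_max hp andbT !mulr_gt0.
have L20 : 0 < 2 * L by rewrite mulr_gt0.
have [l [j [j0 hj jp]]] : exists l j, [/\ (0 < j)%N,
    h' / (2 * L) < 2 * j%:R / (2 ^ l)%:R & 2 * j%:R / (2 ^ l)%:R < p].
  apply: dyadic_between; first by rewrite divr_ge0// ltW.
  by rewrite ltr_pdivrMr// mulrCA mulrA.
move: hj; rewrite ltr_pdivrMr// => hj.
pose D := 2 * j%:R / (2 ^ l)%:R * (2 * L); rewrite -/D in hj.
have D0 : 0 < D by exact: le_lt_trans hj.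
pose c := (h' + D) / (2 * D); have D20 : 0 < 2 * D by rewrite mulr_gt0.
have c0 : 0 < c by rewrite divr_gt0// ltr_wpDl.
have c1 : c < 1 by rewrite ltr_pdivrMr// mul1r; lra.
have cD : c * D = (h' + D) / 2 by rewrite /c; field; rewrite gt_eqF.
pose q := expR (- ((D - h') / 4)).
have q1 : q < 1 by rewrite -expR0 ltr_expR oppr_lt0 divr_gt0// subr_gt0.
have e0 : 0 < (D - h') / 4 by rewrite divr_gt0// subr_gt0.
have [M M0 HM] := nwords_le_exp e0.
exists c, (expR (- (c * L / (2 ^ l)%:R))), (M / (1 - q)), l, j.
split=> //; first exact: expR_gt0.
split=> //.
  rewrite -expRM_natl /powR gt_eqF//; congr expR.
  by rewrite /L; field; rewrite gt_eqF.
move=> m; apply: le_trans (_ : \sum_(a < m.+1) M * q ^+ a <= _); last first.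
  by rewrite -mulr_sumr ler_wpM2l// geo_sum_le// expR_ge0.
apply: ler_sum => a _; apply: le_trans (ler_wpM2r (sqr_ge0 _) (HM a)) _.
rewrite -[leLHS]mulrA ler_wpM2l// -exprM -!expRM_natl -expRD ler_expR.
have -> : (2 * a * j * 2)%:R * - (c * L / (2 ^ l)%:R) = - (a%:R * (c * D)).
  by rewrite !natrM /D; field; rewrite gt_eqF.
rewrite -mulrN -mulrDr ler_wpM2l// cD -/h; lra.
Qed.

(** Write [r = rr * r'] with [rr = r^c] and [r' = r^(1-c)]. The factor [rr^(a^2)] yields
    [kap rr (a + tau)] at the price of [rr^(-2 tau a)] and a constant; [r'^(a^2)] absorbs that price
    and the factor [D^a]. Levels below [M] are covered by boundedness. *)
Lemma kreg_expC (f : seqN N -> C) (r c : R) : inV A f -> 0 < r -> r < 1 -> 0 < c -> c < 1 ->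
  (exists (D : R) (M : nat), forall m : nat, (M <= m)%N ->
      var_le A f m ((D * r ^+ m) ^+ m)) ->
  kreg (r `^ c) A (fun w => expC (f w)).
Proof.
move=> fV r0 r1 c0 c1 [D [M HD]] tau.
set rr := r `^ c; have rr0 : 0 < rr by exact: powR_gt0.
have rr1 : rr < 1.
  by rewrite /rr /powR gt_eqF// -[ltRHS]expR0 ltr_expR pmulr_rlt0// ln_lt0// r0.
pose r' := r `^ (1 - c); have r'0 : 0 < r' by exact: powR_gt0.
have c1' : 0 < 1 - c by rewrite subr_gt0.
have r'1 : r' < 1.
  by rewrite /r' /powR gt_eqF// -[ltRHS]expR0 ltr_expR pmulr_rlt0// ln_lt0// r0.
have rE : r = rr * r'.
  have := @powRD R r c (1 - c); rewrite addrC subrK powRr1 ?(ltW r0)// => -> //.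
  by rewrite gt_eqF// implybT.
have [G G0 HG] := inV_bounded i0 fV.
have [K K0 HK] := expC_lip G.
have [S S0 HS] := kap_superexp r'0 r'1 (b := `|D| / rr ^+ (2 * tau))
  (divr_ge0 (normr_ge0 _) (exprn_ge0 _ (ltW rr0))).
pose B1 := K * S / rr ^+ (tau * tau); pose B2 := K * (2 * G) / kap rr (M + tau).
have kp a : 0 < kap rr a by exact: exprn_gt0.
have B10 : 0 <= B1 by rewrite divr_ge0 ?mulr_ge0 ?exprn_ge0// ltW.
have B20 : 0 <= B2 by rewrite divr_ge0 ?mulr_ge0// ltW.
exists (B1 + B2) => [|a w w' Sw Sw' ww']; first exact: addr_ge0.
have B1le : B1 <= B1 + B2 by rewrite lerDl.
have B2le : B2 <= B1 + B2 by rewrite lerDr.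
apply: le_trans (HK _ _ (HG _ Sw) (HG _ Sw')) _.
have [Ma|aM] := leqP M a; last first.
  apply: le_trans (ler_wpM2r (ltW (kp _)) B2le).
  apply: le_trans (_ : K * (2 * G) <= _).
    rewrite ler_wpM2l//; apply: le_trans (cmodBD _ _) _.
    by rewrite mulr_natl mulr2n lerD ?HG.
  rewrite /B2 mulrAC ler_pdivlMr// ler_wpM2l ?mulr_ge0//.
  apply: ler_wiXn2l; rewrite ?(ltW rr0) ?(ltW rr1)//.
  by rewrite leq_mul// leq_add2r ltnW.
apply: le_trans (ler_wpM2r (ltW (kp _)) B1le).
rewrite /B1 -!mulrA ler_wpM2l//.
apply: le_trans (HD a Ma _ _ Sw Sw' ww') _.
apply: le_trans (ler_norm _) _; rewrite normrX normrM (ger0_norm (exprn_ge0 _ (ltW r0))).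
have -> : (`|D| * r ^+ a) ^+ a = (`|D| / rr ^+ (2 * tau)) ^+ a * kap r' a *
    (rr ^+ (tau * tau))^-1 * kap rr (a + tau).
  have -> : kap rr (a + tau) = rr ^+ (a * a) * rr ^+ (2 * tau) ^+ a * rr ^+ (tau * tau).
    rewrite /kap -!exprM -!exprD; congr (_ ^+ _).
    by rewrite mulnDl !mulnDr mul2n -addnn mulnDl (mulnC a tau) !addnA.
  rewrite exprMn -exprM rE !exprMn exprVn -!exprM -/(kap rr a) -/(kap r' a).
  have : rr ^+ (tau * tau) != 0 by rewrite expf_neq0// gt_eqF.
  have : rr ^+ (2 * tau * a) != 0 by rewrite expf_neq0// gt_eqF.
  move: (rr ^+ (2 * tau * a)) (rr ^+ (tau * tau)) (`|D| ^+ a) (kap rr a) (kap r' a).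
  by move=> x y z u v x0 y0; field; rewrite y0 x0.
rewrite -!mulrA [leLHS]mulrA; apply: ler_wpM2r; last exact: HS.
by rewrite mulr_ge0// ?invr_ge0 ?exprn_ge0// ltW.
Qed.

End WordGrowth.

Unset Implicit Arguments.
Theorem theorem1p2 (R : realType) (N : nat) (A : 'M[int]_N)
  (f : seqN N -> R[i]) (r p : R) (lam : nat -> R[i]) :
  (2 <= N)%N -> zero_one A -> aperiodic A ->
  inV A f ->
  0 < r -> r < 1 ->
  (exists (C : R) (M : nat), forall m : nat, (M <= m)%N ->
      var_le A f m ((C * r ^+ m) ^+ m)) ->
  0 < p -> r `^ (2 * p) * expR (htop R A) < 1 ->
  eigen_enum A f lam ->
  (* (i) *)
  cvgn (series (fun n => cmod (lam n) `^ p)) /\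
  (* (ii) *)
  (forall q : nat, (0 < q)%N -> p <= q%:R ->
     cvgC (fun n => \sum_(j < n) lam j ^+ q) (Zper A f q)) /\
  (* (iii) *)
  (forall k0 : nat, k0_prop A f lam k0 ->
     (forall k : nat, (k < k0)%N -> ~ k0_prop A f lam k) ->
     exists F : R[i] -> R[i],
       (forall rho eps : R, 0 < eps -> exists M : nat, forall n : nat, (M <= n)%N ->
          forall z : R[i], cmod z <= rho ->
            cmod (\prod_(j < n) Efac k0 (z * lam j) - F z) <= eps) /\
       (exists delta : R, 0 < delta /\ forall z : R[i], cmod z < delta ->
          exists s : R[i],
            cvgC (fun n => \sum_(1 <= q < n.+1) z ^+ q / q%:R * Zper A f q) s /\
            expC (- s) =
              expC (- \sum_(1 <= q < k0.+1) z ^+ q / q%:R * Zper A f q) * F z)).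
Proof.
move=> N2 _ _ fV r0 r1 HD p0 hp He.
pose i0 : 'I_N := Ordinal (ltnW N2).
have [c [s [Th [l [j [c0 c1 j0 s0 [sE jp HTh]]]]]]] := params i0 r0 r1 p0 hp.
have gk := kreg_expC i0 fV r0 r1 c0 c1 HD.
have [G G0 HG] := kreg_bounded gk.
have rr0 : 0 < r `^ c by exact: powR_gt0.
have rr1 : r `^ c < 1.
  by rewrite /powR gt_eqF// -[ltRHS]expR0 ltr_expR pmulr_rlt0// ln_lt0// r0.
have [B B0 HB] := @lam_sum_le R _ rr0 rr1 N A i0 f G G0 HG gk lam He s Th l j j0 s0 sE HTh.
split; last split.
- set p' := 2 * j%:R / (2 ^ l)%:R in jp HB.
  apply: nondecreasing_is_cvgn.
    move=> m n mn; rewrite /series /= [leRHS](big_cat_nat (n := m))//= lerDl.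
    by apply: sumr_ge0 => i _; exact: powR_ge0.
  (* The moduli are nonincreasing, so [|lam_i|^p <= |lam_0|^(p - p') * |lam_i|^p']. *)
  exists (cmod (lam 0%N) `^ (p - p') * B) => _ [n _ <-].
  apply: le_trans (ler_wpM2l (powR_ge0 _ _) (HB n)).
  rewrite /series /= big_mkord mulr_sumr; apply: ler_sum => i _.
  have [li|li] := eqVneq (cmod (lam i)) 0.
    by rewrite li powR0 ?gt_eqF// mulr_ge0// powR_ge0.
  have -> : cmod (lam i) `^ p = cmod (lam i) `^ (p - p') * cmod (lam i) `^ p'.
    by rewrite -powRD ?subrK// li implybT.
  rewrite ler_wpM2r ?powR_ge0//.
  apply: ge0_ler_powR; rewrite ?nnegrE ?cmod_ge0 ?subr_ge0 ?(ltW jp)//.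
  exact: lam_decreasing He _ _ _.
- move=> q q0 pq.
  apply: (@lam_trace R _ rr0 rr1 N A i0 f G G0 HG gk lam He s Th l j j0 s0 sE HTh q q0).
  (* The strict inequality between the dyadic exponent and [p] is what admits [q = p]. *)
  exact: lt_le_trans jp pq.
- move=> k0 [Hsum Htr] _; exact: canonical_product.
Qed.
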